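(* Let $\omega\in\mathcal{W}$. There is a constant $C\ge1$, depending only on $\omega$, such that for every analytic function $u$ on $\mathbb{D}$ and every analytic $\phi:\mathbb{D}\to\mathbb{D}$ for which the weighted composition operator $uC_\phi$ is bounded on $A^2(\omega)$, $$\limsup_{|z|\to1}B_\phi(|u|^2)(z)\le\|uC_\phi\|_e^2\le C\limsup_{|z|\to1}B_\phi(|u|^2)(z).$$
   Context: $\mathbb{D}$ is the open unit disk in $\mathbb{C}$, $dA$ is normalized area measure on $\mathbb{D}$, and $H(\mathbb{D})$ is the space of analytic functions on $\mathbb{D}$. For an integrable radial weight $\omega$ on $\mathbb{D}$, $A^2(\omega)$ is the Hilbert space of $f\in H(\mathbb{D})$ with $\|f\|_{2,\omega}^2=\int_{\mathbb{D}}|f(z)|^2\omega(z)\,dA(z)<\infty$. Class $\mathcal{W}$: a weight $\omega$ belongs to $\mathcal{W}$ if it is an integrable radial function of the form $\omega(z)=e^{-\varphi(z)}$ with $\varphi\in\mathcal{C}^2(\mathbb{D})$ real-valued and radial, $\Delta\varphi(z)\ge C>0$ on $\mathbb{D}$ for some constant $C$, and the radial function $\tau(z):=(\Delta\varphi(z))^{-1/2}$ satisfies: $\tau(z)$ decreases to $0$ and $\tau'(z)\to0$ as $|z|\to1^-$ (derivative in the radial variable); and either $\tau(z)(1-|z|)^{-C}$ increases for some $C>0$, or $\lim_{|z|\to1^-}\tau'(z)\log\frac{1}{\tau(z)}=0$. The weighted composition operator is $(uC_\phi)f(z)=u(z)f(\phi(z))$. Let $K_z$ be the reproducing kernel of $A^2(\omega)$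 at $z$ (so $f(z)=\int_{\mathbb{D}}f\,\overline{K_z}\,\omega\,dA$ for $f\in A^2(\omega)$) and $k_z=K_z/\|K_z\|_{2,\omega}$ the normalized kernel. The $\phi$-Berezin transform of $|u|^2$ is $$B_\phi(|u|^2)(z)=\int_{\mathbb{D}}|k_z(\phi(\xi))|^2|u(\xi)|^2\omega(\xi)\,dA(\xi),\quad z\in\mathbb{D}.$$ The essential norm of a bounded operator $T$ on a Banach space $X$ is $\|T\|_e=\inf\{\|T-K\|:K\text{ compact on }X\}$; here $X=A^2(\omega)$. *)

(* Defs.v *)
From HB Require Import structures.
From mathcomp Require Import all_boot all_order all_algebra.
From mathcomp Require Import all_classical all_reals all_analysis.
From mathcomp Require Export complex.

Set Implicit Arguments.
Unset Strict Implicit.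
Unset Printing Implicit Defensive.

Import Order.TTheory GRing.Theory Num.Theory.
Import numFieldNormedType.Exports.
Import Normc.

Local Open Scope classical_set_scope.
Local Open Scope ring_scope.
Local Open Scope complex_scope.

(* Functions on the unit disk are represented by functions on R[i]; only their
   values at points of modulus < 1 are ever used.  Area integrals are taken
   over R * R, transported to R[i] by cplx. *)

Fact invpi_ge0 (R : realType) : 0 <= (pi : R)^-1.
Proof. by rewrite invr_ge0 pi_ge0. Qed.

Section Disk.
Variable R : realType.

Definition cplx (p : R * R) : R[i] := p.1 +i* p.2.

Definition disk : set R[i] := [set z | normc z < 1].

Definition disk2 : set (R * R) := cplx @^-1` disk.

(* R[i]^o carries the complex normed-module structure, so [derivable] along 1
   is complex differentiability. *)
Definition analytic (f : R[i] -> R[i]) : Prop :=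
  forall z, disk z -> derivable (f : R[i]^o -> R[i]^o) z 1.

(* area measure normalized by dA(D) = 1 *)
Definition dA : {measure set _ -> \bar R} :=
  mscale (NngNum (invpi_ge0 R)) (@lebesgue_measure R \x @lebesgue_measure R)%E.

Definition disk_integral (f : R[i] -> R) : \bar R :=
  (\int[dA]_(p in disk2) (f (cplx p))%:E)%E.

(* meaningful when f is integrable *)
Definition disk_cintegral (f : R[i] -> R[i]) : R[i] :=
  (\int[dA]_(p in disk2) complex.Re (f (cplx p)))%R +i*
  (\int[dA]_(p in disk2) complex.Im (f (cplx p)))%R.

(* the filter |z| -> 1^- *)
Definition to_boundary : set_system R[i] :=
  filter_from `]0, 1[ (fun r : R => [set z | r < normc z < 1]).

End Disk.

Section ClassW.
Variable R : realType.

Definition radial (f : R[i] -> R) : Prop :=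
  forall z w, disk z -> disk w -> normc z = normc w -> f z = f w.

Definition dx : R * R := (1, 0).
Definition dy : R * R := (0, 1).

Definition C1_on (U : set (R * R)) (g : R * R -> R) : Prop :=
  forall v, [set dx; dy] v ->
  forall p, U p -> derivable g p v /\ {for p, continuous ('D_v g)}.

Definition C2_on (U : set (R * R)) (g : R * R -> R) : Prop :=
  C1_on U g /\ forall v, [set dx; dy] v -> C1_on U ('D_v g).

Definition laplacian (g : R * R -> R) (p : R * R) : R :=
  'D_dx ('D_dx g) p + 'D_dy ('D_dy g) p.

(* tau at the points of modulus r (tau is radial when phi is) *)
Definition tau (phi : R[i] -> R) (r : R) : R :=
  laplacian (phi \o @cplx R) (r, 0) `^ (- 2^-1).

(* Monotonicity as r -> 1^- is monotonicity on some [r0, 1). *)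
Definition decreases_near1 (f : R -> R) : Prop :=
  exists2 r0, 0 <= r0 < 1 & {in `[r0, 1[ &, {homo f : x y /~ x <= y}}.

Definition increases_near1 (f : R -> R) : Prop :=
  exists2 r0, 0 <= r0 < 1 & {in `[r0, 1[ &, {homo f : x y / x <= y}}.

Definition classW_exponent (phi : R[i] -> R) : Prop :=
  [/\ radial phi,
      C2_on (disk2 (R := R)) (phi \o @cplx R),
      exists2 C : R, 0 < C &
        forall p, disk2 p -> C <= laplacian (phi \o @cplx R) p,
      decreases_near1 (tau phi) /\ tau phi r @[r --> 1^'-] --> (0 : R) &
      [/\ \forall r \near 1^'-, derivable (tau phi) r 1,
          derive1 (tau phi) r @[r --> 1^'-] --> (0 : R) &
          (exists2 C : R, 0 < C &
             increases_near1 (fun r => tau phi r * (1 - r) `^ (- C))) \/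
          derive1 (tau phi) r * ln (tau phi r)^-1 @[r --> 1^'-] --> (0 : R)]].

Definition classW (omega : R[i] -> R) : Prop :=
  [/\ (dA R).-integrable (disk2 (R := R)) (EFin \o (omega \o @cplx R)),
      radial omega &
      exists2 phi, classW_exponent phi &
        forall z, disk z -> omega z = expR (- phi z)].

End ClassW.

Section WeightedBergman.
Variable (R : realType) (omega : R[i] -> R).

Definition A2normsq (f : R[i] -> R[i]) : \bar R :=
  disk_integral (fun z => normc (f z) ^+ 2 * omega z).

Definition A2norm (f : R[i] -> R[i]) : R := Num.sqrt (fine (A2normsq f)).

(* The elements of A^2(omega), extended by 0 off the disk so that distinct
   elements are distinct functions. *)
Definition A2 : set (R[i] -> R[i]) :=
  [set f | [/\ analytic f, forall z, ~ disk z -> f z = 0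
             & (A2normsq f < +oo)%E]].

Definition linear_on_A2 (T : (R[i] -> R[i]) -> (R[i] -> R[i])) : Prop :=
  (forall f, A2 f -> A2 (T f)) /\
  (forall a f g, A2 f -> A2 g ->
     T (fun z => a * f z + g z) = (fun z => a * T f z + T g z)).

Definition bounded_on_A2 (T : (R[i] -> R[i]) -> (R[i] -> R[i])) : Prop :=
  linear_on_A2 T /\
  exists M : R, forall f, A2 f -> A2norm (T f) <= M * A2norm f.

Definition compact_on_A2 (T : (R[i] -> R[i]) -> (R[i] -> R[i])) : Prop :=
  linear_on_A2 T /\
  forall (M : R) (f : nat -> R[i] -> R[i]),
    (forall n, A2 (f n) /\ A2norm (f n) <= M) ->
    exists s : nat -> nat, exists2 g, A2 g &
      {homo s : m n / (m < n)%N} /\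
      A2norm (fun z => T (f (s n)) z - g z) @[n --> \oo] --> (0 : R).

Definition opnorm (T : (R[i] -> R[i]) -> (R[i] -> R[i])) : \bar R :=
  ereal_sup [set (A2norm (T f))%:E | f in [set f | A2 f /\ A2norm f <= 1]].

Definition essnorm (T : (R[i] -> R[i]) -> (R[i] -> R[i])) : \bar R :=
  ereal_inf [set opnorm (fun f z => T f z - K f z) | K in compact_on_A2].

Definition is_kernel_at (z : R[i]) (k : R[i] -> R[i]) : Prop :=
  A2 k /\
  forall f, A2 f ->
    f z = disk_cintegral (fun xi => f xi * (k xi)^*%C * (omega xi)%:C).

(* the function k with [is_kernel_at z k] *)
Definition kernel (z : R[i]) : R[i] -> R[i] := xget (fun=> 0) (is_kernel_at z).

Definition nkernel (z xi : R[i]) : R[i] :=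
  kernel z xi / (A2norm (kernel z))%:C.

Definition wcomp (u phi f : R[i] -> R[i]) : R[i] -> R[i] :=
  patch (fun=> 0) (@disk R) (fun z => u z * f (phi z)).

Definition berezin (u phi : R[i] -> R[i]) (z : R[i]) : \bar R :=
  disk_integral
    (fun xi => normc (nkernel z (phi xi)) ^+ 2 * normc (u xi) ^+ 2 * omega xi).

Definition berezin_limsup (u phi : R[i] -> R[i]) : \bar R :=
  limf_esup (berezin u phi : R[i]^o -> \bar R) (@to_boundary R).

End WeightedBergman.

(* Main.v *)
Require Import Defs.
From HB Require Import structures.
From mathcomp Require Import all_boot all_order all_algebra.
From mathcomp Require Import all_classical all_reals all_analysis.
From mathcomp Require Import measurable_realfun ring lra.
Import Order.TTheory GRing.Theory Num.Theory.
Import numFieldNormedType.Exports.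
Import Normc.

(** Write T for the weighted composition operator u C_phi, K_w for the kernel,
k_w for its normalization and B for the phi-Berezin transform of |u|^2, so that
B(w) is the squared norm of T k_w.

Lower bound.  The k_w tend weakly to 0 as |w| -> 1 ([kernel_weak_null]): a
function of the space is a polynomial plus a small remainder, and K_w(w) tends
to infinity.  Hence every compact operator K satisfies |K k_w| -> 0
([compact_kills_kernels]), and limsup |T k_w| <= |T - K|.

Upper bound.  Let S_N and R_N be the Taylor section of order N and its
remainder.  Then T S_N is compact ([truncation_compact]) and the essential norm
is at most the norm of T R_N.  Where phi stays in a compact disk, R_N f is
uniformly small ([Rn_small]).  Where |phi| is close to 1 one uses the pointwise
inequality [domination]: for |v| close to 1,
  |g(v)|^2 <= C * integral over r' < |w| < 1 of |g(w)|^2 omega(w) |k_w(v)|^2.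
Putting v = phi(xi), multiplying by |u|^2 omega and integrating, Tonelli's
theorem turns the inner integral into B(w), so that this part of |T g|^2 is at
most C * |g|^2 * sup B over the annulus ([outer_part]).

The inequality [domination] is where the class W is used.  Put m(r) = r phi'(r)
and tau = (Delta phi)^(-1/2); the polar form of the Laplacian reads
m' = r / tau^2.  The function r^(2n) omega(r) peaks where m(r) = 2n, and since
tau' -> 0 the peak has width comparable to tau ([peak], [plateau]).  Two
consequences: the n-th moment is at most C r^(2n) omega(r) tau(r) for about
1 / tau(r) indices n, which bounds K_w(w) from below by c / (omega tau^2)
([KK_ge]); and on a disk of radius tau around z, |v^n|^2 omega(v) is constant up
to a factor, for 2n near m(|z|), so that f(v) v^(-n) is subject to unweighted
estimates.  The sub-mean value property gives the matching upper bound
([local_bound], [KK_le]), and Cauchy's estimate for K_w(v) v^(-n) shows that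
|k_w(v)|^2 is at least c / (omega(v) tau(v)^2) for |w - v| <= delta tau
([near_diag]).

The space itself is handled through Taylor coefficients: monomials are
orthogonal for any radial weight, so the squared norm of f is the sum of
|c_n|^2 times the n-th moment ([bessel], [parseval_le]).  The Taylor expansion
of a complex differentiable function is obtained from Cauchy's formula, proved
by bisecting rectangles in the parameters of a family of contracting circles
([cauchy_const], [taylor]). *)

Set Implicit Arguments.
Unset Strict Implicit.
Unset Printing Implicit Defensive.
Local Open Scope classical_set_scope.
Local Open Scope ring_scope.
Local Open Scope complex_scope.
Local Notation RE := (@complex.Re _).
Local Notation IM := (@complex.Im _).

(** * Modulus and complex derivative *)

Section ComplexNorm.
Variable R : realType.
Implicit Types (x y z : R[i]) (a : R).

Lemma normc_ge0 z : 0 <= normc z.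
Proof. by case: z => a b; rewrite sqrtr_ge0. Qed.

Lemma normc_sqr z : normc z ^+ 2 = complex.Re z ^+ 2 + complex.Im z ^+ 2.
Proof. by case: z => a b /=; rewrite sqr_sqrtr // addr_ge0 ?sqr_ge0. Qed.

Lemma normc_real a : normc a%:C = `|a|.
Proof. by rewrite /= expr0n addr0 sqrtr_sqr. Qed.

Lemma normcB x y : normc (x - y) = normc (y - x).
Proof. by rewrite -opprB normcN. Qed.

Lemma normc_gt0 z : (0 < normc z) = (z != 0).
Proof.
rewrite lt_def normc_ge0 andbT; congr (~~ _); apply/eqP/eqP => [|->].
  exact: eq0_normc.
exact: normc0.
Qed.

Lemma le_normc_Re z : `|complex.Re z| <= normc z.
Proof.
by rewrite -(ler_pXn2r (n := 2)) ?nnegrE ?normc_ge0 // normc_sqr real_normK ?num_real // lerDl sqr_ge0.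
Qed.

Lemma le_normc_Im z : `|complex.Im z| <= normc z.
Proof.
by rewrite -(ler_pXn2r (n := 2)) ?nnegrE ?normc_ge0 // normc_sqr real_normK ?num_real // lerDr sqr_ge0.
Qed.

Lemma normc_le_ReIm z : normc z <= `|complex.Re z| + `|complex.Im z|.
Proof.
rewrite -(ler_pXn2r (n := 2)) ?nnegrE ?normc_ge0 ?addr_ge0 //.
rewrite normc_sqr sqrrD !real_normK ?num_real // lerD2r lerDl.
by rewrite mulrn_wge0 // mulr_ge0.
Qed.

Lemma normcX z n : normc (z ^+ n) = normc z ^+ n.
Proof. by elim: n => [|n ih]; rewrite ?expr0 ?normc1 // !exprS normcM ih. Qed.

Lemma normc_conj z : normc z^*%C = normc z.
Proof. by case: z => a b /=; rewrite sqrrN. Qed.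

Lemma normc_sum (I : Type) (s : seq I) (P : pred I) (F : I -> R[i]) :
  normc (\sum_(i <- s | P i) F i) <= \sum_(i <- s | P i) normc (F i).
Proof.
elim/big_rec2: _ => [|i a z _ le]; first by rewrite normc0.
by rewrite (le_trans (le_normcD _ _)) // lerD2l.
Qed.

Lemma normc_sumn n (F : nat -> R[i]) :
  normc (\sum_(i < n) F i) <= \sum_(i < n) normc (F i).
Proof. exact: normc_sum. Qed.

Lemma ler_normcD x y a b : normc x <= a -> normc y <= b -> normc (x + y) <= a + b.
Proof. by move=> xa yb; rewrite (le_trans (le_normcD _ _)) // lerD. Qed.

Lemma ler_normcB x y : normc x - normc y <= normc (x - y).
Proof. by rewrite lerBlDr -{1}(subrK y x) le_normcD. Qed.

Lemma cReD x y : complex.Re (x + y) = complex.Re x + complex.Re y.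
Proof. by case: x y => ? ? []. Qed.
Lemma cImD x y : complex.Im (x + y) = complex.Im x + complex.Im y.
Proof. by case: x y => ? ? []. Qed.
Lemma cReN x : complex.Re (- x) = - complex.Re x.
Proof. by case: x. Qed.
Lemma cImN x : complex.Im (- x) = - complex.Im x.
Proof. by case: x. Qed.
Lemma cReM x y : complex.Re (x * y) = complex.Re x * complex.Re y - complex.Im x * complex.Im y.
Proof. by case: x y => ? ? []. Qed.
Lemma cImM x y : complex.Im (x * y) = complex.Re x * complex.Im y + complex.Im x * complex.Re y.
Proof. by case: x y => ? ? []. Qed.

Lemma complex_ext x y : complex.Re x = complex.Re y -> complex.Im x = complex.Im y -> x = y.
Proof. by case: x y => a b [c d] /= -> ->. Qed.

End ComplexNorm.

Section Cder.
Variable R : realType.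
Implicit Types (f g : R[i] -> R[i]) (z l : R[i]).

(** Stated without a quotient, so that it holds trivially at w = z and passes
through sums, products and compositions by the triangle inequality alone. *)
Definition cder f z l := forall e : R, 0 < e -> exists2 d : R, 0 < d &
  forall w, normc (w - z) < d ->
    normc (f w - f z - l * (w - z)) <= e * normc (w - z).

Lemma ltc_real (a : R) (x : R[i]) : (`|x| < a%:C) = (normc x < a).
Proof. by rewrite normc_def ltcR; case: x. Qed.

(** The norm used by [derivable] takes its values in R[i]; both sides say that
the difference quotients converge in modulus. *)
Lemma derivable_cder f z :
  derivable (f : R[i]^o -> R[i]^o) z 1 <-> exists l, cder f z l.
Proof.
split=> [/cvg_ex[l Hl]|[l Hl]].
  exists l => e e0.
  have ec0 : 0 < e%:C :> R[i] by rewrite ltcR.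
  move/cvgrPdist_le: Hl => /(_ _ ec0) /=.
  move=> /nbhs_ballP[d /= d0 Hd].
  have dR : d = (complex.Re d)%:C.
    by apply: complex_ext => //=; apply/ger0_Im/ltW.
  exists (complex.Re d); first by move: d0; rewrite dR ltcR.
  move=> w wd; have [->|wz] := eqVneq w z.
    by rewrite !subrr mulr0 subr0 !normc0 mulr0.
  have h0 : w - z != 0 by rewrite subr_eq0.
  have /= := Hd (w - z).
  rewrite /ball /= sub0r normrN dR ltc_real => /(_ wd h0).
  rewrite normc_def lecR /= -[GRing.scale _ _]/((w - z)^-1 * _).
  rewrite scaler1 subrK => le.
  rewrite -ler_pdivrMr ?normc_gt0 // -normcV -normcM.
  have -> : (f w - f z - l * (w - z)) / (w - z) =
            - (l - (w - z)^-1 * (f w - f z)) by field.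
  rewrite normcN; apply: le_trans le; by case: (_ - _).
apply/cvg_ex; exists l; apply/cvgrPdist_le => e e0.
have eR : e = (complex.Re e)%:C.
  by apply: complex_ext => //=; apply/ger0_Im/ltW.
have e0' : 0 < complex.Re e by move: e0; rewrite {1}eR ltcR.
have [d d0 Hd] := Hl _ e0'.
apply/nbhs_ballP; exists d%:C => /=; first by rewrite ltcR.
move=> h; rewrite /ball /= sub0r normrN ltc_real => hd h0.
have := Hd (h + z); rewrite addrK => /(_ hd) le.
rewrite eR scaler1 -[GRing.scale _ _]/(h^-1 * _).
have -> : l - h^-1 * (f (h + z) - f z) = - ((f (h + z) - f z - l * h) / h).
  by field.
rewrite normrN normc_def lecR.
have -> : forall x : R[i], Num.sqrt (complex.Re x ^+ 2 + complex.Im x ^+ 2) = normc x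
  by case.
by rewrite normcM normcV ler_pdivrMr ?normc_gt0.
Qed.

Lemma cder_cont f z l : cder f z l -> forall e : R, 0 < e -> exists2 d : R, 0 < d &
  forall w, normc (w - z) < d -> normc (f w - f z) < e.
Proof.
move=> fl e e0; have [d d0 H] := fl 1 ltr01.
have L0 : 0 < normc l + 1 by rewrite ltr_wpDl ?normc_ge0.
exists (Num.min d (e / (normc l + 1))); first by rewrite lt_min d0 divr_gt0.
move=> w; rewrite lt_min => /andP[wd we].
have -> : f w - f z = (f w - f z - l * (w - z)) + l * (w - z) by ring.
rewrite (le_lt_trans (le_normcD _ _)) //.
rewrite normcM (le_lt_trans (lerD (H _ wd) (lexx _))) // -mulrDl addrC mulrC.
by rewrite -ltr_pdivlMr.
Qed.

Lemma cder_shift f z a l : cder f (a + z) l -> cder (fun w => f (a + w)) z l.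
Proof.
move=> H e e0; have [d d0 Hd] := H e e0; exists d => // w wd.
have := Hd (a + w); have -> : a + w - (a + z) = w - z by ring.
exact.
Qed.

End Cder.

(** * Integrals of complex functions of a real variable *)

Section CurveIntegral.
Variable R : realType.
Implicit Types (g h : R -> R[i]) (a b c x y : R).
Local Notation mu := (@lebesgue_measure R).

Definition cts h x := {for x, continuous (RE \o h)} /\
                      {for x, continuous (IM \o h)}.

Lemma ctsP h x : cts h x <-> forall e : R, 0 < e -> exists2 d : R, 0 < d &
  forall y, `|y - x| < d -> normc (h y - h x) < e.
Proof.
split=> [[Hr Hi] e e0|H].
  have e2 : 0 < e / 2 by rewrite divr_gt0.
  move/cvgrPdist_lt: Hr => /(_ _ e2) /nbhs_ballP[d1 /= d10 H1].
  move/cvgrPdist_lt: Hi => /(_ _ e2) /nbhs_ballP[d2 /= d20 H2].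
  exists (Num.min d1 d2) => [|y]; first by rewrite lt_min d10.
  rewrite lt_min => /andP[y1 y2].
  rewrite (le_lt_trans (normc_le_ReIm _)) // cReD cImD cReN cImN [e]splitr.
  by rewrite ltrD // distrC; [apply: H1|apply: H2]; rewrite /ball /= distrC.
split; apply/cvgrPdist_lt => e e0; have [d d0 Hd] := H e e0;
  apply/nbhs_ballP; exists d => //= y; rewrite /ball /= distrC => /Hd;
  apply: le_lt_trans; rewrite distrC.
  by rewrite -cReN -cReD le_normc_Re.
by rewrite -cImN -cImD le_normc_Im.
Qed.

Lemma cts_cst (z : R[i]) x : cts (fun=> z) x.
Proof. by split; apply: cvg_cst. Qed.

Lemma ctsD g h x : cts g x -> cts h x -> cts (fun y => g y + h y) x.
Proof.
move=> [g1 g2] [h1 h2]; split.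
  rewrite (_ : _ \o _ = (RE \o g) \+ (RE \o h)).
    exact: cvgD.
  by apply/funext => y /=; rewrite cReD.
rewrite (_ : _ \o _ = (IM \o g) \+ (IM \o h)).
  exact: cvgD.
by apply/funext => y /=; rewrite cImD.
Qed.

Lemma ctsM g h x : cts g x -> cts h x -> cts (fun y => g y * h y) x.
Proof.
move=> [g1 g2] [h1 h2]; split.
  rewrite (_ : _ \o _ = (fun y => (RE \o g) y * (RE \o h) y
     - (IM \o g) y * (IM \o h) y)).
    by apply: cvgB; apply: cvgM.
  by apply/funext => y /=; rewrite cReM.
rewrite (_ : _ \o _ = (fun y => (RE \o g) y * (IM \o h) y
     + (IM \o g) y * (RE \o h) y)).
  by apply: cvgD; apply: cvgM.
by apply/funext => y /=; rewrite cImM.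
Qed.

Lemma cts_real (u : R -> R) x : {for x, continuous u} -> cts (fun y => (u y)%:C) x.
Proof. by move=> uc; split => //=; apply: cvg_cst. Qed.

Lemma ctsN g x : cts g x -> cts (fun y => - g y) x.
Proof.
move=> [g1 g2]; split.
  rewrite (_ : _ \o _ = fun y => - (RE \o g) y); first exact: cvgN.
  by apply/funext => y /=; rewrite cReN.
rewrite (_ : _ \o _ = fun y => - (IM \o g) y); first exact: cvgN.
by apply/funext => y /=; rewrite cImN.
Qed.

Lemma ctsB g h x : cts g x -> cts h x -> cts (fun y => g y - h y) x.
Proof. by move=> gc hc; apply: ctsD; [exact: gc|exact: ctsN]. Qed.

Lemma cts_comp (f : R[i] -> R[i]) l g x : cts g x -> cder f (g x) l ->
  cts (f \o g) x.
Proof.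
move=> /ctsP gc fc; apply/ctsP => e e0.
have [d d0 Hd] := cder_cont fc e0; have [d' d'0 Hd'] := gc d d0.
by exists d' => // y /Hd' /Hd.
Qed.

(** e^(ix) *)
Definition eis x : R[i] := cos x +i* sin x.

Lemma normc_eis x : normc (eis x) = 1.
Proof. by rewrite /= cos2Dsin2 sqrtr1. Qed.

Lemma eisD x y : eis (x + y) = eis x * eis y.
Proof. by apply: complex_ext; rewrite ?cReM ?cImM /= ?cosD ?sinD //; ring. Qed.

Lemma eis0 : eis 0 = 1.
Proof. by apply: complex_ext; rewrite /= ?cos0 ?sin0. Qed.

Lemma eis_neq0 x : eis x != 0.
Proof. by rewrite -normc_gt0 normc_eis. Qed.

Lemma eisN x : eis (- x) = (eis x)^-1.
Proof.
apply: (mulIf (eis_neq0 x)); rewrite -eisD addNr eis0 mulVf //.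
exact: eis_neq0.
Qed.

Lemma eisMn x n : eis (n%:R * x) = eis x ^+ n.
Proof.
elim: n => [|n ih]; first by rewrite mul0r eis0 expr0.
by rewrite exprS -ih -natr1 mulrDl mul1r addrC eisD.
Qed.

Lemma eis2pi : eis (pi *+ 2) = 1.
Proof. by apply: complex_ext; rewrite /= ?cos2pi ?sin2pi. Qed.

Lemma cts_eis (k : R) x : cts (fun y => eis (k * y)) x.
Proof.
have kc : {for x, continuous (fun y : R => k * y)}.
  by apply: cvgM; [exact: cvg_cst|exact: cvg_id].
split=> /=.
  by apply: (continuous_comp kc); exact: continuous_cos.
by apply: (continuous_comp kc); exact: continuous_sin.
Qed.

Definition RI a b (h : R -> R) : R := \int[mu]_(x in `[a, b]) h x.

Definition CI a b h : R[i] :=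
  RI a b (RE \o h) +i* RI a b (IM \o h).

Definition ccts a b h := forall x, a <= x <= b -> cts h x.

Let rcts a b (h : R -> R) := forall x, a <= x <= b -> {for x, continuous h}.

Lemma rcts_integrable a b (h : R -> R) : rcts a b h -> mu.-integrable `[a, b] (EFin \o h).
Proof.
move=> hc; apply: continuous_compact_integrable; first exact: segment_compact.
by apply: continuous_in_subspaceT => x /set_mem /=; rewrite in_itv /= => /hc.
Qed.

Lemma RI_split a b c (h : R -> R) : a <= b -> b <= c -> rcts a c h ->
  RI a c h = RI a b h + RI b c h.
Proof.
move=> ab bc hc; have hI := rcts_integrable hc.
have H := Rintegral_itvB hI (x := b).
have Hs : mu.-integrable `]b, c] (EFin \o h).
  apply: integrableS hI => // x /=; rewrite !in_itv /= => /andP[/ltW bx ->].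
  by rewrite (le_trans ab).
have : RI a c h - RI a b h = \int[mu]_(x in `]b, c]) h x.
  by apply: H; rewrite bnd_simp.
rewrite Rintegral_itv_obnd_cbnd // => /eqP; rewrite subr_eq => /eqP ->.
by rewrite addrC.
Qed.

Lemma RI_FTC a b (G g : R -> R) : a <= b ->
  (forall x, is_derive x 1 G (g x)) -> continuous g ->
  RI a b g = G b - G a.
Proof.
rewrite le_eqVlt => /predU1P[<-|ab] dG gc.
  by rewrite /RI set_itv1 Rintegral_set1 subrr.
have Gc : continuous G.
  move=> x; apply/differentiable_continuous/derivable1_diffP.
  by have [] := dG x.
rewrite /RI /Rintegral (@continuous_FTC2 _ g G) //.
- by apply: continuous_subspaceT.
- split.
  + by move=> x _; have [] := dG x.
  + exact/cvg_at_right_filter/Gc.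
  + exact/cvg_at_left_filter/Gc.
- by move=> x _; rewrite derive1E; have [] := dG x.
Qed.

Lemma CI_add a b g h : ccts a b g -> ccts a b h ->
  CI a b (fun x => g x + h x) = CI a b g + CI a b h.
Proof.
move=> gc hc.
have gr : rcts a b (RE \o g) by move=> x /gc[].
have gi : rcts a b (IM \o g) by move=> x /gc[].
have hr : rcts a b (RE \o h) by move=> x /hc[].
have hi : rcts a b (IM \o h) by move=> x /hc[].
apply: complex_ext; rewrite ?cReD ?cImD /= /RI -RintegralD //;
  try exact: rcts_integrable; apply: eq_Rintegral => x _ /=.
  exact: cReD.
exact: cImD.
Qed.

Lemma CI_mul a b (z : R[i]) h : ccts a b h ->
  CI a b (fun x => z * h x) = z * CI a b h.
Proof.
move=> hc.
have hr : rcts a b (RE \o h) by move=> x /hc[].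
have hi : rcts a b (IM \o h) by move=> x /hc[].
have Z k (u : R -> R) : rcts a b u -> rcts a b (fun x => k * u x).
  by move=> uc x /uc; apply: cvgM; exact: cvg_cst.
apply: complex_ext; rewrite ?cReM ?cImM /= /RI -!RintegralZl //;
  try exact: rcts_integrable; rewrite -?RintegralD -?RintegralB //;
  try (by apply: rcts_integrable; exact: Z); apply: eq_Rintegral => x _ /=.
  exact: cReM.
exact: cImM.
Qed.

Lemma CI_sub a b g h : ccts a b g -> ccts a b h ->
  CI a b (fun x => g x - h x) = CI a b g - CI a b h.
Proof.
move=> gc hc; rewrite -[in RHS]mulN1r -CI_mul; last exact: hc.
rewrite -CI_add; [|exact: gc|].
  by congr CI; apply/funext => x; rewrite mulN1r.
by move=> x xab; apply: ctsM; [exact: cts_cst|exact: hc].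
Qed.

Lemma CI_split a b c h : a <= b -> b <= c -> ccts a c h ->
  CI a c h = CI a b h + CI b c h.
Proof.
move=> ab bc hc.
have hr : rcts a c (RE \o h) by move=> x /hc[].
have hi : rcts a c (IM \o h) by move=> x /hc[].
by apply: complex_ext; rewrite ?cReD ?cImD /=; exact: RI_split.
Qed.

Lemma eq_CI a b g h : (forall x, a <= x <= b -> g x = h x) -> CI a b g = CI a b h.
Proof.
by move=> gh; apply: complex_ext => /=; apply: eq_Rintegral => x /set_mem /=;
  rewrite in_itv /= => /gh ->.
Qed.

Lemma RI_bound a b (h : R -> R) M : a <= b -> rcts a b h ->
  (forall x, a <= x <= b -> `|h x| <= M) -> `|RI a b h| <= (b - a) * M.
Proof.
move=> ab hc hM.
rewrite (le_trans (le_normr_Rintegral _ (rcts_integrable hc))) //.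
have cM : \int[mu]_(x in `[a, b]) M = (b - a) * M.
  rewrite Rintegral_cst // mulrC; congr (_ * _).
  by rewrite /= lebesgue_measure_itv /= lte_fin; case: ltgtP ab => //= -> _; rewrite subrr.
rewrite -cM; apply: le_Rintegral => //.
- by apply: rcts_integrable => x /hc; exact: cvg_norm.
- by apply: rcts_integrable => x _; exact: cvg_cst.
Qed.

(** The integral is taken componentwise; estimating the two components
separately costs the factor 2. *)
Lemma CI_bound a b h M : a <= b -> ccts a b h ->
  (forall x, a <= x <= b -> normc (h x) <= M) ->
  normc (CI a b h) <= 2 * (b - a) * M.
Proof.
move=> ab hc hM; rewrite (le_trans (normc_le_ReIm _)) //.
rewrite -mulrA mulr_natl mulr2n; apply: lerD; apply: (RI_bound ab).
- by move=> x /hc[].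
- by move=> x xab; apply: le_trans (hM x xab); exact: le_normc_Re.
- by move=> x /hc[].
- by move=> x xab; apply: le_trans (hM x xab); exact: le_normc_Im.
Qed.

(** The derivative of e^(ikx). *)
Lemma CI_eis a b (k : R) : a <= b ->
  CI a b (fun x => ('i%C * k%:C) * eis (k * x)) = eis (k * b) - eis (k * a).
Proof.
move=> ab.
have kd x : is_derive x 1 (fun y : R => k * y) k.
  by apply: is_derive_eq; rewrite -[RHS]mulr1.
have kc : continuous (fun y : R => k * y).
  by move=> x; apply: cvgM; [exact: cvg_cst|exact: cvg_id].
apply: complex_ext; rewrite ?cReD ?cImD ?cReN ?cImN /=.
  apply: (@RI_FTC _ _ (fun x => cos (k * x))) => //.
    move=> x /=.
    have := @is_derive1_comp _ cos (fun y => k * y) x _ _ (is_derive_cos _) (kd x).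
    by move=> H; apply: is_derive_eq; ring.
  move=> x /=.
  rewrite (_ : (_ \o _) = fun y => - k * sin (k * y)); last first.
    by apply/funext => y /=; ring.
  apply: cvgM; first exact: cvg_cst.
  by apply: (continuous_comp (kc x)); exact: continuous_sin.
apply: (@RI_FTC _ _ (fun x => sin (k * x))) => //.
  move=> x /=.
  have := @is_derive1_comp _ sin (fun y => k * y) x _ _ (is_derive_sin _) (kd x).
  by move=> H; apply: is_derive_eq; ring.
move=> x /=.
rewrite (_ : (_ \o _) = fun y => k * cos (k * y)); last first.
  by apply/funext => y /=; ring.
apply: cvgM; first exact: cvg_cst.
by apply: (continuous_comp (kc x)); exact: continuous_cos.
Qed.

Lemma CI_cst a b (z : R[i]) : a <= b -> CI a b (fun=> z) = (b - a)%:C * z.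
Proof.
move=> ab.
have cM M : \int[mu]_(x in `[a, b]) M = (b - a) * M.
  rewrite Rintegral_cst // mulrC; congr (_ * _).
  by rewrite /= lebesgue_measure_itv /= lte_fin; case: ltgtP ab => //= -> _; rewrite subrr.
by apply: complex_ext; rewrite ?cReM ?cImM /= /RI cM; ring.
Qed.

End CurveIntegral.

(** * Bisection of rectangles *)

Section Bisection.
Variable R : realType.

Lemma exp2_gt (x : R) : exists n : nat, x < 2 ^+ n.
Proof.
exists (Num.bound x); apply: lt_le_trans (_ : (Num.bound x)%:R <= _).
  by have := archi_boundP; move=> /(_ R); case: (lerP 0 x) => [x0 /(_ _ x0)//|x0 _];
     rewrite (lt_le_trans x0).
by rewrite -natrX ler_nat ltnW // ltn_expl.
Qed.

Lemma between_seqs (u v : nat -> R) : (forall n m, u n <= v m) ->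
  exists x, forall n, u n <= x <= v n.
Proof.
move=> uv; exists (sup (range u)) => n.
have su : has_sup (range u).
  by split; [exists (u 0%N); exists 0%N|exists (v 0%N) => _ [m _ <-]].
apply/andP; split; first by apply: ub_le_sup; [case: su|exists n].
by apply: ge_sup; [case: su|move=> _ [m _ <-]].
Qed.

(** Goursat's argument, freed from the integrand.  One of the four quarters of a
rectangle carries at least a quarter of J; the rectangles so chosen shrink to a
point, and there the local bound makes the n-th value of J smaller than
4^(-n) J X Y A B. *)
Lemma bisection_vanish (J : R -> R -> R -> R -> R) X Y A B : 0 < A -> 0 < B ->
  (forall x y a b, X <= x -> x + a <= X + A -> Y <= y -> y + b <= Y + B ->
    0 < a -> 0 < b ->
    J x y a b <= J x y (a / 2) (b / 2) + J (x + a / 2) y (a / 2) (b / 2) +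
      (J x (y + b / 2) (a / 2) (b / 2) +
       J (x + a / 2) (y + b / 2) (a / 2) (b / 2))) ->
  (forall x0 y0, X <= x0 <= X + A -> Y <= y0 <= Y + B ->
    forall e : R, 0 < e -> exists2 d : R, 0 < d & forall x y a b,
    X <= x -> x + a <= X + A -> Y <= y -> y + b <= Y + B ->
    x <= x0 <= x + a -> y <= y0 <= y + b -> 0 < a < d -> 0 < b < d ->
    J x y a b <= e * (a + b) ^+ 2) ->
  J X Y A B <= 0.
Proof.
move=> A0 B0 sub loc; rewrite leNgt; apply/negP => J0.
pose a n := A / 2 ^+ n; pose b n := B / 2 ^+ n.
have a0 n : 0 < a n by rewrite divr_gt0 // exprn_gt0.
have b0 n : 0 < b n by rewrite divr_gt0 // exprn_gt0.
have aS n : a n.+1 = a n / 2 by rewrite /a exprSr invfM mulrA.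
have bS n : b n.+1 = b n / 2 by rewrite /b exprSr invfM mulrA.
pose inR n (p : R * R) := [/\ X <= p.1, p.1 + a n <= X + A, Y <= p.2 & p.2 + b n <= Y + B].
have step (np : nat * (R * R)) : exists q : R * R, inR np.1 np.2 ->
   [/\ inR np.1.+1 q, np.2.1 <= q.1, q.1 + a np.1.+1 <= np.2.1 + a np.1,
      np.2.2 <= q.2 /\ q.2 + b np.1.+1 <= np.2.2 + b np.1
    & J np.2.1 np.2.2 (a np.1) (b np.1) <= 4 * J q.1 q.2 (a np.1.+1) (b np.1.+1)].
  case: np => n [x y] /=.
  have [iR|niR] := pselect (inR n (x, y)); last by exists (x, y).
  case: (iR) => /= h1 h2 h3 h4.
  have := sub x y (a n) (b n) h1 h2 h3 h4 (a0 n) (b0 n); rewrite -aS -bS.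
  set J1 := J _ _ _ _; set J2 := J _ _ _ _; set J3 := J _ _ _ _.
  set J4 := J _ _ _ _; set J5 := J _ _ _ _ => Jle.
  have aa : a n.+1 + a n.+1 = a n by rewrite aS -splitr.
  have bb : b n.+1 + b n.+1 = b n by rewrite bS -splitr.
  have xl : x <= x + a n.+1 by rewrite lerDl ltW.
  have yl : y <= y + b n.+1 by rewrite lerDl ltW.
  have xr : x + a n.+1 <= x + a n by rewrite -aa addrA lerDl ltW.
  have yr : y + b n.+1 <= y + b n by rewrite -bb addrA lerDl ltW.
  have [Xl Xr] := (le_trans h1 xl, le_trans xr h2).
  have [Yl Yr] := (le_trans h3 yl, le_trans yr h4).
  have [k1|k1] := lerP J1 (4 * J2).
    by exists (x, y) => _; split => //=; split.
  have [k2|k2] := lerP J1 (4 * J3).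
    by exists (x + a n.+1, y) => _; split => //=; [split|]; rewrite /= -?addrA ?aa.
  have [k3|k3] := lerP J1 (4 * J4).
    by exists (x, y + b n.+1) => _; split => //=; [split| split]; rewrite /= -?addrA ?bb.
  have k4 : J1 <= 4 * J5.
    by clear -k1 k2 k3 Jle; lra.
  exists (x + a n.+1, y + b n.+1) => _.
  by split => //=; [split| |split]; rewrite /= -?addrA ?aa ?bb.
have [f Hf] := choice step.
pose p := fix p n := if n is m.+1 then f (m, p m) else (X, Y).
have a00 : a 0%N = A by rewrite /a expr0 divr1.
have b00 : b 0%N = B by rewrite /b expr0 divr1.
have pR n : inR n (p n).
  elim: n => [|n ih]; first by split; rewrite /= ?a00 ?b00.
  by have [] := Hf (n, p n) ih.
have pJ n : J X Y A B <= 4 ^+ n * J (p n).1 (p n).2 (a n) (b n).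
  elim: n => [|n ih]; first by rewrite expr0 mul1r /= a00 b00.
  rewrite (le_trans ih) // exprSr -mulrA ler_pM2l ?exprn_gt0 //.
  by have [] := Hf (n, p n) (pR n).
have mono1 n k : (p n).1 <= (p (n + k)%N).1 /\ (p (n + k)%N).1 + a (n + k)%N <= (p n).1 + a n.
  elim: k => [|k [ih1 ih2]]; first by rewrite addn0.
  have [_ H1 H2 _ _] := Hf ((n + k)%N, p (n + k)%N) (pR _).
  by rewrite addnS; split; [apply: le_trans H1|apply: le_trans ih2].
have mono2 n k : (p n).2 <= (p (n + k)%N).2 /\ (p (n + k)%N).2 + b (n + k)%N <= (p n).2 + b n.
  elim: k => [|k [ih1 ih2]]; first by rewrite addn0.
  have [_ _ _ [H1 H2] _] := Hf ((n + k)%N, p (n + k)%N) (pR _).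
  by rewrite addnS; split; [apply: le_trans H1|apply: le_trans ih2].
have le1 n m : (p n).1 <= (p m).1 + a m.
  have [nm|/ltnW mn] := leqP n m.
    have [H _] := mono1 n (m - n)%N; rewrite subnKC // in H.
    by rewrite (le_trans H) // lerDl ltW.
  have [_ H] := mono1 m (n - m)%N; rewrite subnKC // in H.
  by apply: le_trans H; rewrite lerDl ltW.
have le2 n m : (p n).2 <= (p m).2 + b m.
  have [nm|/ltnW mn] := leqP n m.
    have [H _] := mono2 n (m - n)%N; rewrite subnKC // in H.
    by rewrite (le_trans H) // lerDl ltW.
  have [_ H] := mono2 m (n - m)%N; rewrite subnKC // in H.
  by apply: le_trans H; rewrite lerDl ltW.
have [x0 x0P] := between_seqs le1; have [y0 y0P] := between_seqs le2.
have AB0 : 0 < (A + B) ^+ 2 by rewrite exprn_gt0 // addr_gt0.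
have e0 : 0 < J X Y A B / (2 * (A + B) ^+ 2) by rewrite divr_gt0 // mulr_gt0.
have hx0 := x0P 0%N; have hy0 := y0P 0%N; rewrite /= ?a00 ?b00 in hx0 hy0.
have [d d0 Hd] := loc _ _ hx0 hy0 _ e0.
have [n Hn] := exp2_gt ((A + B) / d).
have n0 : 0 < 2 ^+ n :> R by rewrite exprn_gt0.
have [H1 H2 H3 H4] := pR n.
have := Hd (p n).1 (p n).2 (a n) (b n) H1 H2 H3 H4 (x0P n) (y0P n).
rewrite a0 b0 /= /a /b !ltr_pdivrMr //.
move: Hn; rewrite ltr_pdivrMr // mulrC => Hn.
have HA : A < d * 2 ^+ n by apply: le_lt_trans Hn; rewrite lerDl ltW.
have HB : B < d * 2 ^+ n by apply: le_lt_trans Hn; rewrite lerDr ltW.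
move=> /(_ HA HB); rewrite -mulrDl => H.
have /le_trans /(_ _) := pJ n => /(_ _ (ler_wpM2l _ H)).
rewrite exprn_ge0 // => /(_ isT).
have -> : 4 ^+ n * (J X Y A B / (2 * (A + B) ^+ 2) * ((A + B) / 2 ^+ n) ^+ 2) = J X Y A B / 2.
  have -> : 4 ^+ n = (2 ^+ n) ^+ 2 :> R by rewrite -exprM mulnC exprM; congr (_ ^+ _); ring.
  field; rewrite gt_eqF //= gt_eqF //; exact: addr_gt0.
lra.
Qed.

End Bisection.

(** * Cauchy formula on circles *)

Section Holo.
Variable R : realType.
Implicit Types (f g : R[i] -> R[i]) (z l : R[i]).

Definition holo_at f z := exists l, cder f z l.

Lemma holo_derivable f z :
  holo_at f z <-> derivable (f : R[i]^o -> R[i]^o) z 1.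
Proof. by split => /derivable_cder. Qed.

Lemma holo_cst c z : holo_at (fun=> c) z.
Proof. by apply/holo_derivable; exact: derivable_cst. Qed.

Lemma holo_id z : holo_at id z.
Proof. by apply/holo_derivable; exact: derivable_id. Qed.

Lemma holoD f g z : holo_at f z -> holo_at g z -> holo_at (fun w => f w + g w) z.
Proof. by move=> /holo_derivable ? /holo_derivable ?; apply/holo_derivable; exact: derivableD. Qed.

Lemma holoM f g z : holo_at f z -> holo_at g z -> holo_at (fun w => f w * g w) z.
Proof. by move=> /holo_derivable df /holo_derivable dg; apply/holo_derivable;
  have := @derivableM R[i] R[i]^o f g z 1 df dg; exact. Qed.

Lemma holoX n z : holo_at (fun w => w ^+ n) z.
Proof.
elim: n => [|n ih]; first exact: holo_cst.
rewrite (_ : (fun _ => _) = (fun w => w * w ^+ n)).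
  by apply: holoM => //; exact: holo_id.
by apply/funext => w; rewrite exprS.
Qed.

Lemma holoV f z : f z != 0 -> holo_at f z -> holo_at (fun w => (f w)^-1) z.
Proof. by move=> fz /holo_derivable df; apply/holo_derivable;
  have := @derivableV R[i] R[i]^o f z 1 fz df; exact. Qed.

Lemma cts_holo f (g : R -> R[i]) x : cts g x -> holo_at f (g x) -> cts (f \o g) x.
Proof. by move=> gc [l]; exact: cts_comp. Qed.

End Holo.

Section CauchyFormula.
Variable R : realType.
Variables (z : R[i]) (s : R).
Hypothesis zs : normc z < s.
Implicit Types (f : R[i] -> R[i]) (t x y a b u : R).

Let s0 : 0 < s. Proof. by apply: le_lt_trans zs; exact: normc_ge0. Qed.

Definition circ x : R[i] := s%:C * eis x.

(** The circle contracted towards z: the whole circle for t = 1, the point z for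
t = 0. *)
Definition gam t x : R[i] := z + t%:C * (circ x - z).

(** The form d zeta / (zeta - z) on the circle, in the parameter x.  It is the
same for all contracted circles [gam t], since the factor t cancels. *)
Definition kk x : R[i] := 'i%C * circ x / (circ x - z).

Lemma normc_circ x : normc (circ x) = s.
Proof. by rewrite normcM normc_eis mulr1 normc_real gtr0_norm. Qed.

Lemma circB_neq0 x : circ x - z != 0.
Proof.
rewrite -normc_gt0; apply: lt_le_trans (ler_normcB _ _).
by rewrite normc_circ subr_gt0.
Qed.

Lemma normc_circB x : normc (circ x - z) <= 2 * s.
Proof.
rewrite (le_trans (le_normcD _ _)) // normcN normc_circ; have := zs; lra.
Qed.

Definition kbd := s / (s - normc z).

Lemma kbd_ge0 : 0 <= kbd.
Proof. by rewrite divr_ge0 ?subr_ge0 // ltW. Qed.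

Lemma normc_kk x : normc (kk x) <= kbd.
Proof.
have i1 : normc 'i%C = 1 :> R by rewrite /= expr0n /= add0r expr1n sqrtr1.
rewrite /kk normcM normcV [normc ('i%C * _)]normcM i1 mul1r normc_circ.
rewrite ler_wpM2l ?(ltW s0) // lef_pV2 ?posrE.
- by rewrite -(normc_circ x) ler_normcB.
- by rewrite normc_gt0 circB_neq0.
- by rewrite subr_gt0.
Qed.

Lemma cts_circ x : cts circ x.
Proof.
apply: ctsM; first exact: cts_cst.
by have := @cts_eis R 1 x; under eq_fun do rewrite mul1r.
Qed.

Lemma cts_kk x : cts kk x.
Proof.
apply: ctsM; first by apply: ctsM; [exact: cts_cst|exact: cts_circ].
apply: (@cts_holo _ GRing.inv (fun y => circ y - z)).
  by apply: ctsB; [exact: cts_circ|exact: cts_cst].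
by apply: (@holoV _ id) => //; [exact: circB_neq0|exact: holo_id].
Qed.

Lemma cts_gam1 t x : cts (gam t) x.
Proof.
apply: ctsD; first exact: cts_cst.
apply: ctsM; first exact: cts_cst.
by apply: ctsB; [exact: cts_circ|exact: cts_cst].
Qed.

Lemma cts_gam2 t x : cts (gam ^~ x) t.
Proof.
apply: ctsD; first exact: cts_cst.
apply: ctsM; last exact: cts_cst.
by apply: cts_real; exact: cvg_id.
Qed.

Lemma normc_gam t x : 0 <= t <= 1 -> normc (gam t x) <= s.
Proof.
move=> /andP[t0 t1].
have -> : gam t x = (1 - t)%:C * z + t%:C * circ x by rewrite /gam rmorphB rmorph1; ring.
rewrite (le_trans (le_normcD _ _)) // normcM [normc (t%:C * _)]normcM normc_circ !normc_real.
rewrite !ger0_norm ?subr_ge0 //.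
have := zs; nra.
Qed.

Lemma eis_lip x y : x <= y -> normc (eis y - eis x) <= 2 * (y - x).
Proof.
move=> xy; have := CI_eis 1 xy; rewrite !mul1r => <-.
have -> : 2 * (y - x) = 2 * (y - x) * 1 by rewrite mulr1.
apply: (CI_bound xy) => u _; last first.
  by rewrite !normcM normc_eis /= expr0n /= !add0r !expr1n !addr0 sqrtr1 !mulr1.
by apply: ctsM; [exact: cts_cst|exact: cts_eis].
Qed.

Definition Gi f t x b := CI x (x + b) (fun y => f (gam t y) * kk y).
Definition Hi f x t a := CI t (t + a) (fun u => (u^-1)%:C * f (gam u x)).
(** The integral of f(zeta) d zeta / (zeta - z) along the image of the boundary of
a rectangle in the parameters (t, x).  On the sides t = const the form
d zeta / (zeta - z) is [kk], on the sides x = const it is dt / t. *)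
Definition Ii f t x a b := Gi f (t + a) x b - Gi f t x b - (Hi f (x + b) t a - Hi f x t a).

Definition holo_on f (r : R) := forall w, normc w < r -> holo_at f w.

Variable rho : R.
Hypothesis srho : s < rho.

Lemma gam_in t x : 0 <= t <= 1 -> normc (gam t x) < rho.
Proof. by move=> t01; apply: le_lt_trans srho; exact: normc_gam. Qed.

Lemma cts_G f t x : holo_on f rho -> 0 <= t <= 1 ->
  cts (fun y => f (gam t y) * kk y) x.
Proof.
move=> fh t01; apply: ctsM; last exact: cts_kk.
by apply: cts_holo; [exact: cts_gam1|apply: fh; exact: gam_in].
Qed.

Lemma cts_H f u x : holo_on f rho -> 0 < u <= 1 ->
  cts (fun u => (u^-1)%:C * f (gam u x)) u.
Proof.
move=> fh /andP[u0 u1]; apply: ctsM.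
  apply: cts_real; apply: cvgV; last exact: cvg_id.
  by rewrite gt_eqF.
apply: (@cts_holo _ f (gam^~ x)); first exact: cts_gam2.
by apply: fh; apply: gam_in; rewrite ltW.
Qed.

Lemma Ii_add f g t x a b : holo_on f rho -> holo_on g rho -> 0 < t -> 0 <= a -> t + a <= 1 ->
  Ii (fun w => f w + g w) t x a b = Ii f t x a b + Ii g t x a b.
Proof.
move=> fh gh t0 a0 ta.
have G t' : 0 <= t' <= 1 -> Gi (fun w => f w + g w) t' x b = Gi f t' x b + Gi g t' x b.
  move=> t01; rewrite /Gi -CI_add; do ?by move=> y _; exact: cts_G.
  by apply: eq_CI => y _; rewrite mulrDl.
have H x' : Hi (fun w => f w + g w) x' t a = Hi f x' t a + Hi g x' t a.
  rewrite /Hi -CI_add; do ?by move=> y /andP[ty yt]; apply: cts_H => //;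
    rewrite (lt_le_trans t0) //= (le_trans yt).
  by apply: eq_CI => y _; rewrite mulrDr.
have ta0 : 0 <= t + a by rewrite addr_ge0 // ltW.
have t1 : t <= 1 by apply: le_trans ta; rewrite lerDl.
rewrite /Ii !G ?H ?(ltW t0) ?ta0 //.
by do 4 (move: (Gi _ _ _ _) => ?); do 4 (move: (Hi _ _ _ _) => ?); ring.
Qed.

Lemma holo_affine (A B : R[i]) r : holo_on (fun w => A + B * w) r.
Proof.
move=> w _; apply: holoD; first exact: holo_cst.
by apply: holoM; [exact: holo_cst|exact: holo_id].
Qed.

(** Goursat's argument compares f with its first-order Taylor polynomial, so the
loop integral has to be known to vanish on affine functions. *)
Lemma Ii_affine (A B : R[i]) t x a b : 0 < t -> 0 <= a -> 0 <= b -> t + a <= 1 ->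
  Ii (fun w => A + B * w) t x a b = 0.
Proof.
move=> t0 a0 b0 ta; have ah := @holo_affine A B rho.
apply/eqP; rewrite subr_eq0; apply/eqP.
rewrite -[LHS]CI_sub; first last.
- by move=> y _; apply: (cts_G (f := fun w => A + B * w)) => //; lra.
- by move=> y _; apply: (cts_G (f := fun w => A + B * w)) => //; lra.
rewrite -[RHS]CI_sub; first last.
- by move=> y /andP[ty yt]; apply: (cts_H (f := fun w => A + B * w)) => //;
    rewrite (lt_le_trans t0) //= (le_trans yt).
- by move=> y /andP[ty yt]; apply: (cts_H (f := fun w => A + B * w)) => //;
    rewrite (lt_le_trans t0) //= (le_trans yt).
rewrite (@eq_CI _ _ _ _ (fun y => (B * a%:C * s%:C) * (('i%C * 1%:C) * eis (1 * y)))); last first.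
  move=> y _; rewrite /kk /gam mul1r rmorphD /= mulr1 -/(circ y).
  by have := circB_neq0 y; rewrite /circ => H; field.
rewrite CI_mul; last first.
  by move=> y _; apply: ctsM; [exact: cts_cst|exact: cts_eis].
rewrite CI_eis; last by rewrite lerDl.
rewrite (@eq_CI _ _ _ _ (fun y => (B * s%:C) * (eis (x + b) - eis x))); last first.
  move=> y /andP[ty _]; rewrite /gam /circ.
  have y0 : y%:C != 0 by rewrite -normc_gt0 normc_real gtr0_norm (lt_le_trans t0).
  by rewrite fmorphV /=; field.
rewrite CI_cst ?lerDl // !mul1r.
have -> : t + a - t = a by ring.
by ring.
Qed.

(** The loop integral over the parameter rectangle [t1, 1] x [0, 2 pi] vanishes by
bisection.  Its sides x = 0 and x = 2 pi cancel because the circles close up,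
which leaves the two circles t = 1 and t = t1. *)
Lemma cauchy_const f t1 : holo_on f rho -> 0 < t1 < 1 ->
  CI 0 (pi *+ 2) (fun x => f (circ x) * kk x) =
  CI 0 (pi *+ 2) (fun x => f (gam t1 x) * kk x).
Proof.
move=> fh /andP[t10 t11].
have pi2 : 0 < pi *+ 2 :> R by rewrite mulrn_wgt0 // pi_gt0.
have st : 0 < 1 - t1 by rewrite subr_gt0.
have : normc (Ii f t1 0 (1 - t1) (pi *+ 2)) <= 0.
  apply: (@bisection_vanish _ (fun t x a b => normc (Ii f t x a b))) => //.
    move=> t x a b; rewrite subrKC add0r => ht hta hx hxb a0 b0.
    set I1 := Ii _ _ _ (a / 2) _; set I2 := Ii _ (t + a / 2) x _ _.
    set I3 := Ii _ t (x + b / 2) _ _; set I4 := Ii _ (t + _) (x + _) _ _.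
    have xb : x + b / 2 + b / 2 = x + b by rewrite -addrA -splitr.
    have ta : t + a / 2 + a / 2 = t + a by rewrite -addrA -splitr.
    have [a20 b20] : 0 <= a / 2 /\ 0 <= b / 2 by rewrite !divr_ge0 // ltW.
    have [ra rb] : t + a / 2 <= t + a /\ x + b / 2 <= x + b.
      by rewrite -ta -xb !lerDl.
    have -> : Ii f t x a b = I1 + I2 + (I3 + I4).
      have GS t' : 0 <= t' <= 1 -> Gi f t' x b = Gi f t' x (b / 2) + Gi f t' (x + b / 2) (b / 2).
        move=> t01; rewrite /Gi (@CI_split _ _ (x + b / 2)).
        - by rewrite xb.
        - by rewrite lerDl.
        - exact: rb.
        - by move=> y _; apply: cts_G fh t01.
      have HS x' : Hi f x' t a = Hi f x' t (a / 2) + Hi f x' (t + a / 2) (a / 2).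
        rewrite /Hi (@CI_split _ _ (t + a / 2)).
        - by rewrite ta.
        - by rewrite lerDl.
        - exact: ra.
        - move=> y /andP[ty yt]; apply: (cts_H _ fh).
          by rewrite (lt_le_trans t10 (le_trans ht ty)) (le_trans yt).
      rewrite /I1 /I2 /I3 /I4 /Ii (GS (t + a)) ?(GS t) ?HS; [|lra|lra].
      rewrite ta xb.
      by do 6 (move: (Gi _ _ _ _) => ?); do 6 (move: (Hi _ _ _ _) => ?); ring.
    by apply: ler_normcD; exact: le_normcD.
  move=> t0 x0; rewrite subrKC add0r => ht0 hx0 e e0.
  have t0in : 0 <= t0 <= 1 by lra.
  have [l fl] := fh _ (gam_in x0 t0in).
  set L := 8 * s * (kbd + t1^-1).
  have L0 : 0 < L.
    by rewrite !mulr_gt0 // ltr_wpDl ?kbd_ge0 ?invr_gt0.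
  have [d d0 Hd] := fl _ (divr_gt0 e0 L0).
  exists (d / (4 * s)); first by rewrite divr_gt0 // mulr_gt0.
  move=> t x a b ht hta hx hxb htt hxx /andP[a0 ad] /andP[b0 bd].
  have t00 : 0 < t by apply: lt_le_trans ht.
  have ttx : t <= t + a by rewrite lerDl ltW.
  have xxb : x <= x + b by rewrite lerDl ltW.
  have [tl tr] : t <= t <= t + a /\ t <= t + a <= t + a by rewrite !lexx ttx.
  have [xl xr] : x <= x <= x + b /\ x <= x + b <= x + b by rewrite !lexx xxb.
  set g0 := gam t0 x0 in fl Hd.
  (* E is f minus its first-order Taylor polynomial at the limit point *)
  pose E w := f w + ((- f g0 + l * g0) + (- l) * w).
  have Eh : holo_on E rho by move=> w wr; apply: holoD; [exact: fh|exact: (@holo_affine _ _ rho w wr)].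
  have fE : f = fun w => E w + ((f g0 - l * g0) + l * w).
    by apply/funext => w; rewrite /E; ring.
  have -> : Ii f t x a b = Ii E t x a b.
    rewrite {1}fE (Ii_add _ _ Eh (@holo_affine _ _ rho) t00 (ltW a0) hta).
    by rewrite (Ii_affine _ _ _ t00 (ltW a0) (ltW b0) hta) addr0.
  have gB u y : t <= u <= t + a -> x <= y <= x + b -> normc (gam u y - g0) <= 2 * s * (a + b).
    move=> hu hy.
    have -> : gam u y - g0 = (u - t0)%:C * (circ y - z) + t0%:C * s%:C * (eis y - eis x0).
      by rewrite /g0 /gam /circ rmorphB /=; ring.
    have E1 : normc ((u - t0)%:C * (circ y - z)) <= a * (2 * s).
      rewrite normcM normc_real ler_pM ?normc_ge0 // ?normc_circB //.
      by rewrite ler_norml; lra.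
    have E2 : normc (t0%:C * s%:C * (eis y - eis x0)) <= 1 * s * (2 * b).
      rewrite !normcM !normc_real ler_pM ?normc_ge0 //.
      - by case/andP: t0in => t0p t0l; rewrite (ger0_norm t0p) (gtr0_norm s0) ler_wpM2r // ltW.
      - have [yx|/ltW yx] := leP y x0.
          by rewrite normcB; have := eis_lip yx; lra.
        by have := eis_lip yx; lra.
    by have := ler_normcD E1 E2; move=> /le_trans; apply; lra.
  have abd : 2 * s * (a + b) < d.
    move: ad bd; rewrite !ltr_pdivlMr ?mulr_gt0 // => ? ?; lra.
  have EB u y : t <= u <= t + a -> x <= y <= x + b ->
      normc (E (gam u y)) <= e / L * (2 * s * (a + b)).
    move=> hu hy; have gb := gB u y hu hy.
    have := Hd (gam u y) (le_lt_trans gb abd).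
    have -> : f (gam u y) - f g0 - l * (gam u y - g0) = E (gam u y) by rewrite /E; ring.
    move=> /le_trans; apply; rewrite ler_wpM2l // divr_ge0 ?ltW //.
  set M := e / L * (2 * s * (a + b)) in EB.
  have M0 : 0 <= M by exact: le_trans (normc_ge0 _) (EB t x tl xl).
  have GB t' : t <= t' <= t + a -> normc (Gi E t' x b) <= 2 * b * (M * kbd).
    move=> ht'; rewrite /Gi (_ : 2 * b = 2 * (x + b - x)); last by ring.
    apply: (CI_bound xxb).
      move=> y _; apply: (cts_G _ Eh); case/andP: ht' => tt' t'a.
      by rewrite (le_trans (ltW t00) tt') (le_trans t'a).
    move=> y hy; rewrite normcM ler_pM ?normc_ge0 ?normc_kk //; exact: EB.
  have HB x' : x <= x' <= x + b -> normc (Hi E x' t a) <= 2 * a * (t1^-1 * M).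
    move=> ht'; rewrite /Hi (_ : 2 * a = 2 * (t + a - t)); last by ring.
    apply: (CI_bound ttx).
      move=> y /andP[ty yt]; apply: (cts_H _ Eh).
      by rewrite (lt_le_trans t00 ty) (le_trans yt).
    move=> y hy; have [ty _] := andP hy; have y0 := lt_le_trans t00 ty.
    rewrite normcM ler_pM ?normc_ge0 //; last exact: EB.
    by rewrite normc_real normfV (gtr0_norm y0) lef_pV2 ?posrE // (le_trans ht).
  have B1 : normc (Gi E (t + a) x b - Gi E t x b) <= 2 * b * (M * kbd) + 2 * b * (M * kbd).
    by apply: ler_normcD; [exact: GB|rewrite normcN; exact: GB].
  have B2 : normc (- (Hi E (x + b) t a - Hi E x t a)) <= 2 * a * (t1^-1 * M) + 2 * a * (t1^-1 * M).
    by rewrite normcN; apply: ler_normcD; [exact: HB|rewrite normcN; exact: HB].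
  apply: le_trans (ler_normcD B1 B2) _.
  have -> : e * (a + b) ^+ 2 = 4 * (M * (kbd + t1^-1) * (a + b)).
    rewrite /M /L; field; rewrite ?(gt_eqF s0) ?(gt_eqF t10) //=.
    by rewrite andbT gt_eqF // ltr_wpDl // mulr_ge0 ?kbd_ge0 // ltW.
  have kb := kbd_ge0; have ti : 0 < t1^-1 by rewrite invr_gt0.
  have N1 : 0 <= M * kbd by rewrite mulr_ge0.
  have N2 : 0 <= t1^-1 * M by rewrite mulr_ge0 // ltW.
  have N3 : 0 <= M * kbd * a by rewrite mulr_ge0 // ltW.
  have N4 : 0 <= t1^-1 * M * b by rewrite mulr_ge0 // ltW.
  nra.
rewrite le_eqVlt ltNge normc_ge0 orbF => /eqP/eq0_normc.
rewrite /Ii subrKC add0r.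
have -> : Hi f (pi *+ 2) t1 (1 - t1) = Hi f 0 t1 (1 - t1).
  by rewrite /Hi /gam /circ eis2pi eis0.
rewrite subrr subr0 => /eqP; rewrite subr_eq0 => /eqP; rewrite /Gi add0r => <-.
by apply: eq_CI => y _; rewrite /gam mul1r subrKC.
Qed.

(** Let t1 tend to 0 in [cauchy_const]: f tends to f z uniformly on the contracted
circles. *)
Lemma cauchy_formula f : holo_on f rho ->
  CI 0 (pi *+ 2) (fun x => f (circ x) * kk x) = f z * CI 0 (pi *+ 2) kk.
Proof.
move=> fh.
have pi2 : 0 < pi *+ 2 :> R by rewrite mulrn_wgt0 // pi_gt0.
apply/eqP; rewrite -subr_eq0; apply/eqP/eq0_normc/eqP.
rewrite eq_le normc_ge0 andbT; apply/ler_addgt0Pr => e e0; rewrite add0r.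
have zr : normc z < rho by apply: lt_trans srho.
have [l fl] := fh z zr.
have P0 : 0 < 2 * (pi *+ 2) * (kbd + 1) by rewrite !mulr_gt0 // ltr_wpDl // kbd_ge0.
have [d d0 Hd] := cder_cont fl (divr_gt0 e0 P0).
pose t1 := Num.min (1/2) (d / (4 * s)).
have t10 : 0 < t1 by rewrite lt_min !divr_gt0 // mulr_gt0.
have t11 : t1 < 1 by rewrite gt_min ltr_pdivrMr // mul1r ltr1n.
have t1d : 2 * s * t1 < d.
  apply: (@le_lt_trans _ _ (d / 2)); last by lra.
  have : t1 <= d / (4 * s) by rewrite ge_min lexx orbT.
  rewrite ler_pdivlMr ?mulr_gt0 //; lra.
rewrite (@cauchy_const f t1) // ?t10 // -CI_mul; last by move=> y _; exact: cts_kk.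
rewrite -CI_sub; first last.
- by move=> y _; apply: ctsM; [exact: cts_cst|exact: cts_kk].
- by move=> y _; apply: cts_G => //; rewrite !ltW.
have -> : e = 2 * (pi *+ 2 - 0) * (e / (2 * (pi *+ 2) * (kbd + 1)) * (kbd + 1)).
  have k1 : kbd + 1 != 0 by rewrite gt_eqF // ltr_wpDl // kbd_ge0.
  have pp : pi != 0 :> R by rewrite gt_eqF // pi_gt0.
  rewrite subr0.
  have P1 : 2 * (pi *+ 2) != 0 :> R by rewrite mulf_neq0 ?pnatr_eq0 // gt_eqF.
  by rewrite invfM [e * _]mulrA mulfVK // mulrC mulfVK.
apply: CI_bound; first exact: ltW.
  move=> y _; apply: ctsB; first by apply: cts_G => //; rewrite !ltW.
  by apply: ctsM; [exact: cts_cst|exact: cts_kk].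
move=> y _; rewrite -mulrBl normcM ler_pM ?normc_ge0 //; last first.
  by rewrite (le_trans (normc_kk _)) // lerDl.
apply/ltW/Hd; apply: le_lt_trans t1d.
rewrite /gam addrC addKr normcM normc_real gtr0_norm // mulrC ler_pM2r //.
exact: normc_circB.
Qed.

End CauchyFormula.

(** * Power series and Taylor expansion *)

Section PowerSeries.
Variable R : realType.
Implicit Types (c : nat -> R[i]) (z v w : R[i]) (f : R[i] -> R[i]) (q M rho : R).

Lemma geom_tail q m n : 0 <= q < 1 -> \sum_(m <= i < n) q ^+ i <= q ^+ m / (1 - q).
Proof.
move=> /andP[q0 q1]; rewrite ler_pdivlMr ?subr_gt0 //.
have [mn|/ltnW nm] := leqP m n; last by rewrite big_geq // mul0r exprn_ge0.
have -> : (\sum_(m <= i < n) q ^+ i) * (1 - q) = q ^+ m - q ^+ n.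
  rewrite -(subnKC mn); elim: (n - m)%N => [|k ih].
    by rewrite addn0 big_geq // mul0r subrr.
  by rewrite addnS big_nat_recr ?leq_addr //= mulrDl ih exprS; ring.
by rewrite gerBl exprn_ge0.
Qed.

Lemma sum_split (V : zmodType) (F : nat -> V) m n : (m <= n)%N ->
  \sum_(i < n) F i - \sum_(i < m) F i = \sum_(m <= i < n) F i.
Proof.
move=> mn; rewrite -!(big_mkord xpredT) (big_cat_nat (n := m)) //=.
by rewrite addrAC subrr add0r.
Qed.

Lemma rsum_geom (a : nat -> R) q M : 0 <= q < 1 -> (forall i, `|a i| <= M * q ^+ i) ->
  exists v : R, forall n, `|\sum_(i < n) a i - v| <= M * q ^+ n / (1 - q).
Proof.
move=> q01 aM; pose S n := \sum_(i < n) a i; pose t n := M * q ^+ n / (1 - q).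
have M0 : 0 <= M by have := aM 0%N; rewrite expr0 mulr1; apply: le_trans.
have St n m : (n <= m)%N -> `|S m - S n| <= t n.
  move=> nm; rewrite /S sum_split // (le_trans (ler_norm_sum _ _ _)) //.
  apply: (@le_trans _ _ (\sum_(n <= i < m) M * q ^+ i)); first by apply: ler_sum.
  by rewrite -mulr_sumr /t -mulrA ler_wpM2l // geom_tail.
have t0 n : 0 <= t n.
  by case/andP: q01 => q0 q1; rewrite divr_ge0 ?subr_ge0 ?(ltW q1) // mulr_ge0 // exprn_ge0.
have [|v Hv] := @between_seqs R (fun n => S n - t n) (fun n => S n + t n).
  move=> n m; have [nm|/ltnW mn] := leqP n m.
    by have := St _ _ nm; have := t0 m; rewrite ler_norml; lra.
  by have := St _ _ mn; have := t0 n; rewrite ler_norml; lra.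
by exists v => n; have := Hv n; rewrite -/(S n) -/(t n) ler_norml; lra.
Qed.

Lemma csum_geom (a : nat -> R[i]) q M : 0 <= q < 1 ->
  (forall i, normc (a i) <= M * q ^+ i) ->
  exists v, forall n, normc (\sum_(i < n) a i - v) <= 2 * (M * q ^+ n / (1 - q)).
Proof.
move=> q01 aM.
have [|x Hx] := @rsum_geom (fun i => complex.Re (a i)) q M q01.
  by move=> i; apply: le_trans (aM i); exact: le_normc_Re.
have [|y Hy] := @rsum_geom (fun i => complex.Im (a i)) q M q01.
  by move=> i; apply: le_trans (aM i); exact: le_normc_Im.
have SRe n : complex.Re (\sum_(i < n) a i) = \sum_(i < n) complex.Re (a i).
  by elim: n => [|n ih]; rewrite ?big_ord0 // !big_ord_recr /= cReD ih.
have SIm n : complex.Im (\sum_(i < n) a i) = \sum_(i < n) complex.Im (a i).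
  by elim: n => [|n ih]; rewrite ?big_ord0 // !big_ord_recr /= cImD ih.
exists (x +i* y) => n; rewrite (le_trans (normc_le_ReIm _)) //.
by rewrite mulr_natl mulr2n cReD cImD cReN cImN SRe SIm lerD.
Qed.

Definition psum c n z := \sum_(i < n) c i * z ^+ i.

Definition sums_to c z v := forall e : R, 0 < e -> exists N, forall n, (N <= n)%N ->
  normc (psum c n z - v) < e.

Definition pser_on c f rho := forall z, normc z < rho -> sums_to c z (f z).

Lemma geom_small q M e : 0 <= q < 1 -> 0 < e -> exists N, forall n, (N <= n)%N ->
  M * q ^+ n < e.
Proof.
move=> /andP[q0 q1] e0.
have : (fun n => M * q ^+ n) @ \oo --> M * 0.
  apply: cvgM; first exact: cvg_cst.
  by apply: cvg_expr; rewrite ger0_norm.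
rewrite mulr0 => /cvgrPdist_lt /(_ _ e0)[N _ HN]; exists N => n Nn.
by have := HN n Nn; rewrite /= sub0r normrN; apply: le_lt_trans; exact: ler_norm.
Qed.

Lemma pser_coef_bound c f rho q : pser_on c f rho -> 0 <= q < rho ->
  exists2 M, 0 < M & forall n, normc (c n) * q ^+ n <= M.
Proof.
move=> cf /andP[q0 qr].
have qc : normc q%:C < rho by rewrite normc_real ger0_norm.
have [N HN] := cf _ qc 1 ltr01.
pose M := 2 + \sum_(i < N) normc (c i) * q ^+ i.
have S0 : 0 <= \sum_(i < N) normc (c i) * q ^+ i.
  by apply: sumr_ge0 => i _; rewrite mulr_ge0 ?normc_ge0 ?exprn_ge0.
exists M => [|n]; first by rewrite ltr_pwDl.
have [nN|Nn] := ltnP n N.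
  rewrite /M (bigD1 (Ordinal nN)) //=.
  have : 0 <= \sum_(i < N | i != Ordinal nN) normc (c i) * q ^+ i.
    by apply: sumr_ge0 => i _; rewrite mulr_ge0 ?normc_ge0 ?exprn_ge0.
  lra.
have -> : normc (c n) * q ^+ n = normc (psum c n.+1 q%:C - psum c n q%:C).
  rewrite /psum big_ord_recr /= addrAC subrr add0r normcM normcX normc_real.
  by rewrite ger0_norm.
have -> : psum c n.+1 q%:C - psum c n q%:C =
   (psum c n.+1 q%:C - f q%:C) - (psum c n q%:C - f q%:C) by ring.
apply: le_trans (_ : 1 + 1 <= _); last by rewrite /M; lra.
by apply: ler_normcD; rewrite ?normcN; apply/ltW/HN => //; exact: leqW.
Qed.

(** The coefficients are dominated at a radius between q and rho, so at radius q
the tails are geometric. *)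
Lemma pser_tail c f rho q : pser_on c f rho -> 0 <= q < rho ->
  exists M th, [/\ 0 < M, 0 <= th < 1,
    (forall n, normc (c n) * q ^+ n <= M * th ^+ n) &
    forall n z, normc z <= q -> normc (psum c n z - f z) <= M * th ^+ n].
Proof.
move=> cf /andP[q0 qr].
pose p := (q + rho) / 2.
have qp : q < p by rewrite /p; lra.
have pr : 0 <= p < rho by rewrite /p; lra.
have p0 : 0 < p by apply: le_lt_trans qp.
have [M M0 HM] := pser_coef_bound cf pr.
pose th := q / p.
have th01 : 0 <= th < 1.
  by rewrite /th divr_ge0 ?(ltW p0) //= ltr_pdivrMr // mul1r.
have cq n : normc (c n) * q ^+ n <= M * th ^+ n.
  rewrite /th exprMn exprVn mulrA ler_pdivlMr ?exprn_gt0 //.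
  by rewrite mulrAC ler_wpM2r ?exprn_ge0.
have t1 : 0 < 1 - th by rewrite subr_gt0; case/andP: th01.
have M1 : M <= M / (1 - th).
  by rewrite ler_pdivlMr // mulrBr mulr1 gerBl mulr_ge0 ?(ltW M0) //; case/andP: th01.
exists (M / (1 - th)), th; split => //.
- by rewrite divr_gt0.
- move=> n; apply: le_trans (cq n) _; rewrite ler_wpM2r // exprn_ge0 //.
  by case/andP: th01.
move=> n z zq; apply/ler_addgt0Pr => e e0.
have zr : normc z < rho by apply: le_lt_trans qr.
have [N HN] := cf z zr e e0.
pose m := maxn n N.
have -> : psum c n z - f z = - (psum c m z - psum c n z) + (psum c m z - f z) by ring.
apply: ler_normcD; last by apply/ltW/HN; rewrite leq_maxr.
rewrite normcN /psum (sum_split (fun i => c i * z ^+ i)) ?leq_maxl //.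
rewrite (le_trans (normc_sum _ _ _)) //.
apply: (@le_trans _ _ (\sum_(n <= i < m) M * th ^+ i)).
  apply: ler_sum => i _; rewrite normcM normcX; apply: le_trans (cq i).
  by rewrite ler_wpM2l ?normc_ge0 // lerXn2r ?nnegrE ?normc_ge0.
by rewrite -mulr_sumr mulrAC -mulrA ler_wpM2l ?(ltW M0) // geom_tail.
Qed.

(** The remainder in the derivative of a monomial is geometric in n, which is what
differentiating a power series term by term requires. *)
Lemma expB_second_order z w (p Q : R) n : 0 < p -> normc z + 2 * p <= Q ->
  normc (w - z) <= p ->
  normc (w ^+ n - z ^+ n - n%:R * z ^+ n.-1 * (w - z)) <= normc (w - z) ^+ 2 / p ^+ 2 * Q ^+ n
  /\ normc (n%:R * z ^+ n.-1) <= Q ^+ n / p.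
Proof.
move=> p0 zQ wz.
have z0 := normc_ge0 z; have h0 := normc_ge0 (w - z).
have Q0 : 0 < Q by lra.
elim: n => [|n [ih1 ih2]].
  rewrite !expr0 mul0r mul0r subr0 subrr normc0 !mulr1; split; last by rewrite divr_ge0 // ltW.
  by rewrite divr_ge0 ?exprn_ge0 // ltW.
have D : n.+1%:R * z ^+ n = z * (n%:R * z ^+ n.-1) + z ^+ n :> R[i].
  case: n {ih1 ih2} => [|n]; first by rewrite expr0 mul0r mulr0 add0r mulr1.
  by rewrite -natr1 /= exprS; ring.
have zn : normc (z ^+ n) <= Q ^+ n.
  by rewrite normcX lerXn2r ?nnegrE ?(ltW Q0) //; lra.
have Qn : 0 <= Q ^+ n by rewrite exprn_ge0 // ltW.
split; last first.
  rewrite [n.+1.-1]/= D exprS -mulrA.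
  apply: (@le_trans _ _ (normc z * (Q ^+ n / p) + Q ^+ n)).
    by apply: ler_normcD => //; rewrite normcM ler_wpM2l.
  have -> : normc z * (Q ^+ n / p) + Q ^+ n = (normc z + p) * (Q ^+ n / p).
    by field; rewrite gt_eqF.
  by rewrite ler_wpM2r ?divr_ge0 ?(ltW p0) //; lra.
rewrite [n.+1.-1]/= D.
have -> : w ^+ n.+1 - z ^+ n.+1 - (z * (n%:R * z ^+ n.-1) + z ^+ n) * (w - z) =
  w * (w ^+ n - z ^+ n - n%:R * z ^+ n.-1 * (w - z)) + n%:R * z ^+ n.-1 * (w - z) ^+ 2.
  by rewrite !exprS; ring.
have wb : normc w <= normc z + p.
  have -> : w = z + (w - z) by ring.
  exact: ler_normcD.
apply: (@le_trans _ _ ((normc z + p) * (normc (w - z) ^+ 2 / p ^+ 2 * Q ^+ n) +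
   Q ^+ n / p * normc (w - z) ^+ 2)).
  apply: ler_normcD; first by rewrite normcM ler_pM ?normc_ge0.
  by rewrite normcM normcX ler_wpM2r ?exprn_ge0.
have -> : (normc z + p) * (normc (w - z) ^+ 2 / p ^+ 2 * Q ^+ n) +
   Q ^+ n / p * normc (w - z) ^+ 2 =
   (normc z + 2 * p) * (normc (w - z) ^+ 2 / p ^+ 2 * Q ^+ n) by field; rewrite gt_eqF.
rewrite [Q ^+ n.+1]exprS [leRHS]mulrCA ler_wpM2r //.
by rewrite mulr_ge0 // divr_ge0 ?exprn_ge0 // ltW.
Qed.

Lemma pser_holo c f rho : pser_on c f rho -> holo_on f rho.
Proof.
move=> cf z zr; pose p := (rho - normc z) / 4.
have z0 := normc_ge0 z.
have p0 : 0 < p by rewrite /p; lra.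
pose Q := normc z + 2 * p.
have Qr : 0 <= Q < rho by rewrite /Q /p; lra.
have [M [th [M0 th01 cM tailM]]] := pser_tail cf Qr.
have t1 : 0 < 1 - th by rewrite subr_gt0; case/andP: th01.
have E2 w := @expB_second_order z w p Q _ p0 (lexx _).
have [|l Hl] := @csum_geom (fun n => c n * (n%:R * z ^+ n.-1)) th (M / p) th01.
  move=> n; rewrite normcM.
  have [|_ H] := E2 n z; first by rewrite subrr normc0 ltW.
  apply: le_trans (ler_wpM2l (normc_ge0 _) H) _.
  by rewrite mulrA [M / p * _]mulrAC ler_pM2r ?invr_gt0.
exists l => e e0.
pose K := M / (p ^+ 2 * (1 - th)).
have K0 : 0 < K by rewrite divr_gt0 // mulr_gt0 // exprn_gt0.
exists (Num.min p (e / (K + 1))) => [|w].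
  by rewrite lt_min p0 divr_gt0 // addr_gt0.
rewrite lt_min => /andP[wp we].
set h := normc (w - z) in wp we *.
have h0 : 0 <= h by exact: normc_ge0.
apply: (@le_trans _ _ (K * h ^+ 2)); last first.
  rewrite expr2 mulrA ler_wpM2r // (le_trans _ (_ : (K + 1) * h <= _)) //.
    by rewrite ler_wpM2r // lerDl.
  by rewrite mulrC -ler_pdivlMr ?addr_gt0 // ltW.
apply/ler_addgt0Pr => d d0.
have wQ : normc w <= Q.
  have -> : w = z + (w - z) by ring.
  by rewrite /Q; apply: ler_normcD => //; rewrite -/h; lra.
have zQ : normc z <= Q by rewrite /Q; lra.
have d3 : 0 < d / 3 by rewrite divr_gt0.
have d4 : 0 < d / (3 * (h + 1)) by rewrite divr_gt0 // mulr_gt0 // ltr_wpDl.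
have [N1 HN1] := geom_small M th01 d3.
have [N2 HN2] := geom_small (2 * (M / p / (1 - th))) th01 d4.
pose N := maxn N1 N2.
have H1 := HN1 N (leq_maxl _ _); have H2 := HN2 N (leq_maxr _ _).
pose dl := \sum_(i < N) c i * (i%:R * z ^+ i.-1).
have -> : f w - f z - l * (w - z) =
   (psum c N w - psum c N z - dl * (w - z)) +
   (- (psum c N w - f w) + ((psum c N z - f z) + (dl - l) * (w - z))) by ring.
have -> : K * h ^+ 2 + d = K * h ^+ 2 + (d / 3 + (d / 3 + d / 3)) by field.
apply: ler_normcD; last first.
  apply: ler_normcD; first by rewrite normcN ltW // (le_lt_trans (tailM _ _ wQ)).
  apply: ler_normcD; first by rewrite ltW // (le_lt_trans (tailM _ _ zQ)).
  rewrite normcM -/h.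
  have : normc (dl - l) <= d / (3 * (h + 1)).
    apply: le_trans (Hl N) _; apply: ltW; apply: le_lt_trans H2.
    by rewrite le_eqVlt; apply/orP; left; apply/eqP; field; rewrite (gt_eqF t1) (gt_eqF p0).
  move=> H; apply: le_trans (ler_pM (normc_ge0 _) h0 H (_ : h <= h + 1)) _; first by rewrite lerDl.
  rewrite invfM mulrA mulfVK // gt_eqF // ltr_wpDl //.
rewrite /psum /dl mulr_suml -!sumrB.
rewrite (le_trans (normc_sumn _ (fun i => c i * w ^+ i - c i * z ^+ i - c i * (i%:R * z ^+ i.-1) * (w - z)))) //.
apply: (@le_trans _ _ (\sum_(i < N) h ^+ 2 / p ^+ 2 * (M * th ^+ i))).
  apply: ler_sum => i _.
  have -> : c i * w ^+ i - c i * z ^+ i - c i * (i%:R * z ^+ i.-1) * (w - z) =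
    c i * (w ^+ i - z ^+ i - i%:R * z ^+ i.-1 * (w - z)) by ring.
  have [H _] := E2 i w (ltW wp).
  rewrite normcM; apply: le_trans (ler_wpM2l (normc_ge0 _) H) _.
  rewrite mulrCA ler_wpM2l //.
  by rewrite divr_ge0 ?exprn_ge0 // ltW.
rewrite -mulr_sumr -mulr_sumr.
have G : \sum_(i < N) th ^+ i <= 1 / (1 - th).
  by have := geom_tail 0 N th01; rewrite big_mkord expr0.
apply: le_trans (_ : h ^+ 2 / p ^+ 2 * (M * (1 / (1 - th))) <= _).
  rewrite ler_wpM2l //; first by rewrite divr_ge0 ?exprn_ge0 // ltW.
  by rewrite ler_wpM2l // ltW.
by rewrite le_eqVlt; apply/orP; left; apply/eqP; rewrite /K; field; rewrite (gt_eqF t1) (gt_eqF p0).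
Qed.

(** By induction on n: near 0 the first nonzero term dominates all later ones. *)
Lemma pser_zero c rho : 0 < rho -> pser_on c (fun=> 0) rho -> forall n, c n = 0.
Proof.
move=> r0 c0.
have r2 : 0 <= rho / 2 < rho by lra.
have [M M0 HM] := pser_coef_bound c0 r2.
set r := rho / 2 in r2 HM; have rp : 0 < r by rewrite divr_gt0.
elim/ltn_ind => k ih; apply/eq0_normc/eqP; rewrite eq_le normc_ge0 andbT.
have rk : 0 < r ^+ k by rewrite exprn_gt0.
rewrite -(pmulr_lle0 _ rk) leNgt; apply/negP => ck.
set a := normc (c k) * r ^+ k in ck.
(* at modulus q * r the terms after the k-th add up to at most half of it *)
pose q := Num.min (1 / 2) (a / (4 * M)).
have q0 : 0 < q by rewrite lt_min !divr_gt0 // mulr_gt0.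
have q2 : q <= 1 / 2 by rewrite ge_min lexx.
have qa : 4 * M * q <= a.
  by rewrite mulrC -ler_pdivlMr ?mulr_gt0 // ge_min lexx orbT.
pose z : R[i] := (q * r)%:C.
have nz : normc z = q * r by rewrite normc_real ger0_norm // mulr_ge0 // ltW.
have zr : normc z < rho.
  by rewrite nz (@le_lt_trans _ _ (1 * r)) ?ler_pM2r //; move: r2; rewrite ?mul1r; lra.
have e0 : 0 < a * q ^+ k / 2 by rewrite divr_gt0 // mulr_gt0 // exprn_gt0.
have [N HN] := c0 z zr _ e0.
pose m := maxn N k.+1.
have := HN m (leq_maxl _ _); rewrite subr0 /psum.
have km : (k < m)%N by rewrite /m leq_max leqnn orbT.
rewrite -(big_mkord xpredT (fun i => c i * z ^+ i)) (big_cat_nat (n := k)) //=; last exact: ltnW.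
rewrite big_nat_cond big1 ?add0r; last first.
  by move=> i /andP[/andP[_ ik] _]; rewrite ih // mul0r.
rewrite big_ltn // => H.
have T : normc (\sum_(k.+1 <= i < m) c i * z ^+ i) <= M * (q ^+ k.+1 / (1 - q)).
  rewrite (le_trans (normc_sum _ _ _)) //.
  apply: (@le_trans _ _ (\sum_(k.+1 <= i < m) M * q ^+ i)).
    apply: ler_sum => i _; rewrite normcM normcX nz exprMn mulrCA mulrC.
    by rewrite ler_wpM2r ?exprn_ge0 // ltW.
  by rewrite -mulr_sumr ler_wpM2l ?(ltW M0) // geom_tail //; lra.
have ckz : normc (c k * z ^+ k) = a * q ^+ k by rewrite normcM normcX nz exprMn /a; ring.
have := ler_normcB (c k * z ^+ k) (- \sum_(k.+1 <= i < m) c i * z ^+ i).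
rewrite opprK normcN ckz => H1.
have T2 : M * (q ^+ k.+1 / (1 - q)) <= a * q ^+ k / 2.
  rewrite exprS.
  have qk : 0 < q ^+ k by rewrite exprn_gt0.
  have q1 : 0 < 1 - q by lra.
  rewrite mulrA ler_pdivrMr //.
  have -> : a * q ^+ k / 2 * (1 - q) = q ^+ k * (a * (1 - q) / 2) by ring.
  rewrite [q * _]mulrC mulrCA ler_pM2l //.
  have : 0 <= a * (1/2 - q) by apply: mulr_ge0; [exact: ltW|lra].
  lra.
lra.
Qed.

Lemma psumB c c' n z : psum (fun i => c i - c' i) n z = psum c n z - psum c' n z.
Proof. by rewrite /psum -sumrB; apply: eq_bigr => i _; rewrite mulrBl. Qed.

Lemma pser_onB c c' f g rho : pser_on c f rho -> pser_on c' g rho ->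
  pser_on (fun i => c i - c' i) (fun z => f z - g z) rho.
Proof.
move=> cf cg z zr e e0; have e2 : 0 < e / 2 by rewrite divr_gt0.
have [N1 H1] := cf z zr _ e2; have [N2 H2] := cg z zr _ e2.
exists (maxn N1 N2) => n; rewrite geq_max => /andP[n1 n2]; rewrite psumB.
have -> : psum c n z - psum c' n z - (f z - g z) =
  (psum c n z - f z) + - (psum c' n z - g z) by ring.
rewrite (le_lt_trans (le_normcD _ _)) // normcN [e]splitr.
by rewrite ltrD // ?H1 ?H2.
Qed.

Lemma pser_uniq c c' f rho : 0 < rho -> pser_on c f rho -> pser_on c' f rho ->
  forall n, c n = c' n.
Proof.
move=> r0 cf cf' n; have := pser_onB cf cf'.
under [X in pser_on _ X]eq_fun do rewrite subrr.
by move=> /(pser_zero r0) /(_ n) /eqP; rewrite subr_eq0 => /eqP.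
Qed.

End PowerSeries.

Section Taylor.
Variable R : realType.
Implicit Types (c : nat -> R[i]) (z v w : R[i]) (f : R[i] -> R[i]) (q M rho s : R).

Let tpi : R := pi *+ 2.
Let tpi0 : 0 < tpi. Proof. by rewrite mulrn_wgt0 // pi_gt0. Qed.

(** 2 pi times the n-th Taylor coefficient, computed on the circle of radius s. *)
Definition fcoef f s n : R[i] :=
  (s ^- n)%:C * CI 0 tpi (fun x => f (circ s x) * eis (- n%:R * x)).

Lemma circ_bound f s rho : 0 < s < rho -> holo_on f rho ->
  exists2 M, 0 < M & forall x, 0 <= x <= tpi -> normc (f (circ s x)) <= M.
Proof.
move=> /andP[s0 sr] fh.
have fc x : cts (f \o circ s) x.
  apply: cts_holo; first exact: cts_circ.
  have s0' : normc (0 : R[i]) < s by rewrite normc0.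
  by apply: fh; rewrite (normc_circ s0').
have nc : {within `[0, tpi], continuous (fun x => normc (f (circ s x)))}.
  apply: continuous_subspaceT => x.
  apply/cvgrPdist_lt => e e0; have [d d0 Hd] := (ctsP _ _).1 (fc x) e e0.
  apply/nbhs_ballP; exists d => //= y; rewrite /ball /= distrC => /Hd.
  apply: le_lt_trans; rewrite ler_norml.
  have := ler_normcB (f (circ s y)) (f (circ s x)).
  have := ler_normcB (f (circ s x)) (f (circ s y)); rewrite (normcB (f (circ s x))) /=.
  by lra.
have [x0 _ Hx0] := EVT_max (ltW tpi0) nc.
exists (normc (f (circ s x0)) + 1); first by rewrite ltr_wpDl ?normc_ge0.
move=> x xin; rewrite (le_trans (Hx0 x _)) ?lerDl //.
Qed.

Lemma kk_expand z s n x : normc z < s ->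
  kk z s x = 'i%C * \sum_(j < n) (z ^+ j * (s ^- j)%:C * eis (- j%:R * x)) +
    (z / circ s x) ^+ n * kk z s x.
Proof.
move=> zs.
have s0 : 0 < s by apply: le_lt_trans zs; exact: normc_ge0.
have c0 : circ s x != 0 by rewrite -normc_gt0 (normc_circ zs).
have -> : \sum_(j < n) (z ^+ j * (s ^- j)%:C * eis (- j%:R * x)) =
          \sum_(j < n) (z / circ s x) ^+ j.
  apply: eq_bigr => j _; rewrite -mulrA; rewrite exprMn exprVn; congr (_ * _).
  rewrite /circ exprMn invfM mulNr eisN eisMn; congr (_ * _).
  by rewrite fmorphV rmorphXn.
have cz := circB_neq0 zs x.
have w1 : 1 - z / circ s x != 0.
  apply: contra cz; rewrite !subr_eq0 => /eqP H; apply/eqP.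
  by rewrite -[LHS]mul1r H mulfVK.
have kE : kk z s x = 'i%C / (1 - z / circ s x) by rewrite /kk; field; rewrite c0 cz.
have G : (\sum_(j < n) (z / circ s x) ^+ j) * (1 - z / circ s x) = 1 - (z / circ s x) ^+ n.
  elim: n => [|n ih]; first by rewrite big_ord0 mul0r expr0 subrr.
  by rewrite big_ord_recr /= mulrDl ih exprSr; ring.
rewrite kE; apply: (mulIf w1); rewrite mulrDl -!mulrA G mulVf //.
ring.
Qed.

Lemma CI_sum (F : nat -> R -> R[i]) n a b : (forall j x, cts (F j) x) ->
  CI a b (fun x => \sum_(j < n) F j x) = \sum_(j < n) CI a b (F j).
Proof.
move=> Fc; elim: n => [|n ih].
  rewrite big_ord0 -[RHS](mul0r (CI a b (fun=> 0))) -CI_mul.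
    by congr CI; apply/funext => x; rewrite big_ord0 mul0r.
  by move=> x _; exact: cts_cst.
rewrite big_ord_recr /= -ih -CI_add.
- by congr CI; apply/funext => x; rewrite big_ord_recr.
- move=> x _; elim: n {ih} => [|n ih].
    rewrite (_ : (fun _ => _) = fun=> 0); first exact: cts_cst.
    by apply/funext => y; rewrite big_ord0.
  rewrite (_ : (fun _ => _) = fun y => \sum_(j < n) F j y + F n y); first exact: ctsD.
  by apply/funext => y; rewrite big_ord_recr.
- by move=> x _; exact: Fc.
Qed.

(** The Cauchy kernel is a geometric series in z / zeta; its sections are
integrated term by term. *)
Lemma cauchy_expand f z s rho n M : normc z < s -> s < rho -> holo_on f rho ->
  (forall x, 0 <= x <= tpi -> normc (f (circ s x)) <= M) ->
  normc (CI 0 tpi (fun x => f (circ s x) * kk z s x) -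
    'i%C * \sum_(j < n) z ^+ j * fcoef f s j) <= 2 * tpi * (M * kbd z s) * (normc z / s) ^+ n.
Proof.
move=> zs sr fh fM.
have s0 : 0 < s by apply: le_lt_trans zs; exact: normc_ge0.
have fc x : cts (fun x => f (circ s x)) x.
  apply: (@cts_holo _ f); first exact: cts_circ.
  by apply: fh; rewrite (normc_circ zs).
pose F j x := z ^+ j * (s ^- j)%:C * (f (circ s x) * eis (- j%:R * x)).
have Fc j x : cts (F j) x.
  apply: ctsM; first exact: cts_cst.
  by apply: ctsM; [exact: fc|exact: cts_eis].
have -> : \sum_(j < n) z ^+ j * fcoef f s j = CI 0 tpi (fun x => \sum_(j < n) F j x).
  rewrite CI_sum; last exact: Fc.
  apply: eq_bigr => j _; rewrite /F [RHS]CI_mul; first by rewrite mulrA.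
  by move=> x _; apply: ctsM; [exact: fc|exact: cts_eis].
have Sc x : cts (fun x => \sum_(j < n) F j x) x.
  elim: n => [|n ih].
    rewrite (_ : (fun _ => _) = fun=> 0); first exact: cts_cst.
    by apply/funext => y; rewrite big_ord0.
  rewrite (_ : (fun _ => _) = fun y => \sum_(j < n) F j y + F n y); first exact: ctsD.
  by apply/funext => y; rewrite big_ord_recr.
rewrite -CI_mul; last by move=> x _.
rewrite -CI_sub; first last.
- by move=> x _; apply: ctsM; [exact: cts_cst|exact: Sc].
- by move=> x _; apply: ctsM; [exact: fc|exact: cts_kk].
have -> : 2 * tpi * (M * kbd z s) * (normc z / s) ^+ n =
  2 * (tpi - 0) * (M * kbd z s * (normc z / s) ^+ n) by ring.
apply: CI_bound; first exact: ltW.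
  move=> x _; apply: ctsB.
    by apply: ctsM; [exact: fc|exact: cts_kk].
  by apply: ctsM; [exact: cts_cst|exact: Sc].
move=> x x01.
have -> : f (circ s x) * kk z s x - 'i%C * \sum_(j < n) F j x =
   f (circ s x) * ((z / circ s x) ^+ n * kk z s x).
  rewrite {1}(kk_expand n x zs) mulrDr addrAC.
  have -> : \sum_(j < n) F j x = f (circ s x) *  \sum_(j < n) (z ^+ j * (s ^- j)%:C * eis (- j%:R * x)).
    by rewrite mulr_sumr; apply: eq_bigr => j _; rewrite /F; ring.
  by rewrite mulrCA subrr add0r.
rewrite normcM -mulrA ler_pM ?normc_ge0 ?fM //.
rewrite normcM normcX normcM normcV (normc_circ zs) mulrC.
by rewrite ler_wpM2r ?normc_kk // exprn_ge0 // divr_ge0 ?normc_ge0 // (ltW s0).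
Qed.

Lemma fcoef1 s n : 0 < s -> fcoef (fun=> 1) s n = if n == 0%N then tpi%:C else 0.
Proof.
move=> s0; rewrite /fcoef; case: n => [|n] /=.
  rewrite expr0 invr1 mul1r (@eq_CI _ _ _ _ (fun=> 1)).
    by rewrite CI_cst ?(ltW tpi0) // mulr1 subr0.
  by move=> x _; rewrite oppr0 mul0r eis0 mul1r.
have k0 : ('i%C * (- n.+1%:R)%:C : R[i]) != 0.
  rewrite mulf_neq0 //; first by rewrite -normc_gt0 /= expr0n /= add0r expr1n sqrtr1.
  by rewrite -normc_gt0 normc_real normr_gt0 oppr_eq0 pnatr_eq0.
have H := CI_eis (- n.+1%:R) (ltW tpi0).
suff -> : CI 0 tpi (fun x => 1 * eis (- n.+1%:R * x)) = 0 by rewrite mulr0.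
apply: (mulfI k0); rewrite mulr0 -CI_mul.
  rewrite (@eq_CI _ _ _ _ (fun x => 'i%C * (- n.+1%:R)%:C * eis (- n.+1%:R * x))).
    by rewrite H mulr0 eis0 mulNr eisN eisMn eis2pi expr1n invr1 subrr.
  by move=> x _; rewrite mul1r.
by move=> x _; apply: ctsM; [exact: cts_cst|exact: cts_eis].
Qed.

(** The normalization of the Cauchy formula is read off from the expansion of the
constant function 1, so no winding number has to be computed. *)
Lemma CI_kk z s : normc z < s -> CI 0 tpi (kk z s) = 'i%C * tpi%:C.
Proof.
move=> zs.
have s0 : 0 < s by apply: le_lt_trans zs; exact: normc_ge0.
have q01 : 0 <= normc z / s < 1 by rewrite divr_ge0 ?normc_ge0 ?(ltW s0) //= ltr_pdivrMr // mul1r.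
apply/eqP; rewrite -subr_eq0; apply/eqP/eq0_normc/eqP.
rewrite eq_le normc_ge0 andbT; apply/ler_addgt0Pr => e e0; rewrite add0r.
have [N HN] := geom_small (2 * tpi * (1 * kbd z s)) q01 e0.
apply/ltW; apply: le_lt_trans (HN N.+1 (leqnSn _)).
have h1 : holo_on (fun=> 1 : R[i]) (s + 1) by move=> w _; exact: holo_cst.
have := @cauchy_expand (fun=> 1) z s (s + 1) N.+1 1 zs _ h1.
rewrite big_ord_recl big1 ?addr0 => [|j _]; last by rewrite fcoef1 // lift0 /= mulr0.
have E1 : (fun x => 1 * kk z s x) = kk z s by apply/funext => x; rewrite mul1r.
rewrite fcoef1 // [nat_of_ord ord0]/= eqxx expr0 mul1r E1.
apply; first by rewrite ltrDl.
by move=> x _; rewrite normc1.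
Qed.

Lemma taylor_circle f s rho : 0 < s < rho -> holo_on f rho ->
  pser_on (fun n => fcoef f s n / tpi%:C) f s.
Proof.
move=> srho fh z zs e e0.
have [M M0 fM] := circ_bound srho fh; case/andP: srho => s0 sr.
have q01 : 0 <= normc z / s < 1 by rewrite divr_ge0 ?normc_ge0 ?(ltW s0) //= ltr_pdivrMr // mul1r.
have [N HN] := geom_small (2 * tpi * (M * kbd z s)) q01 (mulr_gt0 e0 tpi0).
exists N => n /HN H.
have := @cauchy_expand f z s rho n M zs sr fh fM.
rewrite (cauchy_formula zs sr fh) CI_kk // => H1.
have {H1} := le_lt_trans H1 H.
have t0 : tpi%:C != 0 by rewrite -normc_gt0 normc_real normr_gt0 gt_eqF.
have -> : f z * ('i%C * tpi%:C) - 'i%C * (\sum_(j < n) z ^+ j * fcoef f s j) =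
   - ('i%C * tpi%:C * (psum (fun n => fcoef f s n / tpi%:C) n z - f z)).
  have -> : \sum_(j < n) z ^+ j * fcoef f s j = tpi%:C * psum (fun n => fcoef f s n / tpi%:C) n z.
    by rewrite /psum mulr_sumr; apply: eq_bigr => j _;
      rewrite mulrA [tpi%:C * _]mulrC mulfVK // mulrC.
  by ring.
rewrite normcN 2!normcM normc_real (gtr0_norm tpi0).
have -> : normc 'i%C = 1 :> R by rewrite /= expr0n /= add0r expr1n sqrtr1.
by rewrite mul1r mulrC ltr_pM2r.
Qed.

(** Circles of different radii give the same coefficients, because power series
coefficients are unique; so the series on the small circle converges on the
whole disk. *)
Theorem taylor f rho : 0 < rho -> holo_on f rho -> exists c, pser_on c f rho.
Proof.
move=> r0 fh; have r2 : 0 < rho / 2 < rho by lra.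
exists (fun n => fcoef f (rho / 2) n / tpi%:C) => z zr.
pose s := Num.max (rho / 2) ((normc z + rho) / 2).
have s1 : rho / 2 <= s by rewrite le_max lexx.
have s2 : normc z < s by rewrite lt_max; apply/orP; right; lra.
have s3 : s < rho by rewrite gt_max; lra.
have s0 : 0 < s < rho by lra.
have H1 := taylor_circle r2 fh; have H2 := taylor_circle s0 fh.
have E : (fun n => fcoef f (rho / 2) n / tpi%:C) = (fun n => fcoef f s n / tpi%:C).
  apply/funext; apply: (pser_uniq _ H1); first by case/andP: r2.
  by move=> w wr; apply: H2; lra.
by rewrite E; exact: H2.
Qed.

End Taylor.

(** * Affine invariance of area *)

Section PlaneInvariance.
Variable R : realType.
Local Notation mu := (@lebesgue_measure R).
Local Notation L2 := (@lebesgue_measure R \x @lebesgue_measure R)%E.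
Local Open Scope ereal_scope.

Lemma measurable_affine (k c : R) :
  measurable_fun setT (fun x : measurableTypeR R => (k * x + c)%R : measurableTypeR R).
Proof. by apply: measurable_funD => //; exact: mulrl_measurable. Qed.

Lemma lebesgue_affine (k c : R) (k0 : (0 < k)%R) (A : set (measurableTypeR R)) : measurable A ->
  mu A = k%:E * mu ((fun x : R => (k * x + c)%R) @^-1` A).
Proof.
move=> mA.
pose F (x : measurableTypeR R) : measurableTypeR R := (k * x + c)%R.
have mF : measurable_fun setT (F : measurableTypeR R -> measurableTypeR R) by exact: measurable_affine.
have H := @lebesgue_measure_unique R [the {measure set _ -> \bar R} of mscale (NngNum (ltW k0)) (measure_function_pushforward__canonical__measure_function_Measure mu mF)].
rewrite H //= => X [[a b]] /= _ <-.
rewrite /mscale /= /pushforward.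
have -> : F @^-1` `]a, b] = [set` `]((a - c) / k)%R, ((b - c) / k)%R]].
  apply/seteqP; split => x /=; rewrite !in_itv /= /F ltr_pdivrMr // ler_pdivlMr // ltrBlDr lerBrDr mulrC //.
rewrite !lebesgue_measure_itv /= !lte_fin ltr_pM2r ?invr_gt0 // ltrD2r.
case: ifP => _; last by rewrite mule0.
rewrite -!EFinB -EFinM; congr (_%:E).
by rewrite -mulrBl mulrC divfK ?gt_eqF //; ring.
Qed.

Lemma integral_affine (k c : R) (f : measurableTypeR R -> \bar R) : (0 < k)%R ->
  measurable_fun setT f -> (forall x, 0 <= f x) ->
  \int[mu]_x f x = k%:E * \int[mu]_x f (k * x + c)%R.
Proof.
move=> k0 mf f0.
pose F (x : measurableTypeR R) : measurableTypeR R := (k * x + c)%R.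
have mF : measurable_fun setT (F : measurableTypeR R -> measurableTypeR R) by exact: measurable_affine.
pose nu := [the {measure set _ -> \bar R} of mscale (NngNum (ltW k0)) (measure_function_pushforward__canonical__measure_function_Measure mu mF)].
rewrite (@eq_measure_integral _ _ _ setT nu); last first.
  by move=> A mA _; exact: lebesgue_affine.
rewrite ge0_integral_mscale //=; congr (_ * _).
by rewrite ge0_integral_pushforward.
Qed.

Local Notation M1 := (measurableTypeR R).
Local Notation M2 := (measurableTypeR R * measurableTypeR R)%type.
Implicit Types (F : M2 -> \bar R) (T : M2 -> M2) (p : M2).

(** Invariance of integrals of nonnegative functions rather than of measures of
sets: this is the form that Tonelli gives for a shear and that composes. *)
Definition mpres T := measurable_fun setT T /\
  forall F, measurable_fun setT F -> (forall p, 0 <= F p) ->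
    \int[L2]_p F p = \int[L2]_p F (T p).

Lemma mpres_comp T T' : mpres T -> mpres T' -> mpres (T \o T').
Proof.
move=> [mT HT] [mT' HT']; split; first exact: measurableT_comp.
move=> F mF F0; rewrite HT // HT' //; exact: measurableT_comp.
Qed.

Definition shear1 (a b : R) p : M2 := ((p.1 + (a * p.2 + b))%R, p.2).
Definition shear2 (a b : R) p : M2 := (p.1, (p.2 + (a * p.1 + b))%R).

Lemma measurable_shear1 a b : measurable_fun setT (shear1 a b).
Proof.
apply/measurable_fun_pairP; split; last exact: measurable_snd.
apply: measurable_funD; first exact: measurable_fst.
apply: measurable_funD; last exact: measurable_cst.
by apply: measurable_funM; [exact: measurable_cst|exact: measurable_snd].
Qed.

Lemma measurable_shear2 a b : measurable_fun setT (shear2 a b).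
Proof.
apply/measurable_fun_pairP; split; first exact: measurable_fst.
apply: measurable_funD; first exact: measurable_snd.
apply: measurable_funD; last exact: measurable_cst.
by apply: measurable_funM; [exact: measurable_cst|exact: measurable_fst].
Qed.

Lemma integral_shift (c : R) (f : M1 -> \bar R) :
  measurable_fun setT f -> (forall x, 0 <= f x) ->
  \int[mu]_x f x = \int[mu]_x f (x + c)%R.
Proof.
move=> mf f0; rewrite (integral_affine c ltr01) // mul1e.
by under eq_integral do rewrite mul1r.
Qed.

(** For a fixed second coordinate a shear is a translation of the line. *)
Lemma mpres_shear1 a b : mpres (shear1 a b).
Proof.
split; first exact: measurable_shear1.
move=> F mF F0.
have mFT : measurable_fun setT (F \o shear1 a b).
  by apply: measurableT_comp => //; exact: measurable_shear1.
have FT0 p : 0 <= (F \o shear1 a b) p by exact: F0.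
rewrite (fubini_tonelli1 F mF F0) [RHS](fubini_tonelli1 _ mFT FT0) /fubini_F.
rewrite (fubini_tonelli F mF F0) [RHS](fubini_tonelli _ mFT FT0).
apply: eq_integral => y _; rewrite (@integral_shift (a * y + b)) //.
exact: measurable_fun_pair1.
Qed.

Lemma mpres_shear2 a b : mpres (shear2 a b).
Proof.
split; first exact: measurable_shear2.
move=> F mF F0.
have mFT : measurable_fun setT (F \o shear2 a b).
  by apply: measurableT_comp => //; exact: measurable_shear2.
have FT0 p : 0 <= (F \o shear2 a b) p by exact: F0.
rewrite (fubini_tonelli1 F mF F0) [RHS](fubini_tonelli1 _ mFT FT0) /fubini_F.
apply: eq_integral => x _; rewrite (@integral_shift (a * x + b)) //.
exact: measurable_fun_pair2.
Qed.

Definition plane_rot (t : R) p : M2 :=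
  ((cos t * p.1 - sin t * p.2)%R, (sin t * p.1 + cos t * p.2)%R).

(** A rotation by t is a product of three shears; the factor of the outer ones is
-tan(t/2), whence the restriction on t. *)
Lemma mpres_rot t : (cos t != -1)%R -> mpres (plane_rot t).
Proof.
move=> ct; pose k := (- (sin t / (1 + cos t)))%R.
have c1 : (1 + cos t != 0)%R by rewrite addrC addr_eq0.
have -> : plane_rot t = shear1 k 0 \o (shear2 (sin t) 0 \o shear1 k 0).
  apply/funext => -[x y]; rewrite /plane_rot /shear1 /shear2 /=.
  have s2 := sin2cos2 t.
  have ks : (1 + k * sin t = cos t)%R.
    have kc : (k * (1 + cos t) = - sin t)%R by rewrite /k mulNr divfK.
    apply: (mulIf c1).
    have -> : ((1 + k * sin t) * (1 + cos t) = 1 + cos t + sin t * (k * (1 + cos t)))%R by ring.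
    by rewrite kc mulrN -expr2 s2; ring.
  have kk' : (2 * k + k * sin t * k = - sin t)%R.
    apply: (mulIf c1); rewrite (_ : 2 * k + k * sin t * k = k * (1 + (1 + k * sin t)))%R; last by ring.
    by rewrite ks /k; field.
  rewrite !addr0; congr (_, _).
    transitivity ((1 + k * sin t) * x + (2 * k + k * sin t * k) * y)%R; last by ring.
    by rewrite ks kk'; ring.
  transitivity ((1 + k * sin t) * y + sin t * x)%R; last by ring.
  by rewrite ks; ring.
by apply: mpres_comp; [exact: mpres_shear1|apply: mpres_comp;
  [exact: mpres_shear2|exact: mpres_shear1]].
Qed.

Definition dpres T := measurable_fun setT T /\
  forall F, measurable_fun setT F -> (forall p, 0 <= F p) ->
    \int[dA R]_p F p = \int[dA R]_p F (T p).

Lemma mpres_dpres T : mpres T -> dpres T.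
Proof.
move=> [mT HT]; split=> // F mF F0.
rewrite /dA ge0_integral_mscale // [RHS]ge0_integral_mscale //; last exact: measurableT_comp.
by rewrite HT.
Qed.

Lemma dpres_integral T (D : set M2) F : dpres T -> measurable D ->
  measurable_fun D F ->
  \int[dA R]_(p in D) F p = \int[dA R]_(p in T @^-1` D) F (T p).
Proof.
move=> [mT HT] mD mF; rewrite integral_mkcond [RHS]integral_mkcond.
have -> : (fun p => F (T p)) \_ (T @^-1` D) = (F \_ D) \o T.
  apply/funext => p; rewrite /patch /=.
  by have [|] := boolP (p \in T @^-1` D) => H; have [|] := boolP (T p \in D) => H' //;
    move: H H'; rewrite ?inE ?notin_setE /=.
have mFD : measurable_fun setT (F \_ D) by exact: (measurable_restrictT F mD).1 mF.
rewrite integralE [RHS]integralE funepos_comp funeneg_comp.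
by congr (_ - _); apply: HT => //; exact: measurable_funepos || exact: measurable_funeneg.
Qed.

Lemma dA_scale (k : R) F : (0 < k)%R -> measurable_fun setT F -> (forall p, 0 <= F p) ->
  \int[dA R]_p F p = (k ^+ 2)%:E * \int[dA R]_p F ((k * p.1)%R, (k * p.2)%R).
Proof.
move=> k0 mF F0.
have mT : measurable_fun setT (fun p : M2 => ((k * p.1)%R, (k * p.2)%R) : M2).
  apply/measurable_fun_pairP; split.
    by apply: measurable_funM; [exact: measurable_cst|exact: measurable_fst].
  by apply: measurable_funM; [exact: measurable_cst|exact: measurable_snd].
have mFT : measurable_fun setT (fun p : M2 => F ((k * p.1)%R, (k * p.2)%R)).
  by apply: (measurableT_comp mF).
rewrite /dA ge0_integral_mscale // [in RHS]ge0_integral_mscale // muleCA; congr (_ * _).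
rewrite (fubini_tonelli1 F mF F0) (fubini_tonelli1 _ mFT (fun p => F0 _)) /fubini_F /=.
have k0' : 0 <= k%:E by rewrite lee_fin ltW.
have mF1 : measurable_fun setT (fun x : M1 => \int[mu]_y F (x, y)).
  exact: (@measurable_fun_fubini_tonelli_F _ _ M1 M1 R mu F mF F0).
rewrite (@integral_affine k 0 (fun x => \int[mu]_y F (x, y))) ; [|exact: k0|exact: mF1|by move=> x; exact: integral_ge0].
rewrite EFinM -muleA; congr (_ * _).
rewrite -ge0_integralZl //; first last.
- by move=> x _; exact: integral_ge0.
- exact: (@measurable_fun_fubini_tonelli_F _ _ M1 M1 R mu _ mFT).
apply: eq_integral => x _; rewrite addr0 (@integral_affine k 0 (fun y => F ((k * x)%R, y))) //.
  by under eq_integral do rewrite addr0.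
exact: measurable_fun_pair2.
Qed.

End PlaneInvariance.

(** * Orthogonality of monomials for radial weights *)

Section ComplexMeasurable.
Variables (R : realType) (d : measure_display) (T : measurableType d).
Implicit Types (D : set T) (F G : T -> R[i]) (rho r : R).

Definition cmeas D F := measurable_fun D (RE \o F) /\ measurable_fun D (IM \o F).

Lemma cmeas_cst D z : cmeas D (fun=> z).
Proof. by split; exact: measurable_cst. Qed.

Lemma cmeasD D F G : cmeas D F -> cmeas D G -> cmeas D (fun p => F p + G p).
Proof.
move=> [F1 F2] [G1 G2]; split.
  rewrite (_ : _ \o _ = (RE \o F) \+ (RE \o G)); first exact: measurable_funD.
  by apply/funext => p /=; rewrite cReD.
rewrite (_ : _ \o _ = (IM \o F) \+ (IM \o G)); first exact: measurable_funD.
by apply/funext => p /=; rewrite cImD.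
Qed.

Lemma cmeasM D F G : cmeas D F -> cmeas D G -> cmeas D (fun p => F p * G p).
Proof.
move=> [F1 F2] [G1 G2]; split.
  rewrite (_ : _ \o _ = (fun p => (RE \o F) p * (RE \o G) p - (IM \o F) p * (IM \o G) p)).
    by apply: measurable_funB; exact: measurable_funM.
  by apply/funext => p /=; rewrite cReM.
rewrite (_ : _ \o _ = (fun p => (RE \o F) p * (IM \o G) p + (IM \o F) p * (RE \o G) p)).
  by apply: measurable_funD; exact: measurable_funM.
by apply/funext => p /=; rewrite cImM.
Qed.

Lemma cmeas_conj D F : cmeas D F -> cmeas D (fun p => (F p)^*%C).
Proof.
move=> [F1 F2]; split.
  by rewrite (_ : _ \o _ = RE \o F) //; apply/funext => p /=; case: (F p).
rewrite (_ : _ \o _ = (fun p => 0 - (IM \o F) p)).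
  by apply: measurable_funB => //; exact: measurable_cst.
by apply/funext => p /=; rewrite sub0r; case: (F p).
Qed.

Lemma cmeasX D F n : cmeas D F -> cmeas D (fun p => F p ^+ n).
Proof.
move=> mF; elim: n => [|n ih].
  by rewrite (_ : (fun _ => _) = fun=> 1) //; exact: cmeas_cst.
rewrite (_ : (fun _ => _) = fun p => F p * F p ^+ n); first exact: cmeasM.
by apply/funext => p; rewrite exprS.
Qed.

Lemma cmeas_psumf D F (c : T -> nat -> R[i]) n : (forall k, cmeas D (fun p => c p k)) ->
  cmeas D F -> cmeas D (fun p => psum (c p) n (F p)).
Proof.
move=> mc mF; rewrite /psum; elim: n => [|n ih].
  rewrite (_ : (fun _ => _) = fun=> 0); first exact: cmeas_cst.
  by apply/funext => p; rewrite big_ord0.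
rewrite (_ : (fun _ => _) = fun p => \sum_(i < n) c p i * F p ^+ i + c p n * F p ^+ n).
  by apply: cmeasD => //; apply: cmeasM; [exact: mc|exact: cmeasX].
by apply/funext => p; rewrite big_ord_recr.
Qed.

Lemma cmeas_psum D F c n : cmeas D F -> cmeas D (fun p => psum c n (F p)).
Proof. by apply: cmeas_psumf => k; exact: cmeas_cst. Qed.

Lemma sums_to_cvg c z v : sums_to c z v ->
  ((fun n => complex.Re (psum c n z) : R) @ \oo --> (complex.Re v : R)) /\
  ((fun n => complex.Im (psum c n z) : R) @ \oo --> (complex.Im v : R)).
Proof.
move=> cv; split; apply/cvgrPdist_lt => e e0; have [N HN] := cv e e0; exists N => // n /= /HN;
  apply: le_lt_trans; rewrite distrC.
  by rewrite -cReN -cReD le_normc_Re.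
by rewrite -cImN -cImD le_normc_Im.
Qed.

(** The coefficients may depend on the parameter: this gives the joint
measurability of K_w(v) in w and v. *)
Lemma cmeas_pserf D F (c : T -> nat -> R[i]) (f : T -> R[i] -> R[i]) rho :
  (forall k, cmeas D (fun p => c p k)) -> cmeas D F ->
  (forall p, D p -> pser_on (c p) (f p) rho) ->
  (forall p, D p -> normc (F p) < rho) -> cmeas D (fun p => f p (F p)).
Proof.
move=> mc mF cf Frho; split.
  apply: (@measurable_fun_cvg _ _ _ _ (fun n p => complex.Re (psum (c p) n (F p)))).
    by move=> n; have [] := cmeas_psumf n mc mF.
  by move=> p Dp; have [] := sums_to_cvg (cf _ Dp _ (Frho _ Dp)).
apply: (@measurable_fun_cvg _ _ _ _ (fun n p => complex.Im (psum (c p) n (F p)))).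
  by move=> n; have [] := cmeas_psumf n mc mF.
by move=> p Dp; have [] := sums_to_cvg (cf _ Dp _ (Frho _ Dp)).
Qed.

Lemma cmeas_pser D F c f rho : cmeas D F -> pser_on c f rho ->
  (forall p, D p -> normc (F p) < rho) -> cmeas D (f \o F).
Proof.
move=> mF cf Frho; apply: (@cmeas_pserf D F (fun=> c) (fun=> f) rho) => //.
by move=> k; exact: cmeas_cst.
Qed.

Lemma measurable_normc2 D F : cmeas D F -> measurable_fun D (fun p => normc (F p) ^+ 2).
Proof.
move=> [F1 F2]; rewrite (_ : (fun _ => _) = (fun p => (RE \o F) p ^+ 2 + (IM \o F) p ^+ 2)).
  by apply: measurable_funD; exact: measurable_funX.
by apply/funext => p; rewrite normc_sqr.
Qed.

Lemma measurable_normc D F : cmeas D F -> measurable_fun D (fun p => normc (F p)).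
Proof.
move=> mF; rewrite (_ : (fun _ => _) = Num.sqrt \o (fun p => normc (F p) ^+ 2)).
  apply: measurableT_comp; last exact: measurable_normc2.
  exact: (continuous_measurable_fun (@sqrt_continuous R)).
by apply/funext => p /=; rewrite sqrtr_sqr ger0_norm ?normc_ge0.
Qed.

End ComplexMeasurable.

Lemma cmeas_comp (R : realType) d (T : measurableType d) d' (T' : measurableType d') (D : set T) (E : set T')
  (g : T -> T') (F : T' -> R[i]) : measurable E -> (forall x, D x -> E (g x)) ->
  measurable_fun D g -> cmeas E F -> cmeas D (F \o g).
Proof.
move=> mE DE mg [F1 F2].
have gDE : g @` D `<=` E by move=> _ [x Dx <-]; exact: DE.
by split; [exact: (measurable_comp mE gDE F1 mg)|exact: (measurable_comp mE gDE F2 mg)].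
Qed.

Section RadialWeights.
Variable R : realType.
Local Notation M2 := (measurableTypeR R * measurableTypeR R)%type.
Implicit Types (D : set M2) (F G : M2 -> R[i]) (rho r : R) (W : R[i] -> R).

Lemma cmeas_cplx D : cmeas D (@cplx R).
Proof.
split; apply: measurable_funTS; first exact: (@measurable_fst _ _ (measurableTypeR R) (measurableTypeR R)).
exact: (@measurable_snd _ _ (measurableTypeR R) (measurableTypeR R)).
Qed.

Definition disc2 rho : set M2 := [set p | normc (cplx p) < rho].

Lemma measurable_disc2 rho : measurable (disc2 rho).
Proof.
have [r0|r0] := ltP 0 rho; last first.
  rewrite (_ : disc2 _ = set0) //; apply/seteqP; split => // p /=.
  by move=> /lt_le_trans /(_ r0); rewrite ltNge normc_ge0.
have := measurable_normc2 (cmeas_cplx setT).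
move=> /(_ measurableT `]-oo, rho ^+ 2[%classic (measurable_itv _)).
rewrite setTI; congr measurable; apply/seteqP; split => p /=; rewrite in_itv /=.
  by rewrite ltr_pXn2r // ?nnegrE ?normc_ge0 // ltW.
by move=> H; rewrite ltr_pXn2r // ?nnegrE ?normc_ge0 // ltW.
Qed.

Lemma subset_disc2 r rho : r <= rho -> disc2 r `<=` disc2 rho.
Proof. by move=> rr p /= /lt_le_trans; exact. Qed.

(** The radius rho is free because the weight 1 on small disks gives the local
estimates. *)
Record radial_weight rho W : Prop := RadialWeight {
  rw_gt0 : 0 < rho;
  rw_ge0 : forall z, normc z < rho -> 0 <= W z;
  rw_rad : forall z w, normc z < rho -> normc z = normc w -> W z = W w;
  rw_int : (dA R).-integrable (disc2 rho) (fun p => (W (cplx p))%:E) }.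

Lemma rw_meas rho W : radial_weight rho W -> measurable_fun (disc2 rho) (W \o @cplx R).
Proof. by move=> rw; apply/measurable_EFinP; exact: measurable_int (rw_int rw). Qed.

Lemma rw_sub r rho W : radial_weight rho W -> 0 < r <= rho -> radial_weight r W.
Proof.
move=> [h1 h2 h3 h4] /andP[r0 rr]; split=> //.
- by move=> z zr; apply: h2; exact: lt_le_trans rr.
- by move=> z w zr; apply: h3; exact: lt_le_trans rr.
- by apply: integrableS h4; [exact: measurable_disc2..|exact: subset_disc2].
Qed.

Definition wint rho W (g : R[i] -> R) : \bar R :=
  (\int[dA R]_(p in disc2 rho) (g (cplx p) * W (cplx p))%:E)%E.

Lemma rw_integrable rho W (g : R[i] -> R) (B : R) : radial_weight rho W ->
  measurable_fun (disc2 rho) (g \o @cplx R) ->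
  (forall z, normc z < rho -> `|g z| <= B) ->
  (dA R).-integrable (disc2 rho) (fun p => (g (cplx p) * W (cplx p))%:E).
Proof.
move=> rw mg gB; apply: (le_integrable (measurable_disc2 rho) _ _ (integrableZl (measurable_disc2 rho) B (rw_int rw))).
  by apply/measurable_EFinP; apply: measurable_funM => //; exact: rw_meas.
move=> p Dp; rewrite -EFinM !abse_EFin lee_fin !normrM ler_wpM2r //.
by apply: le_trans (gB _ Dp) _; exact: ler_norm.
Qed.

Lemma cplx_rot t (p : M2) : cplx (plane_rot t p) = eis t * cplx p.
Proof. by apply: complex_ext; rewrite ?cReM ?cImM /=; ring. Qed.

Lemma rot_disc2 t rho : plane_rot t @^-1` disc2 rho = disc2 rho.
Proof.
have H p : normc (cplx (plane_rot t p)) = normc (cplx p).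
  by rewrite cplx_rot normcM normc_eis mul1r.
apply/seteqP; split => p Hp.
  by change (normc (cplx p) < rho); rewrite -H.
by change (normc (cplx (plane_rot t p)) < rho); rewrite H.
Qed.

Lemma cconjM (x y : R[i]) : (x * y)^*%C = x^*%C * y^*%C.
Proof. exact: rmorphM. Qed.

(** A rotation by pi / (2k) preserves the weighted area and multiplies the
coefficient a by -i.  Two of them turn a into -a, so the integral equals its own
opposite. *)
Lemma cross_vanish rho W (a : R[i]) n k : radial_weight rho W -> (0 < k)%N ->
  (\int[dA R]_(p in disc2 rho)
    (complex.Re (a * cplx p ^+ n * (cplx p ^+ (n + k))^*%C) * W (cplx p))%:E = 0)%E.
Proof.
move=> rw k0.
pose g (b : R[i]) (z : R[i]) := complex.Re (b * z ^+ n * (z ^+ (n + k))^*%C).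
pose J b := wint rho W (g b).
have mg b : measurable_fun (disc2 rho) (g b \o @cplx R).
  have : cmeas (disc2 rho) (fun p => b * cplx p ^+ n * (cplx p ^+ (n + k))^*%C).
    apply: cmeasM; last by apply: cmeas_conj; apply: cmeasX; exact: cmeas_cplx.
    by apply: cmeasM; [exact: cmeas_cst|apply: cmeasX; exact: cmeas_cplx].
  by case.
have r0 := rw_gt0 rw.
have ig b : (dA R).-integrable (disc2 rho) (fun p => (g b (cplx p) * W (cplx p))%:E).
  apply: (@rw_integrable _ _ _ (normc b * (rho ^+ n * rho ^+ (n + k)))) => // z zr.
  apply: le_trans (le_normc_Re _) _.
  rewrite !normcM normc_conj !normcX -mulrA ler_wpM2l ?normc_ge0 //.
  by rewrite ler_pM ?exprn_ge0 ?normc_ge0 // lerXn2r ?nnegrE ?normc_ge0 // ltW.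
(* rotating by t multiplies the integrand by the conjugate of e^(i k t) *)
pose t : R := pi / 2 / k%:R.
have kt : k%:R * t = pi / 2 by rewrite /t mulrC divfK // pnatr_eq0 -lt0n.
have ct : cos t != -1.
  have : 0 <= cos t.
    have k1 : 1 <= k%:R :> R by rewrite ler1n.
    have p0 : 0 < pi :> R by exact: pi_gt0.
    apply: cos_ge0_pihalf; rewrite /t; apply/andP; split.
      by apply: (@le_trans _ _ 0); rewrite ?oppr_le0 ?divr_ge0 // ?divr_ge0 // ltW.
    by rewrite ler_pdivrMr ?(lt_le_trans ltr01) // ler_peMr // divr_ge0 // ltW.
  by apply: contraTneq => ->; rewrite -ltNge ltrN10.
have JJ b : J b = J (b * (eis (pi / 2))^*%C).
  rewrite /J /wint (dpres_integral (mpres_dpres (mpres_rot ct)) (measurable_disc2 rho)); last first.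
    exact: measurable_int (ig b).
  rewrite rot_disc2; apply: eq_integral => p /set_mem Dp.
  have <- : W (cplx p) = W (cplx (plane_rot t p)).
    by rewrite cplx_rot; apply: (rw_rad rw) => //; rewrite normcM normc_eis mul1r.
  apply: (congr1 (fun x : R => (x * W (cplx p))%:E)).
  rewrite /g cplx_rot; congr complex.Re.
  rewrite !exprMn !cconjM -!eisMn -kt natrD [(n%:R + _) * t]mulrDl eisD cconjM.
  have E : eis (n%:R * t) * (eis (n%:R * t))^*%C = 1.
    apply: complex_ext; rewrite ?cReM ?cImM /=.
      by rewrite mulrN opprK -!expr2 cos2Dsin2.
    by ring.
  transitivity (b * (cplx p ^+ n * (cplx p ^+ (n + k))^*%C) * (eis (k%:R * t))^*%C *
     (eis (n%:R * t) * (eis (n%:R * t))^*%C)); first by ring.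
  by rewrite E; ring.
have eI : (eis (pi / 2))^*%C = - 'i%C :> R[i].
  by apply: complex_ext; rewrite /= ?cos_pihalf ?sin_pihalf ?oppr0.
have JN : J a = J (- a).
  rewrite JJ JJ eI; congr J; rewrite -mulrA mulrNN.
  by apply: complex_ext; rewrite ?cReN ?cImN ?cReM ?cImM /=; ring.
have JN' : J (- a) = (- J a)%E.
  have -> : (- J a = (-1)%:E * J a)%E by rewrite EFinN mulN1e.
  rewrite /J /wint -(integralZl (measurable_disc2 rho) (ig a)).
  apply: eq_integral => p _; rewrite -EFinM; congr (_ %:E).
  by rewrite /g !mulNr cReN; ring.
have Jfin : J a \is a fin_num by apply: (integrable_fin_num (measurable_disc2 rho) (ig a)).
rewrite -/(wint rho W (g a)) -/(J a).
move: JN; rewrite JN' -(fineK Jfin) -EFinN => -[] H; congr (_ %:E); lra.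
Qed.

Lemma poly_parseval rho W c N : radial_weight rho W ->
  wint rho W (fun z => normc (psum c N z) ^+ 2) =
  wint rho W (fun z => \sum_(n < N) normc (c n) ^+ 2 * normc z ^+ (2 * n)).
Proof.
move=> rw; have r0 := rw_gt0 rw.
have mD := measurable_disc2 rho.
have mp n : cmeas (disc2 rho) (fun p => psum c n (cplx p)).
  by apply: cmeas_psum; exact: cmeas_cplx.
have pB n z : normc z < rho -> normc (psum c n z) <= \sum_(i < n) normc (c i) * rho ^+ i.
  move=> zr; rewrite (le_trans (normc_sumn _ (fun i => c i * z ^+ i))) //.
  apply: ler_sum => i _; rewrite normcM normcX ler_wpM2l ?normc_ge0 //.
  by rewrite lerXn2r ?nnegrE ?normc_ge0 // ltW.
have i1 n : (dA R).-integrable (disc2 rho) (fun p => (normc (psum c n (cplx p)) ^+ 2 * W (cplx p))%:E).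
  apply: (@rw_integrable _ _ (fun z => normc (psum c n z) ^+ 2) ((\sum_(i < n) normc (c i) * rho ^+ i) ^+ 2)) => //.
    exact: measurable_normc2.
  move=> z zr; rewrite ger0_norm ?sqr_ge0 // lerXn2r ?nnegrE ?normc_ge0 ?pB //.
  by apply: le_trans (pB n z zr); exact: normc_ge0.
have mn n : cmeas (disc2 rho) (fun p => c n * cplx p ^+ n).
  by apply: cmeasM; [exact: cmeas_cst|apply: cmeasX; exact: cmeas_cplx].
have i2 n : (dA R).-integrable (disc2 rho) (fun p => (normc (c n * cplx p ^+ n) ^+ 2 * W (cplx p))%:E).
  apply: (@rw_integrable _ _ (fun z => normc (c n * z ^+ n) ^+ 2) ((normc (c n) * rho ^+ n) ^+ 2)) => //.
    exact: measurable_normc2.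
  move=> z zr; rewrite ger0_norm ?sqr_ge0 // normcM normcX.
  rewrite lerXn2r ?nnegrE ?mulr_ge0 ?exprn_ge0 ?normc_ge0 ?(ltW r0) //.
  by rewrite ler_wpM2l ?normc_ge0 // lerXn2r ?nnegrE ?normc_ge0 // ltW.
have i3 n : (dA R).-integrable (disc2 rho) (fun p => (2 * complex.Re (psum c n (cplx p) * (c n * cplx p ^+ n)^*%C) * W (cplx p))%:E).
  apply: (@rw_integrable _ _ (fun z => 2 * complex.Re (psum c n z * (c n * z ^+ n)^*%C)) (2 * ((\sum_(i < n) normc (c i) * rho ^+ i) * (normc (c n) * rho ^+ n)))) => //.
    apply: measurable_funM; first exact: measurable_cst.
    by have [] := cmeasM (mp n) (cmeas_conj (mn n)).
  move=> z zr; rewrite normrM ger0_norm // ler_pM2l //.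
  apply: le_trans (le_normc_Re _) _; rewrite normcM normc_conj ler_pM ?normc_ge0 ?pB //.
  by rewrite normcM normcX ler_wpM2l ?normc_ge0 // lerXn2r ?nnegrE ?normc_ge0 // ltW.
have Z n : (\int[dA R]_(p in disc2 rho) (2 * complex.Re (psum c n (cplx p) * (c n * cplx p ^+ n)^*%C) * W (cplx p))%:E = 0)%E.
  have -> : (fun p : M2 => (2 * complex.Re (psum c n (cplx p) * (c n * cplx p ^+ n)^*%C) * W (cplx p))%:E) =
     (fun p : M2 => \sum_(i < n) (complex.Re ((2 * (c i * (c n)^*%C)) * cplx p ^+ i * (cplx p ^+ (i + (n - i)))^*%C) * W (cplx p))%:E)%E.
    apply/funext => p; rewrite sumEFin; congr (_ %:E); rewrite -mulr_suml; congr (_ * _).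
    have -> : 2 * complex.Re (psum c n (cplx p) * (c n * cplx p ^+ n)^*%C) =
       complex.Re (2 * (psum c n (cplx p) * (c n * cplx p ^+ n)^*%C)).
      by rewrite [in RHS]mulr_natl mulr2n cReD -mulr2n mulr_natl.
    have -> : 2 * (psum c n (cplx p) * (c n * cplx p ^+ n)^*%C) =
      \sum_(i < n) ((2 * (c i * (c n)^*%C)) * cplx p ^+ i * (cplx p ^+ (i + (n - i)))^*%C).
      rewrite /psum mulr_suml mulr_sumr; apply: eq_bigr => i _.
      by rewrite subnKC ?(ltnW (ltn_ord i)) // cconjM; ring.
    elim/big_ind2: _ => //= x1 x2 y1 y2 <- <-; exact: cReD.
  rewrite integral_sum //=; last first.
    move=> i; apply: (@rw_integrable _ _ (fun z => complex.Re ((2 * (c i * (c n)^*%C)) * z ^+ i * (z ^+ (i + (n - i)))^*%C)) (normc (2 * (c i * (c n)^*%C)) * (rho ^+ i * rho ^+ (i + (n - i))))) => //.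
      have : cmeas (disc2 rho) (fun p => 2 * (c i * (c n)^*%C) * cplx p ^+ i * (cplx p ^+ (i + (n - i)))^*%C).
        apply: cmeasM; last by apply: cmeas_conj; apply: cmeasX; exact: cmeas_cplx.
        by apply: cmeasM; [exact: cmeas_cst|apply: cmeasX; exact: cmeas_cplx].
      by case.
    move=> z zr; apply: le_trans (le_normc_Re _) _.
    rewrite 2!normcM normc_conj !normcX -mulrA ler_wpM2l ?normc_ge0 //.
    by rewrite ler_pM ?exprn_ge0 ?normc_ge0 // lerXn2r ?nnegrE ?normc_ge0 // ltW.
  by rewrite big1 // => i _; rewrite cross_vanish // subn_gt0.
rewrite /wint; elim: N => [|n ih].
  by apply: eq_integral => p _; rewrite big_ord0 /psum big_ord0 normc0 expr0n.
have -> : (fun p : M2 => (normc (psum c n.+1 (cplx p)) ^+ 2 * W (cplx p))%:E) =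
  ((fun p : M2 => (normc (psum c n (cplx p)) ^+ 2 * W (cplx p))%:E) \+
   ((fun p => (normc (c n * cplx p ^+ n) ^+ 2 * W (cplx p))%:E) \+
    (fun p => (2 * complex.Re (psum c n (cplx p) * (c n * cplx p ^+ n)^*%C) * W (cplx p))%:E)))%E.
  apply/funext => p; rewrite /= -!EFinD; congr (_ %:E); rewrite -!mulrDl; congr (_ * _).
  rewrite /psum big_ord_recr /= -/(psum c n (cplx p)) !normc_sqr.
  move: (psum c n (cplx p)) (c n * cplx p ^+ n) => [a b] [a' b'] /=; ring.
rewrite integralD //; last by apply: integrableD.
rewrite integralD // Z adde0 ih -integralD //.
  apply: eq_integral => p _; rewrite -EFinD; congr (_ %:E).
  by rewrite big_ord_recr /= mulrDl normcM normcX exprMn -exprM [(n * 2)%N]mulnC.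
apply: (@rw_integrable _ _ (fun z => \sum_(i < n) normc (c i) ^+ 2 * normc z ^+ (2 * i)) (\sum_(i < n) normc (c i) ^+ 2 * rho ^+ (2 * i))) => //.
  apply: measurable_sum => i; apply: measurable_funM; first exact: measurable_cst.
  rewrite (_ : (fun _ => _) = fun p : M2 => (normc (cplx p) ^+ 2) ^+ i).
    by apply: measurable_funX; apply: measurable_normc2; exact: cmeas_cplx.
  by apply/funext => p; rewrite exprM.
move=> z zr; rewrite ger0_norm; last first.
  by apply: sumr_ge0 => i _; rewrite mulr_ge0 ?exprn_ge0 ?normc_ge0 ?sqr_ge0.
apply: ler_sum => i _; rewrite ler_wpM2l ?sqr_ge0 //.
by rewrite lerXn2r ?nnegrE ?normc_ge0 // ltW.
Qed.

End RadialWeights.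

(** * Parseval identity *)

Local Arguments normc : simpl never.

Section Parseval.
Variable R : realType.
Local Notation M2 := (measurableTypeR R * measurableTypeR R)%type.
Implicit Types (D : set M2) (rho r : R) (W : R[i] -> R) (c : nat -> R[i]) (f : R[i] -> R[i]).

(** Monotone convergence along an increasing sequence of smaller disks. *)
Lemma disc2_exhaust rho (F : M2 -> \bar R) (B : \bar R) : 0 < rho ->
  measurable_fun (disc2 rho) F -> (forall p, disc2 rho p -> 0 <= F p)%E ->
  (forall r, 0 < r < rho -> (\int[dA R]_(p in disc2 r) F p <= B)%E) ->
  (\int[dA R]_(p in disc2 rho) F p <= B)%E.
Proof.
move=> r0 mF F0 HB.
pose r k : R := rho * (1 - k.+2%:R^-1).
have rk k : 0 < r k < rho.
  have k1 : 0 < k.+2%:R^-1 :> R by rewrite invr_gt0.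
  have k2 : k.+2%:R^-1 < 1 :> R by rewrite invf_lt1 // ltr1n.
  by rewrite /r mulr_gt0 ?subr_gt0 //= gtr_pMr // gtrBl.
have U : disc2 rho = \bigcup_k disc2 (r k).
  apply/seteqP; split=> [p Dp|p [k _]].
    have e0 : 0 < 1 - normc (cplx p) / rho by rewrite subr_gt0 ltr_pdivrMr // mul1r.
    have [k Hk] : exists k : nat, (1 - normc (cplx p) / rho)^-1 < k%:R.
      by exists (Num.bound (1 - normc (cplx p) / rho)^-1); apply: archi_boundP; rewrite invr_ge0 ltW.
    exists k => //; change (normc (cplx p) < r k).
    rewrite /r -ltr_pdivrMl // mulrC ltrBrDl addrC -ltrBrDl.
    rewrite -[ltRHS]invrK ltf_pV2 ?posrE ?invr_gt0 ?ltr0Sn //.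
    by apply: lt_trans Hk _; rewrite ltr_nat.
  by apply: subset_disc2; case/andP: (rk k) => _ /ltW.
rewrite U.
have Cv : (\int[dA R]_(p in disc2 (r k)) F p)%E @[k --> \oo] --> (\int[dA R]_(p in \bigcup_k disc2 (r k)) F p)%E.
  apply: ge0_nondecreasing_set_cvg_integral.
  - move=> n m nm; apply/subsetPset; apply: subset_disc2.
    by rewrite /r ler_pM2l // lerB // lef_pV2 ?posrE // ler_nat !ltnS.
  - by move=> k; exact: measurable_disc2.
  - move=> k; apply: measurable_funS mF; [exact: measurable_disc2|].
    by apply: subset_disc2; case/andP: (rk k) => _ /ltW.
  - move=> k p Dp; apply: F0; move: Dp; apply: subset_disc2.
    by case/andP: (rk k) => _ /ltW.
rewrite -(cvg_lim _ Cv) //; apply: lime_le; first by apply/cvg_ex; eexists; exact: Cv.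
by apply: nearW => k; exact: HB.
Qed.

Lemma measurable_pser2 rho c f r : pser_on c f rho -> r <= rho ->
  measurable_fun (disc2 r) (fun p => normc (f (cplx p)) ^+ 2).
Proof.
move=> cf rr; apply: (@measurable_normc2 _ _ _ _ (f \o @cplx R)).
by apply: (cmeas_pser _ cf); [exact: cmeas_cplx|move=> p /lt_le_trans; exact].
Qed.

(** On a smaller disk the power series converges uniformly, so dominated
convergence applies whatever f does near the boundary. *)
Lemma wint_psum_cvg rho W c f r : radial_weight rho W -> pser_on c f rho -> 0 < r < rho ->
  wint r W (fun z => normc (psum c n z) ^+ 2) @[n --> \oo] --> wint r W (fun z => normc (f z) ^+ 2)%R.
Proof.
move=> rw cf /andP[r0 rr].
have rw' : radial_weight r W by apply: rw_sub rw _; rewrite r0 ltW.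
have [|M [th [M0 th01 _ tl]]] := pser_tail (q := r) cf; first by rewrite ltW.
have fM n z : normc z < r -> normc (psum c n z - f z) <= M.
  move=> zr; apply: le_trans (tl n z (ltW zr)) _.
  rewrite ler_piMr ?(ltW M0) // exprn_ile1 //; case/andP: th01 => // ? ?; exact: ltW.
have pM n z : normc z < r -> normc (psum c n z) <= 2 * M.
  move=> zr; have -> : psum c n z = (psum c n z - f z) - (psum c 0 z - f z).
    by rewrite /psum big_ord0; ring.
  by rewrite mulr_natl mulr2n; apply: ler_normcD; rewrite ?normcN; exact: fM.
apply: (@dominated_cvg _ _ _ _ _ (measurable_disc2 r) _ _ (fun p => ((2 * M) ^+ 2)%:E * (W (cplx p))%:E)%E).
- move=> n; apply/measurable_EFinP; apply: measurable_funM; last exact: rw_meas.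
  by apply: measurable_normc2; apply: cmeas_psum; exact: cmeas_cplx.
- move=> p Dp; apply: cvg_EFin; first by apply: nearW.
  apply: cvgM; last exact: cvg_cst.
  have [H1 H2] := sums_to_cvg (cf (cplx p) (lt_trans Dp rr)).
  rewrite (_ : (fun n => normc (psum c n (cplx p)) ^+ 2) =
    (fun n => complex.Re (psum c n (cplx p)) * complex.Re (psum c n (cplx p)) +
              complex.Im (psum c n (cplx p)) * complex.Im (psum c n (cplx p)))).
    by rewrite normc_sqr !expr2; apply: cvgD; apply: cvgM.
  by apply/funext => n; rewrite normc_sqr !expr2.
- by move=> p _.
- by apply: integrableZl; [exact: measurable_disc2|exact: rw_int rw'].
- move=> n p Dp; rewrite -EFinM abse_EFin lee_fin normrM.
  rewrite (ger0_norm (rw_ge0 rw' Dp)) ler_wpM2r ?(rw_ge0 rw' Dp) //.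
  rewrite ger0_norm ?sqr_ge0 // lerXn2r ?nnegrE ?normc_ge0 ?pM //.
  by rewrite mulr_ge0 // ltW.
Qed.

(** What remains of the squared modulus of the N-th partial sum after integration
against a radial weight. *)
Definition diagp c N (z : R[i]) : R := \sum_(n < N) normc (c n) ^+ 2 * normc z ^+ (2 * n).

Lemma diagp_ge0 c N z : 0 <= diagp c N z.
Proof. by apply: sumr_ge0 => i _; rewrite mulr_ge0 ?exprn_ge0 ?normc_ge0 ?sqr_ge0. Qed.

Lemma diagp_le c N M z : (N <= M)%N -> diagp c N z <= diagp c M z.
Proof.
move=> NM; rewrite -subr_ge0 /diagp (sum_split (fun n => normc (c n) ^+ 2 * normc z ^+ (2 * n))) //.
by apply: sumr_ge0 => i _; rewrite mulr_ge0 ?exprn_ge0 ?normc_ge0 ?sqr_ge0.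
Qed.

Lemma measurable_normcX D n : measurable_fun D (fun p : M2 => normc (cplx p) ^+ (2 * n)).
Proof.
rewrite (_ : (fun _ => _) = fun p : M2 => (normc (cplx p) ^+ 2) ^+ n).
  by apply: measurable_funX; apply: measurable_normc2; exact: cmeas_cplx.
by apply/funext => p; rewrite exprM.
Qed.

Lemma measurable_diagp D c N : measurable_fun D (fun p => diagp c N (cplx p)).
Proof.
apply: measurable_sum => i; apply: measurable_funM; first exact: measurable_cst.
exact: measurable_normcX.
Qed.

Lemma measurable_wint rho W (g : R[i] -> R) : radial_weight rho W ->
  measurable_fun (disc2 rho) (g \o @cplx R) ->
  measurable_fun (disc2 rho) (fun p => (g (cplx p) * W (cplx p))%:E).
Proof.
by move=> rw mg; apply/measurable_EFinP; apply: measurable_funM => //; exact: rw_meas.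
Qed.

Lemma le_wint rho W (g h : R[i] -> R) : radial_weight rho W ->
  measurable_fun (disc2 rho) (g \o @cplx R) -> measurable_fun (disc2 rho) (h \o @cplx R) ->
  (forall z, normc z < rho -> 0 <= g z <= h z) ->
  (wint rho W g <= wint rho W h)%E.
Proof.
move=> rw mg mh gh; apply: ge0_le_integral => //.
- exact: measurable_disc2.
- move=> p Dp; rewrite lee_fin mulr_ge0 ?(rw_ge0 rw) //.
  by case/andP: (gh _ Dp).
- exact: measurable_wint.
- exact: measurable_wint.
- move=> p Dp; rewrite lee_fin ler_wpM2r ?(rw_ge0 rw) //.
  by case/andP: (gh _ Dp).
Qed.

Lemma wint_ge0 rho W (g : R[i] -> R) : radial_weight rho W ->
  (forall z, normc z < rho -> 0 <= g z) -> (0 <= wint rho W g)%E.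
Proof.
move=> rw g0; apply: integral_ge0 => p Dp; rewrite lee_fin mulr_ge0 ?(rw_ge0 rw) //.
exact: g0.
Qed.

Lemma wint_sub r rho W (g : R[i] -> R) : radial_weight rho W -> 0 < r <= rho ->
  measurable_fun (disc2 rho) (g \o @cplx R) ->
  (forall z, normc z < rho -> 0 <= g z) ->
  (wint r W g <= wint rho W g)%E.
Proof.
move=> rw /andP[r0 rr] mg g0; apply: ge0_subset_integral.
- exact: measurable_disc2.
- exact: measurable_disc2.
- exact: measurable_wint.
- by move=> p Dp; rewrite lee_fin mulr_ge0 ?(rw_ge0 rw) //; exact: g0.
- exact: subset_disc2.
Qed.

(** On a smaller disk this is orthogonality followed by the limit of the partial
sums; the smaller disks then exhaust the disk. *)
Lemma bessel rho W c f N : radial_weight rho W -> pser_on c f rho ->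
  (wint rho W (diagp c N) <= wint rho W (fun z => normc (f z) ^+ 2)%R)%E.
Proof.
move=> rw cf; apply: disc2_exhaust; first exact: rw_gt0 rw.
- by apply: measurable_wint => //; exact: measurable_diagp.
- by move=> p Dp; rewrite lee_fin mulr_ge0 ?diagp_ge0 ?(rw_ge0 rw).
move=> r rr; have /andP[r0 rr'] := rr.
have rw' : radial_weight r W by apply: rw_sub rw _; rewrite r0 ltW.
have C := wint_psum_cvg rw cf rr.
apply: (@le_trans _ _ (wint r W (fun z => normc (f z) ^+ 2)%R)); last first.
  apply: wint_sub => //; first by rewrite r0 ltW.
    exact: (@measurable_pser2 rho c f rho).
  by move=> z _; exact: sqr_ge0.
rewrite -(cvg_lim _ C) //; apply: lime_ge; first by apply/cvg_ex; eexists; exact: C.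
exists N => // n /= Nn; rewrite (poly_parseval c n rw').
apply: le_wint => //; [exact: measurable_diagp|exact: measurable_diagp|].
by move=> z _; rewrite diagp_ge0 diagp_le.
Qed.

(** The converse of [bessel]: square-summable coefficients give a function of
finite norm. *)
Lemma parseval_le rho W c f (B : \bar R) : radial_weight rho W -> pser_on c f rho ->
  (forall N, (wint rho W (diagp c N) <= B)%E) ->
  (wint rho W (fun z => normc (f z) ^+ 2)%R <= B)%E.
Proof.
move=> rw cf HB; apply: disc2_exhaust; first exact: rw_gt0 rw.
- by apply: (@measurable_wint _ _ (fun z => normc (f z) ^+ 2)) => //; exact: (@measurable_pser2 rho c f rho).
- by move=> p Dp; rewrite lee_fin mulr_ge0 ?sqr_ge0 ?(rw_ge0 rw).
move=> r rr; have /andP[r0 rr'] := rr.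
have rw' : radial_weight r W by apply: rw_sub rw _; rewrite r0 ltW.
have C := wint_psum_cvg rw cf rr.
rewrite -[X in (X <= _)%E]/(wint r W (fun z => normc (f z) ^+ 2)%R).
rewrite -(cvg_lim _ C) //; apply: lime_le; first by apply/cvg_ex; eexists; exact: C.
apply: nearW => n; rewrite (poly_parseval c n rw').
apply: le_trans (HB n); apply: wint_sub => //; first by rewrite r0 ltW.
  exact: measurable_diagp.
by move=> z _; exact: diagp_ge0.
Qed.

Definition moment rho W n : R := fine (wint rho W (fun z => normc z ^+ (2 * n))%R).

Lemma moment_fin rho W n : radial_weight rho W ->
  (wint rho W (fun z => normc z ^+ (2 * n))%R = (moment rho W n)%:E)%E.
Proof.
move=> rw; rewrite /moment fineK //.
apply: (integrable_fin_num (measurable_disc2 rho)).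
apply: (@rw_integrable _ _ _ (fun z => normc z ^+ (2 * n))%R (rho ^+ (2 * n))) => //.
  exact: measurable_normcX.
move=> z zr; rewrite ger0_norm ?exprn_ge0 ?normc_ge0 //.
by rewrite lerXn2r ?nnegrE ?normc_ge0 // ltW // (rw_gt0 rw).
Qed.

Lemma wint_diagp rho W c N : radial_weight rho W ->
  wint rho W (diagp c N) = (\sum_(n < N) normc (c n) ^+ 2 * moment rho W n)%:E.
Proof.
move=> rw; rewrite -sumEFin.
have -> : wint rho W (diagp c N) = (\int[dA R]_(p in disc2 rho)
   \sum_(n < N) (normc (c n) ^+ 2)%:E * (normc (cplx p) ^+ (2 * n) * W (cplx p))%:E)%E.
  apply: eq_integral => p _; rewrite /diagp mulr_suml -sumEFin; apply: eq_bigr => i _.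
  by rewrite -EFinM mulrA.
rewrite ge0_integral_sum //=.
- apply: eq_bigr => i _; rewrite ge0_integralZl_EFin ?sqr_ge0 //.
  + by rewrite -[LHS]/((normc (c i) ^+ 2)%:E * wint rho W (fun z => normc z ^+ (2 * i))%R)%E moment_fin.
  + exact: measurable_disc2.
  + by move=> p Dp; rewrite lee_fin mulr_ge0 ?exprn_ge0 ?normc_ge0 ?(rw_ge0 rw).
  + by apply: (@measurable_wint _ _ (fun z => normc z ^+ (2 * i))) => //; exact: measurable_normcX.
- exact: measurable_disc2.
- move=> i; apply: measurable_funeM.
  by apply: (@measurable_wint _ _ (fun z => normc z ^+ (2 * i))) => //; exact: measurable_normcX.
- move=> i p Dp; rewrite -EFinM lee_fin mulr_ge0 ?sqr_ge0 //.
  by rewrite mulr_ge0 ?exprn_ge0 ?normc_ge0 ?(rw_ge0 rw).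
Qed.

End Parseval.

(** * Sub-mean value and Lipschitz estimates *)

Section Area.
Variable R : realType.
Local Notation M1 := (measurableTypeR R).
Local Notation M2 := (measurableTypeR R * measurableTypeR R)%type.
Implicit Types (D : set M2) (rho r s : R) (W : R[i] -> R) (c : nat -> R[i]) (f : R[i] -> R[i]).

(** Scaling by r multiplies area by r^2. *)
Lemma dA_disc r : 0 < r -> (dA R (disc2 r) = (r ^+ 2)%:E * dA R (disc2 1))%E.
Proof.
move=> r0; have mr := measurable_disc2 r; have m1 := measurable_disc2 (1 : R).
have I D : measurable D -> dA R D = (\int[dA R]_p (\1_D p)%:E)%E.
  by move=> mD; rewrite integral_indic // setIT.
rewrite !I // (@dA_scale R r (fun p : M2 => (\1_(disc2 r) p)%:E)) //; last first.
  by apply/measurable_EFinP; exact: measurable_indic.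
congr (_ * _)%E; apply: eq_integral => p _; congr (_ %:E).
rewrite !indicE; congr (_ %:R); congr nat_of_bool.
have E : normc (cplx ((r * p.1), (r * p.2))) = r * normc (cplx p).
  have -> : cplx ((r * p.1), (r * p.2)) = r%:C * cplx p.
    by apply: complex_ext; rewrite ?cReM ?cImM /=; ring.
  by rewrite normcM normc_real gtr0_norm.
apply/idP/idP => /set_mem H; apply/mem_set; move: H; rewrite /disc2 /= E.
  by rewrite -[ltRHS]mulr1 ltr_pM2l.
by move=> H; rewrite -[ltRHS]mulr1 ltr_pM2l.
Qed.

Lemma dA_box (a : R) : 0 <= a -> dA R (`[(- a), a] `*` `[(- a), a]) = (pi^-1 * (2 * a) ^+ 2)%:E.
Proof.
move=> a0; set B := (X in dA R X); rewrite -[LHS]/((pi^-1)%:E * (@lebesgue_measure R \x @lebesgue_measure R)%E B)%E.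
rewrite /B product_measure1E //.
have L : lebesgue_measure (`[(- a), a] : set M1) = (2 * a)%:E.
  rewrite lebesgue_measure_itv /= lte_fin; case: ifP => [_|/negbT]; first by rewrite -EFinB; congr (_ %:E); ring.
  by rewrite -leNgt => H; congr (_ %:E); lra.
transitivity ((pi^-1)%:E * ((2 * a)%:E * (2 * a)%:E))%E; last by rewrite -!EFinM.
by congr (_ * (_ * _))%E; exact: L.
Qed.

Lemma measurable_box (a : R) : measurable (`[(- a), a] `*` `[(- a), a] : set M2).
Proof. by apply: measurableX; exact: measurable_itv. Qed.

(** The number 1, by the normalization of dA.  The estimates below carry
unspecified constants, so it is kept as a positive constant. *)
Definition disk_area : R := fine (dA R (disc2 1)).

Lemma dA1_fin : (dA R (disc2 1) < +oo)%E.
Proof.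
apply: (@le_lt_trans _ _ (dA R (`[(- 1), 1] `*` `[(- 1), 1]))).
  apply: le_measure; rewrite ?inE; [exact: measurable_disc2|exact: measurable_box|].
  move=> p /= H; rewrite !in_itv /= -!ler_norml.
  split; apply: le_trans (ltW H); [exact: (le_normc_Re (cplx p))|exact: (le_normc_Im (cplx p))].
by rewrite dA_box // ltry.
Qed.

Lemma dA1E : dA R (disc2 1) = disk_area%:E.
Proof. by rewrite /disk_area fineK // ge0_fin_numE ?measure_ge0 // dA1_fin. Qed.

Lemma disk_area_gt0 : 0 < disk_area.
Proof.
rewrite -lte_fin -dA1E; apply: (@lt_le_trans _ _ (dA R (`[(- (1/3)), 1/3] `*` `[(- (1/3)), 1/3]))).
  by rewrite dA_box // lte_fin mulr_gt0 ?invr_gt0 ?pi_gt0 // exprn_gt0 // mulr_gt0.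
apply: le_measure; rewrite ?inE; [exact: measurable_box|exact: measurable_disc2|].
move=> p /=; rewrite !in_itv /= -!ler_norml => -[H1 H2].
have := normc_le_ReIm (cplx p); rewrite /= => /le_lt_trans; apply; lra.
Qed.

Lemma dA_discE r : 0 < r -> dA R (disc2 r) = (r ^+ 2 * disk_area)%:E.
Proof. by move=> r0; rewrite dA_disc // dA1E -EFinM. Qed.

Lemma dA_annulus s r : 0 < s -> s <= r -> dA R (disc2 r `\` disc2 s) = ((r ^+ 2 - s ^+ 2) * disk_area)%:E.
Proof.
move=> s0 sr; have r0 := lt_le_trans s0 sr.
have I : disc2 r `&` disc2 s = disc2 s by apply: setIidr; exact: subset_disc2.
have E : dA R (disc2 r `\` disc2 s) = (dA R (disc2 r) - dA R (disc2 s))%E.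
  rewrite -{2}I; apply: measureD; [exact: measurable_disc2|exact: measurable_disc2|].
  by apply: le_lt_trans (ltry (r ^+ 2 * disk_area)); rewrite -dA_discE.
by rewrite E !dA_discE // -EFinB mulrBl.
Qed.

Lemma radial_weight1 rho : 0 < rho -> radial_weight rho (fun=> 1 : R).
Proof.
move=> r0; split=> //; apply/integrableP; split; first exact: measurable_cst.
rewrite (@eq_integral _ _ _ _ _ (cst 1%:E)); last by move=> p _; rewrite /= normr1.
by rewrite integral_cst ?mul1e ?dA_discE ?ltry //; exact: measurable_disc2.
Qed.

(** Keep only the part of the disk outside radius s. *)
Lemma moment_ge rho W s n : radial_weight rho W -> 0 <= s ->
  ((s ^+ (2 * n))%:E * \int[dA R]_(p in disc2 rho `\` disc2 s) (W (cplx p))%:E <=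
     (moment rho W n)%:E)%E.
Proof.
move=> rw s0; have mD := measurable_disc2 rho; have mA : measurable (disc2 rho `\` disc2 s).
  by apply: measurableD; exact: measurable_disc2.
have mW : measurable_fun (disc2 rho `\` disc2 s) (fun p : M2 => (W (cplx p))%:E).
  apply: measurable_funS (measurable_int _ (rw_int rw)) => //; exact: subDsetl.
rewrite -moment_fin // -ge0_integralZl_EFin ?exprn_ge0 //; last first.
  by move=> p [Dp _]; rewrite lee_fin (rw_ge0 rw).
have mn : measurable_fun (disc2 rho) (fun p : M2 => (normc (cplx p) ^+ (2 * n) * W (cplx p))%:E).
  by apply: (@measurable_wint _ _ _ (fun z => normc z ^+ (2 * n))) => //; exact: measurable_normcX.
apply: (@le_trans _ _ (\int[dA R]_(p in disc2 rho `\` disc2 s) (normc (cplx p) ^+ (2 * n) * W (cplx p))%:E)%E).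
  apply: ge0_le_integral => //.
  - by move=> p [Dp _]; rewrite -EFinM lee_fin mulr_ge0 ?exprn_ge0 // (rw_ge0 rw).
  - exact: measurable_funeM.
  - by apply: measurable_funS mn => //; exact: subDsetl.
  - move=> p [Dp /negP]; rewrite -leNgt => sp.
    by rewrite -EFinM lee_fin ler_wpM2r ?(rw_ge0 rw) // lerXn2r ?nnegrE ?normc_ge0.
apply: (ge0_subset_integral (dA R) mA mD mn); last exact: subDsetl.
by move=> p Dp; rewrite lee_fin mulr_ge0 ?exprn_ge0 ?normc_ge0 // (rw_ge0 rw).
Qed.

Lemma moment1_ge rho n : 0 < rho ->
  (rho / 2) ^+ (2 * n) * (3 / 4 * rho ^+ 2 * disk_area) <= moment rho (fun=> 1) n.
Proof.
move=> r0; have := moment_ge n (radial_weight1 r0) (_ : 0 <= rho / 2).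
move=> /(_ _)/wrap[]; first by rewrite divr_ge0 // ltW.
rewrite (@eq_integral _ _ _ _ _ (cst 1%:E)) // integral_cst; last first.
  by apply: measurableD; exact: measurable_disc2.
rewrite mul1e dA_annulus ?divr_gt0 //; last by lra.
rewrite -EFinM lee_fin; apply: le_trans.
by rewrite ler_wpM2l ?exprn_ge0 ?divr_ge0 ?(ltW r0) // le_eqVlt; apply/orP; left; apply/eqP; field.
Qed.

Definition discat (a : R[i]) rho : set M2 := [set p | normc (cplx p - a) < rho].

Definition transl (a : R[i]) (p : M2) : M2 := (p.1 + complex.Re a, p.2 + complex.Im a).

Lemma cplx_transl a p : cplx (transl a p) = a + cplx p.
Proof. by apply: complex_ext; rewrite ?cReD ?cImD /= addrC. Qed.

Lemma dpres_transl a : dpres (transl a).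
Proof.
have -> : transl a = shear1 0 (complex.Re a) \o shear2 0 (complex.Im a).
  by apply/funext => p; rewrite /transl /shear1 /shear2 /= !mul0r !add0r.
by apply/mpres_dpres/mpres_comp; [exact: mpres_shear1|exact: mpres_shear2].
Qed.

Lemma discat_transl a rho : transl a @^-1` discat a rho = disc2 rho.
Proof.
have H p : cplx (transl a p) - a = cplx p by rewrite cplx_transl addrC addKr.
apply/seteqP; split => p Hp.
  by change (normc (cplx p) < rho); rewrite -H.
by change (normc (cplx (transl a p) - a) < rho); rewrite H.
Qed.

Lemma measurable_discat a rho : measurable (discat a rho).
Proof.
have -> : discat a rho = transl (- a) @^-1` disc2 rho.
  have H p : cplx (transl (- a) p) = cplx p - a by rewrite cplx_transl addrC.
  apply/seteqP; split => p Hp.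
    by change (normc (cplx (transl (- a) p)) < rho); rewrite H.
  by change (normc (cplx p - a) < rho); rewrite -H.
have [m _] := dpres_transl (- a).
by rewrite -[X in measurable X]setTI; apply: m => //; exact: measurable_disc2.
Qed.

Lemma integral_discat a rho (F : M2 -> \bar R) : measurable_fun (discat a rho) F ->
  (\int[dA R]_(p in discat a rho) F p = \int[dA R]_(p in disc2 rho) F (transl a p))%E.
Proof.
move=> mF; rewrite (dpres_integral (dpres_transl a) (measurable_discat a rho) mF).
by rewrite discat_transl.
Qed.

Lemma taylor_at (h : R[i] -> R[i]) a rho : 0 < rho ->
  (forall w, normc (w - a) < rho -> holo_at h w) ->
  exists c, pser_on c (fun w => h (a + w)) rho.
Proof.
move=> r0 hh; apply: taylor => // w wr.
have [|l hl] := hh (a + w); first by rewrite addrC addKr.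
by exists l; exact: cder_shift.
Qed.

Lemma pser_c0 c f rho : 0 < rho -> pser_on c f rho -> c 0%N = f 0.
Proof.
move=> r0 cf; apply/eqP; rewrite -subr_eq0; apply/eqP/eq0_normc/eqP.
rewrite eq_le normc_ge0 andbT; apply/ler_addgt0Pr => e e0; rewrite add0r.
have [|N HN] := cf 0 _ e e0; first by rewrite normc0.
have := HN N.+1 (leqnSn _); rewrite /psum big_ord_recl big1 ?addr0 ?expr0 ?mulr1 => [/ltW//|i _].
by rewrite lift0 exprS mul0r mulr0.
Qed.

Lemma measurable_holo_discat (h : R[i] -> R[i]) a rho : 0 < rho ->
  (forall w, normc (w - a) < rho -> holo_at h w) ->
  measurable_fun (discat a rho) (fun p => normc (h (cplx p)) ^+ 2).
Proof.
move=> r0 hh; have [c cP] := taylor_at r0 hh.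
rewrite (_ : (fun _ => _) = (fun p => normc (((fun w => h (a + w)) \o (fun p => cplx p + - a)) p) ^+ 2)).
  apply: measurable_normc2; apply: (cmeas_pser _ cP) => //.
  by apply: cmeasD; [exact: cmeas_cplx|exact: cmeas_cst].
by apply/funext => p /=; rewrite addrCA subrr addr0.
Qed.

(** The zeroth term of the Bessel inequality for the weight 1 on the disk around a. *)
Lemma submean (h : R[i] -> R[i]) a rho : 0 < rho ->
  (forall w, normc (w - a) < rho -> holo_at h w) ->
  ((normc (h a) ^+ 2 * (rho ^+ 2 * disk_area))%:E <=
     \int[dA R]_(p in discat a rho) (normc (h (cplx p)) ^+ 2)%:E)%E.
Proof.
move=> r0 hh; have [c cP] := taylor_at r0 hh.
rewrite integral_discat; last by apply/measurable_EFinP; exact: measurable_holo_discat.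
have := bessel 1 (radial_weight1 r0) cP.
rewrite wint_diagp; last exact: radial_weight1.
rewrite big_ord_recl big_ord0 addr0 /= (pser_c0 r0 cP) addr0.
have -> : moment rho (fun=> 1) 0 = rho ^+ 2 * disk_area.
  apply/EFin_inj; rewrite -(moment_fin _ (radial_weight1 r0)) /wint.
  rewrite (@eq_integral _ _ _ _ _ (cst 1%:E)); last by move=> p _; rewrite muln0 expr0 mulr1.
  by rewrite integral_cst ?mul1e ?dA_discE //; exact: measurable_disc2.
move=> /le_trans; apply; rewrite /wint le_eqVlt; apply/orP; left; apply/eqP.
by apply: eq_integral => p _; rewrite mulr1 cplx_transl.
Qed.

(** The Taylor coefficients at a are bounded by the Bessel inequality for the
weight 1; the terms of order at least 1 are then summed geometrically. *)
Lemma cauchy_lipschitz (h : R[i] -> R[i]) a rho M : 0 < rho -> 0 <= M ->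
  (forall w, normc (w - a) < rho -> holo_at h w) ->
  (forall w, normc (w - a) < rho -> normc (h w) <= M) ->
  forall w, normc (w - a) <= rho / 4 ->
    normc (h w - h a) <= 8 * M / rho * normc (w - a).
Proof.
move=> r0 M0 hh hM w wa; have [c cP] := taylor_at r0 hh.
have rw := radial_weight1 r0.
have cb n : normc (c n) * (rho / 2) ^+ n <= 2 * M.
  have := bessel n.+1 rw cP; rewrite wint_diagp // => B1.
  have B2 : (wint rho (fun=> 1)%R (fun z => normc (h (a + z)) ^+ 2)%R <= (M ^+ 2 * (rho ^+ 2 * disk_area))%:E)%E.
    apply: (@le_trans _ _ (\int[dA R]_(p in disc2 rho) (cst (M ^+ 2)%:E) p)%E).
      apply: ge0_le_integral => //.
      - exact: measurable_disc2.
      - by move=> p _; rewrite lee_fin mulr1 sqr_ge0.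
      - by apply: (@measurable_wint _ rho (fun=> 1) (fun z => normc (h (a + z)) ^+ 2)) => //; exact: measurable_pser2 cP (lexx _).
      - move=> p Dp; rewrite lee_fin mulr1 lerXn2r ?nnegrE ?normc_ge0 // hM //.
        by rewrite addrC addKr.
    by rewrite integral_cst ?dA_discE //; exact: measurable_disc2.
  have := le_trans B1 B2; rewrite lee_fin => B3.
  have B4 : normc (c n) ^+ 2 * moment rho (fun=> 1) n <= M ^+ 2 * (rho ^+ 2 * disk_area).
    apply: le_trans B3; rewrite big_ord_recr /= lerDr; apply: sumr_ge0 => i _.
    rewrite mulr_ge0 ?sqr_ge0 // -lee_fin -moment_fin //; apply: wint_ge0 => // z _.
    by rewrite exprn_ge0 // normc_ge0.
  have B5 := moment1_ge n r0.
  have K0 : 0 < rho ^+ 2 * disk_area by rewrite mulr_gt0 ?disk_area_gt0 // exprn_gt0.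
  have B6 : normc (c n) ^+ 2 * ((rho / 2) ^+ (2 * n) * (3 / 4)) <= M ^+ 2.
    rewrite -(ler_pM2r K0); apply: le_trans B4.
    have -> : normc (c n) ^+ 2 * ((rho / 2) ^+ (2 * n) * (3 / 4)) * (rho ^+ 2 * disk_area) =
       normc (c n) ^+ 2 * ((rho / 2) ^+ (2 * n) * (3 / 4 * rho ^+ 2 * disk_area)) by ring.
    by rewrite ler_wpM2l ?sqr_ge0.
  have q0 : 0 <= normc (c n) * (rho / 2) ^+ n by rewrite mulr_ge0 ?normc_ge0 ?exprn_ge0 ?divr_ge0 // ltW.
  rewrite -(ler_pXn2r (n := 2)) ?nnegrE //; last by rewrite mulr_ge0.
  rewrite exprMn -exprM [(n * 2)%N]mulnC.
  have q1 : 0 <= normc (c n) ^+ 2 * (rho / 2) ^+ (2 * n) by rewrite mulr_ge0 ?sqr_ge0 ?exprn_ge0 ?divr_ge0 // ltW.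
  move: B6 q1; rewrite mulrA; set X := normc _ ^+ 2 * _ => B6 q1.
  by rewrite exprMn; lra.
set u := w - a in wa *; have -> : w = a + u by rewrite /u addrC subrK.
pose q := 2 * normc u / rho.
have q0 : 0 <= q by rewrite /q divr_ge0 ?(ltW r0) // mulr_ge0 ?normc_ge0.
have q2 : q <= 1 / 2 by rewrite /q ler_pdivrMr //; lra.
have ur : normc u < rho by apply: le_lt_trans wa _; rewrite ltr_pdivrMr //; lra.
apply/ler_addgt0Pr => e e0.
have [N HN] := cP u ur e e0.
have := HN N.+1 (leqnSn _); set P := psum _ _ _ => HP.
have -> : h (a + u) - h a = (P - h a) + - (P - h (a + u)) by ring.
apply: ler_normcD; last by rewrite normcN ltW.
have -> : P - h a = \sum_(1 <= i < N.+1) c i * u ^+ i.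
  rewrite /P /psum -(big_mkord xpredT (fun i => c i * u ^+ i)) big_ltn // expr0 mulr1.
  by rewrite (pser_c0 r0 cP) addr0 addrC addKr.
rewrite (le_trans (normc_sum _ _ _)) //.
apply: (@le_trans _ _ (\sum_(1 <= i < N.+1) 2 * M * q ^+ i)).
  apply: ler_sum => i _; rewrite normcM normcX.
  have -> : normc u = (rho / 2) * q by rewrite /q; field; rewrite gt_eqF.
  rewrite exprMn mulrA ler_wpM2r ?exprn_ge0 //.
rewrite -mulr_sumr.
have G : \sum_(1 <= i < N.+1) q ^+ i <= q ^+ 1 / (1 - q) by apply: geom_tail; lra.
have G2 : q ^+ 1 / (1 - q) <= 2 * q.
  rewrite expr1 ler_pdivrMr; [nra|lra].
apply: (@le_trans _ _ (2 * M * (2 * q))).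
  by rewrite ler_wpM2l ?mulr_ge0 //; apply: le_trans G2.
by rewrite le_eqVlt; apply/orP; left; apply/eqP; rewrite /q; field; rewrite gt_eqF.
Qed.

End Area.

(** * The weighted Bergman space in Taylor coefficients *)

Section Bergman.
Variable R : realType.
Local Notation M2 := (measurableTypeR R * measurableTypeR R)%type.
Variable omega : R[i] -> R.
Hypothesis rw : radial_weight 1 omega.
Hypothesis om0 : forall z, normc z < 1 -> 0 < omega z.
Implicit Types (f g h : R[i] -> R[i]) (c d : nat -> R[i]) (z w : R[i]) (N n : nat).

(** The squared norm of the monomial z^n. *)
Definition mom n : R := moment 1 omega n.

Lemma annulus_gt0 (s : R) : 0 < s < 1 -> exists2 k : R, 0 < k &
  (k%:E <= \int[dA R]_(p in disc2 1 `\` disc2 s) (omega (cplx p))%:E)%E.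
Proof.
move=> /andP[s0 s1].
set A := disc2 1 `\` disc2 s.
have mA : measurable A by apply: measurableD; exact: measurable_disc2.
have mW : measurable_fun A (fun p : M2 => (omega (cplx p))%:E).
  apply: measurable_funS (measurable_int _ (rw_int rw)); [exact: measurable_disc2|exact: subDsetl].
pose I := (\int[dA R]_(p in A) (omega (cplx p))%:E)%E; rewrite -/I.
have I0 : (0 <= I)%E.
  by apply: integral_ge0 => p [Dp _]; rewrite lee_fin (rw_ge0 rw).
have Ifin : I \is a fin_num.
  apply: (integrable_fin_num mA); apply: integrableS (rw_int rw) => //; [exact: measurable_disc2|exact: subDsetl].
exists (fine I); last by rewrite fineK.
rewrite fine_gt0 // lt_def I0 andbT; apply/andP; split; last by rewrite -ge0_fin_numE.
apply/negP => /eqP I00.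
have : (\int[dA R]_(p in A) `| (omega (cplx p))%:E | = 0)%E.
  rewrite -I00; apply: eq_integral => p /set_mem [Dp _].
  by rewrite gee0_abs // lee_fin (rw_ge0 rw).
move/(ae_eq_integral_abs _ mA mW) => [N [mN N0 HN]].
have AN : A `<=` N.
  move=> p Ap; apply: HN => /= /(_ Ap); case: Ap => Dp _ [] H.
  by have := om0 Dp; rewrite H ltxx.
have : ((1 ^+ 2 - s ^+ 2) * disk_area R)%:E = 0%E.
  by rewrite -(dA_annulus s0 (ltW s1)); exact: subset_measure0 mA mN AN N0.
move=> -[] /eqP; rewrite mulf_eq0 (gt_eqF (disk_area_gt0 R)) orbF.
by rewrite expr1n subr_eq0 gt_eqF // expr_lt1 // ltW.
Qed.

(** Some mass of the weight lies outside radius s, so the moments decay no faster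
than s^(2n). *)
Lemma mom_lower (s : R) : 0 < s < 1 -> exists2 k : R, 0 < k & forall n, s ^+ (2 * n) * k <= mom n.
Proof.
move=> s01; have [k k0 Hk] := annulus_gt0 s01; exists k => // n.
have s0 : 0 <= s by case/andP: s01 => /ltW.
have := moment_ge n rw s0; rewrite -lee_fin; apply: le_trans.
by rewrite EFinM lee_pmul2l // lte_fin exprn_gt0 //; case/andP: s01.
Qed.

Lemma mom_gt0 n : 0 < mom n.
Proof.
have [|k k0 H] := @mom_lower (1 / 2); first by lra.
by apply: lt_le_trans (H n); rewrite mulr_gt0 // exprn_gt0.
Qed.

Lemma mom_le0 n : mom n <= mom 0%N.
Proof.
rewrite -lee_fin -!moment_fin //; apply: le_wint => //; do ?exact: measurable_normcX.
move=> z z1; rewrite exprn_ge0 ?normc_ge0 //= muln0 expr0 exprn_ile1 ?normc_ge0 //.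
exact: ltW.
Qed.

Lemma pser_holo1 c f : pser_on c f 1 -> analytic f.
Proof. by move=> /pser_holo H z zD; apply/holo_derivable; exact: H. Qed.

Definition tc f : nat -> R[i] := xget (fun=> 0) [set c | pser_on c f 1].

Lemma tcP f : analytic f -> pser_on (tc f) f 1.
Proof.
move=> fa; have [|c cP] := @taylor _ f 1 ltr01.
  by move=> w w1; apply/holo_derivable; exact: fa.
have := @xgetPex _ (fun=> 0) [set c | pser_on c f 1]; apply; by exists c.
Qed.

Lemma tc_uniq c f : pser_on c f 1 -> tc f = c.
Proof.
move=> cP; apply/funext; apply: (pser_uniq ltr01 _ cP).
by apply: tcP; exact: pser_holo1 cP.
Qed.

Definition nrm2 f : R := fine (A2normsq omega f).

Lemma A2normE f : A2norm omega f = Num.sqrt (nrm2 f).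
Proof. by []. Qed.

Lemma A2normsqE f : A2normsq omega f = wint 1 omega (fun z => normc (f z) ^+ 2)%R.
Proof. by []. Qed.

Lemma A2normsq_ge0 f : (0 <= A2normsq omega f)%E.
Proof. by rewrite A2normsqE; apply: wint_ge0 => // z _; exact: sqr_ge0. Qed.

Lemma nrm2_ge0 f : 0 <= nrm2 f.
Proof. by rewrite /nrm2 fine_ge0 // A2normsq_ge0. Qed.

Lemma nrm2E f : A2 omega f -> A2normsq omega f = (nrm2 f)%:E.
Proof. by case=> _ _ f2; rewrite /nrm2 fineK // ge0_fin_numE // A2normsq_ge0. Qed.

Lemma A2norm0 : A2norm omega (fun=> 0) = 0.
Proof.
rewrite /A2norm /A2normsq /disk_integral integral0_eq ?sqrtr0 //= => p _.
by rewrite normc0 expr0n mul0r.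
Qed.

Lemma A2norm_ge0 f : 0 <= A2norm omega f.
Proof. by rewrite A2normE sqrtr_ge0. Qed.

Lemma A2norm_sqr f : A2norm omega f ^+ 2 = nrm2 f.
Proof. by rewrite A2normE sqr_sqrtr // nrm2_ge0. Qed.

Definition dsum c N : R := \sum_(n < N) normc (c n) ^+ 2 * mom n.

Lemma dsum_ge0 c N : 0 <= dsum c N.
Proof. by apply: sumr_ge0 => i _; rewrite mulr_ge0 ?sqr_ge0 // ltW // mom_gt0. Qed.

Lemma dsum_le c N M : (N <= M)%N -> dsum c N <= dsum c M.
Proof.
move=> NM; rewrite -subr_ge0 /dsum (sum_split (fun n => normc (c n) ^+ 2 * mom n)) //.
by apply: sumr_ge0 => i _; rewrite mulr_ge0 ?sqr_ge0 // ltW // mom_gt0.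
Qed.

Lemma dsum_nrm2 f N : A2 omega f -> dsum (tc f) N <= nrm2 f.
Proof.
move=> fA; rewrite -lee_fin -nrm2E //; case: fA => fa _ _.
by have := bessel N rw (tcP fa); rewrite wint_diagp.
Qed.

(** The norm of a function is bounded through its coefficients; this is how elements
of the space are constructed. *)
Lemma A2_of_coefs c f (B : R) : pser_on c f 1 -> (forall z, ~ disk z -> f z = 0) ->
  (forall N, dsum c N <= B) -> A2 omega f /\ nrm2 f <= B.
Proof.
move=> cP f0 cB.
have H : (A2normsq omega f <= B%:E)%E.
  by apply: (parseval_le rw cP) => N; rewrite wint_diagp // lee_fin; exact: cB.
have fA : A2 omega f.
  by split=> //; [exact: pser_holo1 cP|apply: le_lt_trans H _; exact: ltry].
by split=> //; rewrite -lee_fin -nrm2E.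
Qed.

(** If the partial sums stayed below nrm2 f by e, [parseval_le] would bound nrm2 f
by itself minus e. *)
Lemma dsum_cvg f : A2 omega f -> (dsum (tc f) N @[N --> \oo] --> nrm2 f).
Proof.
move=> fA; apply/cvgrPdist_le => e e0.
suff [N HN] : exists N, nrm2 f - e <= dsum (tc f) N.
  exists N => // n /= Nn; rewrite ger0_norm ?subr_ge0 ?dsum_nrm2 //.
  by rewrite lerBlDl -lerBlDr (le_trans HN) // dsum_le.
apply/not_existsP => H.
have [fa f0 _] := fA.
have Hd N : dsum (tc f) N <= nrm2 f - e by apply/ltW; rewrite ltNge; apply/negP; exact: H.
by have [_] := A2_of_coefs (tcP fa) f0 Hd; lra.
Qed.

Lemma nrm2_0 f : A2 omega f -> nrm2 f = 0 -> forall z, f z = 0.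
Proof.
move=> fA n0 z; have [fa f0 _] := fA.
have c0 n : tc f n = 0.
  have := dsum_nrm2 n.+1 fA; rewrite n0 /dsum big_ord_recr /= => H.
  have H1 : normc (tc f n) ^+ 2 * mom n <= 0.
    apply: le_trans H; rewrite lerDr; exact: dsum_ge0.
  apply: eq0_normc; apply/eqP; rewrite -sqrf_eq0 eq_le sqr_ge0 andbT.
  by rewrite -(pmulr_lle0 _ (mom_gt0 n)).
have [zD|zD] := pselect (disk z); last exact: f0.
apply/eq0_normc/eqP; rewrite eq_le normc_ge0 andbT; apply/ler_addgt0Pr => e e0.
have [N HN] := tcP fa zD e0; have := HN N (leqnn _).
rewrite /psum big1 => [|i _]; last by rewrite c0 mul0r.
by rewrite sub0r normcN add0r => /ltW.
Qed.

Definition lc (a : R[i]) f g : R[i] -> R[i] := fun z => a * f z + g z.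

Lemma psum_lc a c d N z : psum (fun n => a * c n + d n) N z = a * psum c N z + psum d N z.
Proof. by rewrite /psum mulr_sumr -big_split /=; apply: eq_bigr => i _; ring. Qed.

Lemma pser_lc a c d f g (rho : R) : pser_on c f rho -> pser_on d g rho ->
  pser_on (fun n => a * c n + d n) (lc a f g) rho.
Proof.
move=> cf dg z zr e e0.
have a0 : 0 < normc a + 1 by rewrite ltr_wpDl ?normc_ge0.
have [N1 H1] := cf z zr _ (divr_gt0 e0 (mulr_gt0 (ltr0n R 2) a0)).
have [N2 H2] := dg z zr _ (divr_gt0 e0 (ltr0n R 2)).
exists (maxn N1 N2) => n; rewrite geq_max => /andP[n1 n2]; rewrite psum_lc.
have -> : a * psum c n z + psum d n z - lc a f g z = a * (psum c n z - f z) + (psum d n z - g z).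
  by rewrite /lc; ring.
apply: le_lt_trans (le_normcD _ _) _; rewrite [e]splitr.
apply: ler_ltD; last exact: H2.
rewrite normcM; apply: (@le_trans _ _ ((normc a + 1) * (e / (2 * (normc a + 1))))).
  by apply: ler_pM; rewrite ?normc_ge0 ?lerDl // ltW // H1.
by rewrite le_eqVlt; apply/orP; left; apply/eqP; field; rewrite gt_eqF.
Qed.

Lemma tc_lc a f g : A2 omega f -> A2 omega g -> tc (lc a f g) = (fun n => a * tc f n + tc g n).
Proof. by move=> [fa _ _] [ga _ _]; apply: tc_uniq; apply: pser_lc; exact: tcP. Qed.

Lemma normc_sqrD (x y : R[i]) : normc (x + y) ^+ 2 =
  normc x ^+ 2 + normc y ^+ 2 + 2 * complex.Re (x * y^*%C).
Proof. by rewrite !normc_sqr; case: x y => [x1 x2] [y1 y2] /=; ring. Qed.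

Lemma normc_sqrD_le (x y : R[i]) : normc (x + y) ^+ 2 <= 2 * normc x ^+ 2 + 2 * normc y ^+ 2.
Proof.
have : 0 <= normc (x - y) ^+ 2 by exact: sqr_ge0.
by rewrite !normc_sqr; case: x y => [x1 x2] [y1 y2] /=; lra.
Qed.

Lemma A2_lc a f g : A2 omega f -> A2 omega g -> A2 omega (lc a f g).
Proof.
move=> fA gA; have [fa f0 _] := fA; have [ga g0 _] := gA.
pose B := 2 * (normc a ^+ 2 * nrm2 f) + 2 * nrm2 g.
have [] // := @A2_of_coefs (fun n => a * tc f n + tc g n) (lc a f g) B.
- by apply: pser_lc; exact: tcP.
- by move=> z zD; rewrite /lc f0 // g0 // mulr0 addr0.
move=> N; have H1 := dsum_nrm2 N fA; have H2 := dsum_nrm2 N gA.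
apply: (@le_trans _ _ (2 * (normc a ^+ 2 * dsum (tc f) N) + 2 * dsum (tc g) N)).
  rewrite /dsum !mulr_sumr -big_split /=; apply: ler_sum => i _.
  have m0 := mom_gt0 i.
  apply: (@le_trans _ _ ((2 * normc (a * tc f i) ^+ 2 + 2 * normc (tc g i) ^+ 2) * mom i)).
    by rewrite ler_pM2r // normc_sqrD_le.
  by rewrite normcM exprMn le_eqVlt; apply/orP; left; apply/eqP; ring.
by apply: lerD; rewrite ler_pM2l // ler_wpM2l ?sqr_ge0.
Qed.

Lemma A2_0 : A2 omega (fun=> 0).
Proof.
have [] // := @A2_of_coefs (fun=> 0) (fun=> 0) 0.
  by move=> z _ e e0; exists 0%N => n _; rewrite /psum big1 ?subrr ?normc0 // => i _; rewrite mul0r.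
by move=> N; rewrite /dsum big1 // => i _; rewrite normc0 expr0n mul0r.
Qed.

Lemma A2Z a f : A2 omega f -> A2 omega (fun z => a * f z).
Proof.
move=> fA; have := A2_lc a fA A2_0; congr (A2 _ _); apply/funext => z.
by rewrite /lc addr0.
Qed.

Lemma A2D f g : A2 omega f -> A2 omega g -> A2 omega (fun z => f z + g z).
Proof.
move=> fA gA; have := A2_lc 1 fA gA; congr (A2 _ _); apply/funext => z.
by rewrite /lc mul1r.
Qed.

Lemma A2B f g : A2 omega f -> A2 omega g -> A2 omega (fun z => f z - g z).
Proof.
move=> fA gA; have := A2_lc (-1) gA fA; congr (A2 _ _); apply/funext => z.
by rewrite /lc mulN1r addrC.
Qed.

Lemma A2_meas f : A2 omega f -> cmeas (disc2 1) (fun p => f (cplx p)).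
Proof.
by move=> [fa _ _]; apply: (cmeas_pser _ (tcP fa)) => //; exact: cmeas_cplx.
Qed.

Lemma A2_integrable f : A2 omega f ->
  (dA R).-integrable (disc2 1) (fun p => (normc (f (cplx p)) ^+ 2 * omega (cplx p))%:E).
Proof.
move=> fA; apply/integrableP; split.
  apply: (@measurable_wint _ _ _ (fun z => normc (f z) ^+ 2)) => //.
  exact: (measurable_normc2 (A2_meas fA)).
case: fA => _ _; apply: le_lt_trans; rewrite A2normsqE /wint le_eqVlt; apply/orP; left; apply/eqP.
apply: eq_integral => p /set_mem Dp; rewrite gee0_abs // lee_fin mulr_ge0 ?sqr_ge0 //.
exact: (rw_ge0 rw).
Qed.

(** The real part of the inner product.  It determines the inner product, because
multiplying f by -i brings the imaginary part to the real one. *)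
Definition rip f g : R := complex.Re (disk_cintegral (fun xi => f xi * (g xi)^*%C * (omega xi)%:C)).

Lemma ripE f g : rip f g = (\int[dA R]_(p in disc2 1) (complex.Re (f (cplx p) * (g (cplx p))^*%C) * omega (cplx p)))%R.
Proof.
by rewrite /rip /disk_cintegral /=; apply: eq_Rintegral => p _; rewrite cReM /= mulr0 subr0.
Qed.

Lemma rip_integrable f g : A2 omega f -> A2 omega g -> (dA R).-integrable (disc2 1)
  (fun p => (complex.Re (f (cplx p) * (g (cplx p))^*%C) * omega (cplx p))%:E).
Proof.
move=> fA gA.
have I := integrableD (measurable_disc2 1) (A2_integrable fA) (A2_integrable gA).
apply: (le_integrable (measurable_disc2 1) _ _ I).
  apply: (@measurable_wint _ _ _ (fun z => complex.Re (f z * (g z)^*%C))) => //.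
  by have [] := cmeasM (A2_meas fA) (cmeas_conj (A2_meas gA)).
move=> p Dp; have o0 := rw_ge0 rw Dp.
rewrite -EFinD !abse_EFin lee_fin -mulrDl !normrM (ger0_norm o0) ler_wpM2r //.
rewrite [leRHS]ger0_norm ?addr_ge0 ?sqr_ge0 //.
apply: le_trans (le_normc_Re _) _; rewrite normcM normc_conj.
have := sqr_ge0 (normc (f (cplx p)) - normc (g (cplx p))).
have := sqr_ge0 (normc (f (cplx p))); have := sqr_ge0 (normc (g (cplx p))); nra.
Qed.

Lemma nrm2_R f : A2 omega f -> nrm2 f = (\int[dA R]_(p in disc2 1) (normc (f (cplx p)) ^+ 2 * omega (cplx p)))%R.
Proof. by []. Qed.

Lemma nrm2D f g : A2 omega f -> A2 omega g ->
  nrm2 (fun z => f z + g z) = nrm2 f + nrm2 g + 2 * rip f g.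
Proof.
move=> fA gA; rewrite ripE !nrm2_R //; last exact: A2D.
have m1 := measurable_disc2 (1 : R).
have If := A2_integrable fA; have Ig := A2_integrable gA; have Ir := rip_integrable fA gA.
have Ir2 := integrableZl m1 2 Ir.
rewrite -RintegralZl // -RintegralD // -RintegralD //; last exact: (integrableD m1 If Ig).
by apply: eq_Rintegral => p _; rewrite normc_sqrD; ring.
Qed.

Lemma ripZr f g (t : R) : A2 omega f -> A2 omega g ->
  rip f (fun z => t%:C * g z) = t * rip f g.
Proof.
move=> fA gA; rewrite !ripE -RintegralZl //; last first.
- exact: rip_integrable.
- exact: measurable_disc2.
apply: eq_Rintegral => p _; move: (f (cplx p)) (g (cplx p)) => [a b] [a' b'] /=; ring.
Qed.

Lemma nrm2Z a f : A2 omega f -> nrm2 (fun z => a * f z) = normc a ^+ 2 * nrm2 f.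
Proof.
move=> fA; rewrite !nrm2_R //; last exact: A2Z.
rewrite -RintegralZl //; last exact: A2_integrable; last exact: measurable_disc2.
by apply: eq_Rintegral => p _; rewrite normcM; ring.
Qed.

Lemma rip_self f : A2 omega f -> rip f f = nrm2 f.
Proof.
move=> fA; rewrite ripE nrm2_R //; apply: eq_Rintegral => p _; congr (_ * _).
by rewrite normc_sqr; case: (f (cplx p)) => a b /=; ring.
Qed.

(** The quadratic polynomial t |-> nrm2 (f + t g) is nonnegative. *)
Lemma rip_CS f g : A2 omega f -> A2 omega g -> rip f g ^+ 2 <= nrm2 f * nrm2 g.
Proof.
move=> fA gA.
have H t : 0 <= nrm2 f + t ^+ 2 * nrm2 g + 2 * t * rip f g.
  have := nrm2_ge0 (fun z => f z + t%:C * g z).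
  rewrite nrm2D //; last exact: A2Z.
  by rewrite nrm2Z // ripZr // normc_real real_normK ?num_real // mulrA.
have f0 := nrm2_ge0 f; have g0 := nrm2_ge0 g.
have [g1|g1] := eqVneq (nrm2 g) 0.
  have r0 : rip f g = 0.
    have := H (rip f g * (- (nrm2 f + 1))); rewrite g1 mulr0 addr0.
    have -> : 2 * (rip f g * - (nrm2 f + 1)) * rip f g = - (2 * (nrm2 f + 1) * rip f g ^+ 2) by ring.
    have r1 := sqr_ge0 (rip f g) => H1.
    apply/eqP; rewrite -sqrf_eq0 eq_le r1 andbT; rewrite leNgt; apply/negP => r2.
    have [t Ht] : exists t, nrm2 f + 2 * t * rip f g < 0.
      exists (- rip f g * ((nrm2 f + 1) / rip f g ^+ 2)).
      have -> : 2 * (- rip f g * ((nrm2 f + 1) / rip f g ^+ 2)) * rip f g = - (2 * (nrm2 f + 1)).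
        by field; rewrite -sqrf_eq0 gt_eqF.
      lra.
    by have := H t; rewrite g1 mulr0 addr0 leNgt Ht.
  by rewrite r0 expr0n mulr_ge0.
have g2 : 0 < nrm2 g by rewrite lt_def g1.
have := H (- rip f g / nrm2 g).
have -> : nrm2 f + (- rip f g / nrm2 g) ^+ 2 * nrm2 g + 2 * (- rip f g / nrm2 g) * rip f g =
   (nrm2 f * nrm2 g - rip f g ^+ 2) / nrm2 g by field.
by rewrite pmulr_lge0 ?invr_gt0 // subr_ge0.
Qed.

Lemma A2norm_triangle f g : A2 omega f -> A2 omega g ->
  A2norm omega (fun z => f z + g z) <= A2norm omega f + A2norm omega g.
Proof.
move=> fA gA; have F0 := A2norm_ge0 f; have G0 := A2norm_ge0 g.
rewrite -(ler_pXn2r (n := 2)) ?nnegrE ?A2norm_ge0 ?addr_ge0 //.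
rewrite A2norm_sqr nrm2D // sqrrD !A2norm_sqr.
have : rip f g <= A2norm omega f * A2norm omega g.
  apply: le_trans (ler_norm _) _.
  rewrite -(ler_pXn2r (n := 2)) ?nnegrE ?mulr_ge0 // real_normK ?num_real //.
  by rewrite exprMn !A2norm_sqr rip_CS.
lra.
Qed.

Lemma A2normZ a f : A2 omega f -> A2norm omega (fun z => a * f z) = normc a * A2norm omega f.
Proof.
move=> fA; rewrite !A2normE nrm2Z // sqrtrM ?sqr_ge0 // sqrtr_sqr ger0_norm //.
exact: normc_ge0.
Qed.

(** Polarization of Parseval. *)
Lemma rip_lim f g : A2 omega f -> A2 omega g ->
  (\sum_(n < N) complex.Re (tc f n * (tc g n)^*%C) * mom n) @[N --> \oo] --> rip f g.
Proof.
move=> fA gA.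
have fgA := A2D fA gA.
have tfg : tc (fun z => f z + g z) = fun n => tc f n + tc g n.
  have := tc_lc 1 fA gA; rewrite /lc => H.
  transitivity (tc (fun z => 1 * f z + g z)).
    by congr tc; apply/funext => z; rewrite mul1r.
  by rewrite H; apply/funext => n; rewrite mul1r.
have H1 := dsum_cvg fgA; have H2 := dsum_cvg fA; have H3 := dsum_cvg gA.
have -> : rip f g = 2^-1 * (nrm2 (fun z => f z + g z) - nrm2 f - nrm2 g).
  by rewrite nrm2D //; field.
rewrite (_ : (fun N => _) = (fun N => 2^-1 * (dsum (tc (fun z => f z + g z)) N - dsum (tc f) N - dsum (tc g) N))).
  by apply: cvgM; [exact: cvg_cst|apply: cvgB => //; exact: cvgB].
apply/funext => N; rewrite /dsum tfg -!sumrB mulr_sumr; apply: eq_bigr => n _.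
by rewrite normc_sqrD; field.
Qed.

End Bergman.

(** * Reproducing kernel *)

Section Kernel.
Variable R : realType.
Variable omega : R[i] -> R.
Hypothesis rw : radial_weight 1 omega.
Hypothesis om0 : forall z, normc z < 1 -> 0 < omega z.
Implicit Types (f g h : R[i] -> R[i]) (c d : nat -> R[i]) (z w : R[i]) (N n : nat).
Local Notation bkernel := (Defs.kernel omega).
Local Notation mom := (mom omega).
Local Notation nrm2 := (nrm2 omega).
Local Notation rip := (rip omega).
Local Notation dsum := (dsum omega).
Let mom0 n : 0 < mom n := mom_gt0 rw om0 n.

(** The function with Taylor coefficients conj(z)^n / mom n: by polarized Parseval
its inner product with f is the Taylor series of f at z. *)
Lemma kernel_exists z : normc z < 1 -> exists2 k, is_kernel_at omega z k &
  pser_on (fun n => (z ^*%C) ^+ n / (mom n)%:C) k 1.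
Proof.
move=> z1; have z0 := normc_ge0 z.
pose s := (1 + normc z) / 2.
have s01 : 0 < s < 1 by rewrite /s; lra.
have s0 : 0 < s by case/andP: s01.
have [k k0 Hk] := mom_lower rw om0 s01.
pose q := normc z / s ^+ 2.
have q01 : 0 <= q < 1.
  rewrite divr_ge0 ?sqr_ge0 //= ltr_pdivrMr ?exprn_gt0 // mul1r.
  have : 0 < (1 - normc z) ^+ 2 by rewrite exprn_gt0 // subr_gt0.
  by rewrite /s; nra.
pose d n : R[i] := (z ^*%C) ^+ n / (mom n)%:C.
have nd n : normc (d n) = normc z ^+ n / mom n.
  by rewrite /d normcM normcX normc_conj normcV normc_real ger0_norm // ltW.
have dq n : normc (d n) <= k^-1 * q ^+ n.
  rewrite nd /q exprMn exprVn -exprM mulrCA ler_wpM2l ?exprn_ge0 //.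
  rewrite -invfM lef_pV2 ?posrE // ?mulr_gt0 ?exprn_gt0 //.
  by rewrite mulrC; exact: Hk.
have ex w : exists v, (normc w < 1 -> forall N,
    normc (psum d N w - v) <= 2 * (k^-1 * q ^+ N / (1 - q))) /\ (~ normc w < 1 -> v = 0).
  have [w1|w1] := pselect (normc w < 1); last by exists 0.
  have [|v Hv] := @csum_geom _ (fun n => d n * w ^+ n) q k^-1 q01.
    move=> n; rewrite normcM normcX -[leRHS]mulr1 ler_pM ?normc_ge0 ?exprn_ge0 //.
      exact: normc_ge0.
    by rewrite exprn_ile1 ?normc_ge0 // ltW.
  by exists v; split.
have [F HF] := choice ex.
have FP : pser_on d F 1.
  move=> w w1 e e0; have [H _] := HF w.
  have [N HN] := geom_small (2 * (k^-1 / (1 - q))) q01 e0.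
  exists N => n /HN; apply: le_lt_trans; apply: le_trans (H w1 n) _.
  by rewrite le_eqVlt; apply/orP; left; apply/eqP; ring.
have F0 w : ~ disk w -> F w = 0 by move=> wD; have [_] := HF w; apply.
have [|FA _] := @A2_of_coefs _ _ rw d F (k^-1 / (1 - q)) FP F0.
  move=> N; rewrite /dsum; apply: (@le_trans _ _ (\sum_(n < N) k^-1 * q ^+ n)).
    apply: ler_sum => n _; rewrite expr2 -mulrA {2}nd divfK ?gt_eqF //.
    by rewrite -[leRHS]mulr1 ler_pM ?normc_ge0 ?exprn_ge0 ?exprn_ile1 ?(ltW z1).
  rewrite -mulr_sumr ler_wpM2l ?invr_ge0 ?(ltW k0) //.
  by have := geom_tail 0 N q01; rewrite big_mkord expr0 mul1r.
exists F => //; split=> // f fA.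
have RF f' : A2 omega f' -> rip f' F = complex.Re (f' z).
  move=> fA'; have L1 := rip_lim rw om0 fA' FA.
  have [fa _ _] := fA'.
  have [L2 _] := sums_to_cvg (tcP fa z1).
  rewrite (tc_uniq FP) in L1.
  have E : (fun N => \sum_(n < N) complex.Re (tc f' n * (d n)^*%C) * mom n) = (fun N => complex.Re (psum (tc f') N z)).
    apply/funext => N; rewrite /psum.
    have -> : complex.Re (\sum_(i < N) tc f' i * z ^+ i) = \sum_(i < N) complex.Re (tc f' i * z ^+ i).
      by elim: N => [|N ih]; rewrite ?big_ord0 // !big_ord_recr /= cReD ih.
    apply: eq_bigr => n _.
    have -> : (d n)^*%C = z ^+ n * ((mom n)^-1)%:C.
      rewrite /d cconjM; congr (_ * _).
        by rewrite rmorphXn /= conjcK.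
      by rewrite -fmorphV /= oppr0.
    move: (tc f' n) (z ^+ n) => [a b] [a' b'] /=; field; exact: lt0r_neq0.
  rewrite E in L1; exact: (cvg_unique _ L1 L2).
apply: complex_ext; first by rewrite -RF.
have := RF _ (A2Z rw om0 (- 'i%C) fA).
rewrite ripE => H.
transitivity (complex.Re (- 'i%C * f z)); first by case: (f z) => a b /=; ring.
rewrite -H /disk_cintegral /=; apply: eq_Rintegral => p _.
by case: (f (cplx p)) (F (cplx p)) => [a b] [a' b'] /=; ring.
Qed.

Lemma kernelP z : normc z < 1 -> is_kernel_at omega z (bkernel z).
Proof.
move=> z1; have [k Hk _] := kernel_exists z1.
by apply: (@xgetPex _ (fun=> 0) (is_kernel_at omega z)); exists k.
Qed.

Lemma kernel_A2 z : normc z < 1 -> A2 omega (bkernel z).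
Proof. by case/kernelP. Qed.

Lemma rip_kernel f z : normc z < 1 -> A2 omega f -> rip f (bkernel z) = complex.Re (f z).
Proof. by move=> /kernelP[_ H] /H ->. Qed.

(** K_z(z), as the squared norm of K_z. *)
Definition KK z : R := nrm2 (bkernel z).

Lemma KK_self z : normc z < 1 -> complex.Re (bkernel z z) = KK z.
Proof. by move=> z1; rewrite -rip_kernel ?rip_self //; exact: kernel_A2. Qed.

Lemma ripC f g : rip f g = rip g f.
Proof.
rewrite !ripE; apply: eq_Rintegral => p _; congr (_ * _).
by case: (f (cplx p)) (g (cplx p)) => [a b] [a' b'] /=; ring.
Qed.

(** Two kernels at z have the same inner product with each other and with
themselves, so their difference has norm 0. *)
Lemma kernel_uniq z k : normc z < 1 -> is_kernel_at omega z k -> forall w, bkernel z w = k w.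
Proof.
move=> z1 [kA kP] w; have bA := kernel_A2 z1.
have rk f : A2 omega f -> rip f k = complex.Re (f z) by move=> /kP ->.
have nA : A2 omega (fun z => - 1 * k z) := A2Z rw om0 (- 1) kA.
have N0 : nrm2 (fun w => - 1 * k w + bkernel z w) = 0.
  rewrite (nrm2D rw om0 nA bA) (nrm2Z rw om0 _ kA) normcN normc1 expr1n mul1r.
  rewrite (rip_kernel z1 nA) -[nrm2 k](rip_self kA) rk // -[nrm2 (bkernel z)](rip_self bA) rip_kernel //.
  rewrite -(rk _ bA) (ripC (bkernel z) k) rip_kernel //.
  by have -> : complex.Re (- 1 * k z) = - complex.Re (k z); [case: (k z) => a b /=; ring|ring].
have := nrm2_0 rw om0 (A2D rw om0 nA bA) N0 w.
by rewrite mulN1r => /eqP; rewrite addrC subr_eq0 => /eqP.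
Qed.

Lemma kernel_pser z : normc z < 1 -> pser_on (fun n => (z ^*%C) ^+ n / (mom n)%:C) (bkernel z) 1.
Proof.
move=> z1; have [k kP kS] := kernel_exists z1.
by move=> w w1 e e0; rewrite (kernel_uniq z1 kP); exact: kS.
Qed.

Lemma KK_ge0 z : 0 <= KK z.
Proof. exact: nrm2_ge0. Qed.

Lemma eval_bound f z : normc z < 1 -> A2 omega f -> normc (f z) ^+ 2 <= nrm2 f * KK z.
Proof.
move=> z1 fA; have [f0|f0] := eqVneq (f z) 0.
  by rewrite f0 normc0 expr0n mulr_ge0 ?nrm2_ge0.
have := rip_CS rw om0 (A2Z rw om0 (f z)^*%C fA) (kernel_A2 z1).
rewrite rip_kernel //; last exact: A2Z.
have -> : complex.Re ((f z)^*%C * f z) = normc (f z) ^+ 2.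
  by rewrite normc_sqr; case: (f z) => a b /=; ring.
rewrite nrm2Z // normc_conj -mulrA expr2 ler_pM2l //.
by rewrite exprn_gt0 // normc_gt0.
Qed.

(** Polynomials made into elements of the space, which vanish off the disk. *)
Definition polyd c N : R[i] -> R[i] := patch (fun=> 0) (@disk R) (fun z => psum c N z).

Lemma polydE c N z : normc z < 1 -> polyd c N z = psum c N z.
Proof. by move=> z1; rewrite /polyd /patch mem_set. Qed.

Lemma psum_trunc c N M z : (N <= M)%N ->
  psum (fun n => if (n < N)%N then c n else 0) M z = psum c N z.
Proof.
move=> NM; rewrite /psum -(big_mkord xpredT (fun i => (if (i < N)%N then c i else 0) * z ^+ i)).
rewrite (big_cat_nat (n := N)) //= [X in _ + X]big_nat_cond [X in _ + X]big1 ?addr0 => [|i]; last first.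
  by rewrite andbT => /andP[Ni _]; rewrite ltnNge Ni mul0r.
rewrite big_mkord; apply: eq_bigr => i _; by rewrite ltn_ord.
Qed.

Lemma polyd_pser c N : pser_on (fun n => if (n < N)%N then c n else 0) (polyd c N) 1.
Proof.
move=> z z1 e e0; exists N => n Nn.
by rewrite psum_trunc // polydE // subrr normc0.
Qed.

Lemma polyd_A2 c N : A2 omega (polyd c N) /\ nrm2 (polyd c N) <= dsum c N.
Proof.
apply: (A2_of_coefs rw (polyd_pser c N)).
  by move=> z zD; rewrite /polyd /patch memNset.
move=> M; have [MN|/ltnW NM] := leqP M N.
  apply: le_trans (dsum_le rw om0 c MN); rewrite /dsum; apply: ler_sum => i _.
  by rewrite (leq_trans (ltn_ord i)).
rewrite /dsum -(big_mkord xpredT (fun i => normc (if (i < N)%N then c i else 0) ^+ 2 * mom i)).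
rewrite (big_cat_nat (n := N)) //= [X in _ + X]big_nat_cond [X in _ + X]big1 ?addr0 => [|i]; last first.
  by rewrite andbT => /andP[Ni _]; rewrite ltnNge Ni normc0 expr0n mul0r.
rewrite big_mkord; apply: ler_sum => i _; by rewrite ltn_ord.
Qed.

(** Evaluate at z the part of the kernel series between a and b: its squared norm
equals its value at z. *)
Lemma KK_lower z a b : normc z < 1 ->
  \sum_(a <= n < b) normc z ^+ (2 * n) / mom n <= KK z.
Proof.
move=> z1; have [ab|/ltnW ba] := leqP a b; last by rewrite big_geq // KK_ge0.
pose c n : R[i] := if (a <= n)%N then (z ^*%C) ^+ n / (mom n)%:C else 0.
pose S := \sum_(a <= n < b) normc z ^+ (2 * n) / mom n; rewrite -/S.
have SE (G : nat -> R) : (forall n, (n < a)%N -> G n = 0) -> (forall n, (a <= n)%N -> G n = normc z ^+ (2 * n) / mom n) ->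
    \sum_(n < b) G n = S.
  move=> G0 G1; rewrite -(big_mkord xpredT G) (big_cat_nat (n := a)) //=.
  rewrite [X in X + _]big_nat_cond [X in X + _]big1 ?add0r => [|i]; last by rewrite andbT => /andP[_ /G0].
  by rewrite /S big_nat_cond [RHS]big_nat_cond; apply: eq_bigr => i; rewrite andbT => /andP[ai _]; exact: G1.
have [fA fS] := polyd_A2 c b.
have dS : dsum c b = S.
  apply: (SE (fun n => normc (c n) ^+ 2 * mom n)) => n; rewrite /c.
    by rewrite ltnNge => /negbTE ->; rewrite normc0 expr0n mul0r.
  move=> ->; rewrite normcM normcX normc_conj normcV normc_real ger0_norm ?(ltW (mom0 _)) //.
  rewrite exprMn -exprM [(n * 2)%N]mulnC exprVn; field; exact: lt0r_neq0.
have fz : complex.Re (polyd c b z) = S.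
  rewrite polydE // /psum.
  have -> : complex.Re (\sum_(i < b) c i * z ^+ i) = \sum_(i < b) complex.Re (c i * z ^+ i).
    by elim: (b) => [|N ih]; rewrite ?big_ord0 // !big_ord_recr /= cReD ih.
  apply: (SE (fun n => complex.Re (c n * z ^+ n))) => n; rewrite /c.
    by rewrite ltnNge => /negbTE ->; rewrite mul0r.
  move=> ->; rewrite mulrAC -rmorphXn /=.
  have -> : (z ^+ n)^*%C * z ^+ n = (normc z ^+ (2 * n))%:C.
    rewrite [(2 * n)%N]mulnC exprM -normcX normc_sqr; case: (z ^+ n) => x y.
    by apply: complex_ext => /=; ring.
  by rewrite -fmorphV -rmorphM /=.
have S0 : 0 <= S by apply: sumr_ge0 => i _; rewrite divr_ge0 ?exprn_ge0 ?normc_ge0 // ltW.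
have := eval_bound z1 fA.
move: S0; rewrite le_eqVlt => /predU1P[<- _|S0 H]; first exact: KK_ge0.
have H1 : S ^+ 2 <= S * KK z.
  apply: (@le_trans _ _ (normc (polyd c b z) ^+ 2)).
    by rewrite lerXn2r ?nnegrE ?normc_ge0 ?(ltW S0) // -fz (le_trans (ler_norm _)) // le_normc_Re.
  by apply: le_trans H _; rewrite ler_wpM2r ?KK_ge0 // -dS.
by move: H1; rewrite expr2 ler_pM2l.
Qed.

Lemma KK_gt0 z : normc z < 1 -> 0 < KK z.
Proof.
move=> z1; apply: lt_le_trans (KK_lower 0 1 z1).
by rewrite big_nat1 muln0 expr0 mul1r invr_gt0.
Qed.

(** The kernel itself is the extremal function for evaluation at z. *)
Lemma KK_upper z (C : R) : normc z < 1 ->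
  (forall f, A2 omega f -> normc (f z) ^+ 2 <= C * nrm2 f) -> KK z <= C.
Proof.
move=> z1 H; have := H _ (kernel_A2 z1).
rewrite -/(KK z) => H1.
have : KK z ^+ 2 <= C * KK z.
  apply: le_trans H1; rewrite lerXn2r ?nnegrE ?normc_ge0 ?KK_ge0 //.
  by rewrite -KK_self // (le_trans (ler_norm _)) // le_normc_Re.
by rewrite expr2 ler_pM2r // KK_gt0.
Qed.

Lemma bernoulli (x : R) n : 0 <= x <= 1 -> 1 - n%:R * (1 - x) <= x ^+ n.
Proof.
move=> /andP[x0 x1]; elim: n => [|n ih]; first by rewrite expr0 mul0r subr0.
rewrite exprS -natr1.
have n0 : 0 <= n%:R :> R by [].
apply: (@le_trans _ _ (x * (1 - n%:R * (1 - x)))); last by rewrite ler_wpM2l.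
have : 0 <= n%:R * ((1 - x) * (1 - x)) by rewrite mulr_ge0 // mulr_ge0 // subr_ge0.
nra.
Qed.

(** All moments are at most mom 0, so the first N terms of [KK_lower] sum to at
least N / (2 mom 0) once normc z is close to 1. *)
Lemma KK_infty (B : R) : exists2 r : R, 0 < r < 1 & forall z, r < normc z < 1 -> B <= KK z.
Proof.
pose N := (Num.bound (2 * B * mom 0)).+1.
have BN : 2 * B * mom 0 <= N%:R.
  have [B0|B0] := lerP 0 (2 * B * mom 0); last by apply: ltW; apply: lt_le_trans B0 _.
  by apply/ltW; apply: lt_trans (archi_boundP B0) _; rewrite ltr_nat.
have N0 : 0 < N%:R :> R by rewrite ltr0n.
pose r : R := 1 - (4 * N%:R)^-1.
have i0 : 0 < (4 * N%:R : R)^-1 by rewrite invr_gt0 mulr_gt0.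
have i1 : (4 * N%:R : R)^-1 <= 4^-1.
  by rewrite lef_pV2 ?posrE ?mulr_gt0 // ler_peMr // ler1n.
exists r => [|z /andP[rz z1]]; first by rewrite /r; lra.
apply: le_trans (KK_lower 0 N z1).
have z0 := normc_ge0 z.
have zN n : (n < N)%N -> 1/2 <= normc z ^+ (2 * n).
  move=> nN; apply: le_trans (bernoulli _ _); last by rewrite z0 ltW.
  have : (2 * n)%:R * (1 - normc z) <= (2 * N)%:R * (4 * N%:R)^-1 :> R.
    apply: ler_pM => //; first by rewrite subr_ge0 ltW.
      by rewrite ler_nat leq_mul2l /= ltnW.
    by move: rz; rewrite /r; lra.
  have -> : (2 * N)%:R * (4 * N%:R)^-1 = 1 / 2 :> R by rewrite natrM; field; rewrite gt_eqF.
  lra.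
apply: (@le_trans _ _ (\sum_(0 <= n < N) (1/2) / mom 0)).
  rewrite big_mkord sumr_const card_ord -[leRHS]mulr_natl mulrA ler_pdivlMr //.
  lra.
rewrite !big_mkord; apply: ler_sum => n _.
apply: ler_pM => //; first by rewrite invr_ge0 ltW.
  exact: zN.
by rewrite lef_pV2 ?posrE // mom_le0.
Qed.

Definition Sn N f := polyd (tc f) N.
Definition Rn N f : R[i] -> R[i] := fun z => f z - Sn N f z.

Lemma Sn_A2 N f : A2 omega (Sn N f).
Proof. by have [] := polyd_A2 (tc f) N. Qed.

Lemma Rn_A2 N f : A2 omega f -> A2 omega (Rn N f).
Proof. by move=> fA; apply: A2B => //; exact: Sn_A2. Qed.

Lemma tc_Rn N f : A2 omega f -> tc (Rn N f) = (fun n => if (n < N)%N then 0 else tc f n).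
Proof.
move=> [fa _ _]; apply: tc_uniq.
have := pser_onB (tcP fa) (polyd_pser (tc f) N).
by congr (pser_on _ _ _); apply/funext => n; case: ifP => _; rewrite ?subrr ?subr0.
Qed.

Lemma nrm2_Rn N f : A2 omega f -> nrm2 (Rn N f) <= nrm2 f - dsum (tc f) N.
Proof.
move=> fA; have RA := Rn_A2 N fA; have [Ra R0 _] := RA.
have [] // := @A2_of_coefs _ _ rw _ _ (nrm2 f - dsum (tc f) N) (tcP Ra) R0.
move=> M; rewrite tc_Rn // lerBrDr.
apply: le_trans (dsum_nrm2 rw (maxn N M) fA).
apply: (@le_trans _ _ (dsum (fun n => if (n < N)%N then 0 else tc f n) (maxn N M) + dsum (tc f) N)).
  by rewrite lerD2r; apply: dsum_le => //; exact: leq_maxr.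
have D c K : dsum c K = \sum_(0 <= n < K) normc (c n) ^+ 2 * mom n by rewrite /dsum big_mkord.
rewrite !D [X in X + _ <= _](big_cat_nat (n := N)) ?leq_maxl //=.
rewrite [X in X + _ + _]big_nat_cond [X in X + _ + _]big1 ?add0r; last first.
  by move=> i; rewrite andbT => /andP[_ ->]; rewrite normc0 expr0n mul0r.
rewrite [leRHS](big_cat_nat (n := N)) ?leq_maxl //= [leLHS]addrC lerD2l.
rewrite big_nat_cond [leRHS]big_nat_cond; apply: ler_sum => i; rewrite andbT => /andP[Ni _].
by rewrite ltnNge Ni.
Qed.

Lemma nrm2_Rn_le N f : A2 omega f -> nrm2 (Rn N f) <= nrm2 f.
Proof.
by move=> fA; apply: le_trans (nrm2_Rn N fA) _; rewrite gerBl; exact: dsum_ge0.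
Qed.

Lemma tc_bound f n : A2 omega f -> normc (tc f n) ^+ 2 * mom n <= nrm2 f.
Proof.
move=> fA; apply: le_trans (dsum_nrm2 rw n.+1 fA); rewrite /dsum big_ord_recr /= lerDr.
exact: (dsum_ge0 rw om0 (tc f) n).
Qed.

(** At a radius between r and 1 the coefficients are bounded uniformly over the
unit ball, so on the disk of radius r the remainders are geometrically small. *)
Lemma Rn_small (r : R) : 0 <= r < 1 -> exists B q : R, [/\ 0 <= B, 0 <= q < 1 &
  forall f N w, A2 omega f -> normc w <= r -> normc (Rn N f w) <= A2norm omega f * (B * q ^+ N)].
Proof.
move=> /andP[r0 r1].
pose s := (1 + r) / 2; have s01 : 0 < s < 1 by rewrite /s; lra.
have s0 : 0 < s by case/andP: s01.
have rs : r < s by rewrite /s; lra.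
have [k k0 Hk] := mom_lower rw om0 s01.
pose q := r / s; have q01 : 0 <= q < 1.
  by rewrite /q divr_ge0 ?(ltW s0) //= ltr_pdivrMr // mul1r.
have sk : 0 < Num.sqrt k by rewrite sqrtr_gt0.
have q1 : 0 < 1 - q by case/andP: q01; rewrite subr_gt0.
exists ((Num.sqrt k)^-1 / (1 - q)), q; split => //.
  by rewrite divr_ge0 ?invr_ge0 ?sqrtr_ge0 // ltW.
move=> f N w fA wr; have fn0 := A2norm_ge0 omega f.
have w1 : normc w < 1 by apply: le_lt_trans r1.
have cb n : normc (tc f n) * normc w ^+ n <= A2norm omega f / Num.sqrt k * q ^+ n.
  have C1 : normc (tc f n) * (s ^+ n * Num.sqrt k) <= A2norm omega f.
    rewrite -(ler_pXn2r (n := 2)) ?nnegrE ?mulr_ge0 ?normc_ge0 ?exprn_ge0 ?sqrtr_ge0 ?(ltW s0) //.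
    have -> : (normc (tc f n) * (s ^+ n * Num.sqrt k)) ^+ 2 = normc (tc f n) ^+ 2 * (s ^+ (2 * n) * k).
      by rewrite -[in RHS](sqr_sqrtr (ltW k0)) [(2 * n)%N]mulnC exprM; ring.
    rewrite (A2norm_sqr rw).
    by apply: le_trans (tc_bound n fA); rewrite ler_wpM2l ?sqr_ge0.
  apply: (@le_trans _ _ (normc (tc f n) * r ^+ n)).
    by rewrite ler_wpM2l ?normc_ge0 // lerXn2r ?nnegrE ?normc_ge0.
  have -> : normc (tc f n) * r ^+ n = normc (tc f n) * (s ^+ n * Num.sqrt k) / Num.sqrt k * q ^+ n.
    have qn : q ^+ n * s ^+ n = r ^+ n by rewrite -exprMn /q divfK // gt_eqF.
    have kn : Num.sqrt k != 0 by rewrite gt_eqF.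
    by rewrite [X in X / _]mulrA mulfK // -mulrA [s ^+ n * q ^+ n]mulrC qn.
  by rewrite ler_wpM2r ?exprn_ge0 ?ler_wpM2r ?invr_ge0 ?sqrtr_ge0 //; case/andP: q01.
have [fa _ _] := fA.
apply/ler_addgt0Pr => e e0.
have [M HM] := tcP fa w1 e0.
have HMm := HM (maxn N M) (leq_maxr _ _).
have -> : Rn N f w = (psum (tc f) (maxn N M) w - psum (tc f) N w) + - (psum (tc f) (maxn N M) w - f w).
  by rewrite /Rn /Sn polydE //; ring.
apply: ler_normcD; last by rewrite normcN ltW.
rewrite /psum (sum_split (fun i => tc f i * w ^+ i)) ?leq_maxl //.
rewrite (le_trans (normc_sum _ _ _)) //.
apply: (@le_trans _ _ (\sum_(N <= i < maxn N M) A2norm omega f / Num.sqrt k * q ^+ i)).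
  by apply: ler_sum => i _; rewrite normcM normcX; exact: cb.
rewrite -mulr_sumr.
have -> : A2norm omega f * ((Num.sqrt k)^-1 / (1 - q) * q ^+ N) = A2norm omega f / Num.sqrt k * (q ^+ N / (1 - q)).
  by ring.
by rewrite ler_wpM2l ?divr_ge0 ?sqrtr_ge0 // geom_tail.
Qed.

(** Weak convergence of the normalized kernels to 0: f is a polynomial, which is
bounded while KK w tends to infinity, plus a remainder of small norm, to which
[eval_bound] applies. *)
Lemma kernel_weak_null f (e : R) : A2 omega f -> 0 < e -> exists2 r : R, 0 < r < 1 &
  forall w, r < normc w < 1 -> normc (f w) ^+ 2 <= e * KK w.
Proof.
move=> fA e0.
have e4 : 0 < e / 4 by rewrite divr_gt0.
have /cvgrPdist_le /(_ _ e4) [N _ HN] := dsum_cvg rw om0 fA.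
have RN : nrm2 (Rn N f) <= e / 4.
  apply: le_trans (nrm2_Rn N fA) _.
  by apply: le_trans (ler_norm _) _; exact: (HN N (leqnn _)).
pose B := \sum_(n < N) normc (tc f n).
have B0 : 0 <= B by apply: sumr_ge0 => i _; exact: normc_ge0.
have [r r01 Hr] := KK_infty (4 * B ^+ 2 / e).
exists r => // w rw1; have Kw := Hr w rw1; case/andP: rw1 => rw1 w1.
have -> : f w = Rn N f w + Sn N f w by rewrite /Rn subrK.
apply: le_trans (normc_sqrD_le _ _) _.
have H1 : normc (Rn N f w) ^+ 2 <= e / 4 * KK w.
  by apply: le_trans (eval_bound w1 (Rn_A2 N fA)) _; rewrite ler_wpM2r ?KK_ge0.
have H2 : normc (Sn N f w) <= B.
  rewrite /Sn polydE // /psum (le_trans (normc_sumn _ (fun i => tc f i * w ^+ i))) //.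
  apply: ler_sum => i _; rewrite normcM normcX ler_piMr ?normc_ge0 //.
  by rewrite exprn_ile1 ?normc_ge0 // ltW.
have H3 : normc (Sn N f w) ^+ 2 <= B ^+ 2 by rewrite lerXn2r ?nnegrE ?normc_ge0.
move: Kw; rewrite ler_pdivrMr // => Kw.
lra.
Qed.

End Kernel.

(** * The Laplacian of a radial function *)

Section RadialLaplacian.
Variable R : realType.
Variable phi : R[i] -> R.
Hypothesis phi_rad : radial phi.
Hypothesis phi_C2 : C2_on (disk2 (R := R)) (phi \o @cplx R).
Let G := phi \o @cplx R.

Lemma derive_dxE (F : R * R -> R) (s y : R) : 'D_(dx R) F (s, y) = 'D_1 (fun x => F (x, y)) s.
Proof.
rewrite /derive.
have -> // : (fun h : R => h^-1 *: ((F \o shift (s, y)) (h *: dx R) - F (s, y))) =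
  (fun h : R => h^-1 *: (((fun x => F (x, y)) \o shift s) (h *: 1) - F (s, y))).
apply/funext => h /=; congr (_ *: (F _ - _)).
by congr (_, _); rewrite /= scaler0 add0r.
Qed.

Lemma derive_dyE (F : R * R -> R) (s y : R) : 'D_(dy R) F (s, y) = 'D_1 (fun x => F (s, x)) y.
Proof.
rewrite /derive.
have -> // : (fun h : R => h^-1 *: ((F \o shift (s, y)) (h *: dy R) - F (s, y))) =
  (fun h : R => h^-1 *: (((fun x => F (s, x)) \o shift y) (h *: 1) - F (s, y))).
apply/funext => h /=; congr (_ *: (F _ - _)).
by congr (_, _); rewrite /= scaler0 add0r.
Qed.

Lemma derivable_dxE (F : R * R -> R) (s y : R) : derivable F (s, y) (dx R) ->
  derivable (fun x => F (x, y)) s 1.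
Proof.
rewrite /derivable.
have -> // : (fun h : R => h^-1 *: ((F \o shift (s, y)) (h *: dx R) - F (s, y))) =
  (fun h : R => h^-1 *: (((fun x => F (x, y)) \o shift s) (h *: 1) - F (s, y))).
apply/funext => h /=; congr (_ *: (F _ - _)).
by congr (_, _); rewrite /= scaler0 add0r.
Qed.

Definition prof (s : R) := G (s, 0).
Definition prof1 (s : R) := 'D_(dx R) G (s, 0).
Definition prof2 (s : R) := 'D_(dx R) ('D_(dx R) G) (s, 0).

Lemma disk2_axis (s : R) : `|s| < 1 -> disk2 (s, 0).
Proof. by move=> s1; change (normc (s%:C) < 1); rewrite normc_real. Qed.

Let dxin : [set dx R; dy R] (dx R). Proof. by left. Qed.
Let dyin : [set dx R; dy R] (dy R). Proof. by right. Qed.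

Lemma is_derive_prof (s : R) : `|s| < 1 -> is_derive s (1 : R) prof (prof1 s).
Proof.
move=> s1; have [H _] := phi_C2; have [D _] := H _ dxin _ (disk2_axis s1).
by apply: DeriveDef; [exact: derivable_dxE|rewrite /prof1 derive_dxE].
Qed.

Lemma is_derive_prof1 (s : R) : `|s| < 1 -> is_derive s (1 : R) prof1 (prof2 s).
Proof.
move=> s1; have [_ H] := phi_C2; have [D _] := H _ dxin _ dxin _ (disk2_axis s1).
by apply: DeriveDef; [exact: (derivable_dxE D)|rewrite /prof2 derive_dxE].
Qed.

Lemma profE z : normc z < 1 -> phi z = prof (normc z).
Proof.
move=> z1; apply: phi_rad => //.
  by apply: disk2_axis; rewrite ger0_norm ?normc_ge0.
by change (normc z = normc ((normc z)%:C)); rewrite normc_real ger0_norm ?normc_ge0.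
Qed.

Let rad (s t : R) := Num.sqrt (s ^+ 2 + t ^+ 2).

Let rad_derive (s t : R) : 0 < s -> is_derive t (1 : R) (rad s) (t / rad s t).
Proof.
move=> s0; have p0 : 0 < s ^+ 2 + t ^+ 2 by rewrite ltr_pwDl ?exprn_gt0 ?sqr_ge0.
have D : is_derive t (1 : R) (fun t : R => s ^+ 2 + t ^+ 2) (2 * t).
  apply: is_derive_eq.
  rewrite add0r -[LHS]/(_ * _) /= -[t%:A]/(t * 1); ring.
have := @is_derive1_comp _ Num.sqrt (fun t : R => s ^+ 2 + t ^+ 2) t _ _ (is_derive1_sqrt p0) D.
move=> H; apply: is_derive_eq; rewrite /rad.
by field; rewrite gt_eqF // sqrtr_gt0.
Qed.

(** On the vertical line through (s, 0) the function is prof (sqrt (s^2 + t^2)).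
Its first derivative in t is k t * t with k continuous at 0, so the second one
at 0 is k 0. *)
Lemma lap_dy (s : R) : 0 < s < 1 -> 'D_(dy R) ('D_(dy R) G) (s, 0) = prof1 s / s.
Proof.
move=> /andP[s0 s1].
pose k t := prof1 (rad s t) / rad s t.
have r0 : rad s 0 = s by rewrite /rad expr0n addr0 sqrtr_sqr gtr0_norm.
have rp t : 0 < rad s t by rewrite sqrtr_gt0 ltr_pwDl ?exprn_gt0 ?sqr_ge0.
have d0 : 0 < 1 - s by lra.
have rb t : `|t| < 1 - s -> rad s t < 1.
  move=> ts; rewrite -(ltr_pXn2r (n := 2)) ?nnegrE ?(ltW (rp t)) // expr1n /rad.
  rewrite sqr_sqrtr ?addr_ge0 ?sqr_ge0 // -[t ^+ 2]real_normK ?num_real //.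
  have := normr_ge0 t; nra.
have nearb (t : R) : `|t| < 1 - s -> \forall u \near t, `|u| < 1 - s.
  move=> ts; have e0 : 0 < 1 - s - `|t| by lra.
  apply/nbhs_ballP; exists (1 - s - `|t|) => //= u; rewrite /ball /= => tu.
  have := ler_normD (u - t) t; rewrite subrK distrC; lra.
have g2E t : `|t| < 1 - s -> 'D_(dy R) G (s, t) = k t * t.
  move=> ts; rewrite derive_dyE.
  have D : is_derive t (1 : R) (prof \o rad s) (prof1 (rad s t) * (t / rad s t)).
    apply: is_derive1_comp; last exact: rad_derive.
    by apply: is_derive_prof; rewrite ger0_norm ?(ltW (rp t)) // rb.
  have E : \forall u \near t, (prof \o rad s) u = (fun x => G (s, x)) u.
    have := nearb t ts; apply: filterS => u us /=.
    apply/esym; rewrite /G /= profE.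
      by congr prof; rewrite /rad.
    by rewrite -[normc _]/(rad s u) rb.
  have := near_eq_is_derive E D => -[_ ->].
  by rewrite /k; ring.
rewrite derive_dyE.
have kd : derivable k 0 1.
  have D1 : is_derive (0:R) 1 (rad s) (0 / rad s 0) by exact: rad_derive.
  have D2 : is_derive (0:R) 1 (prof1 \o rad s) (prof2 (rad s 0) * (0 / rad s 0)).
    have D3 : is_derive (rad s 0) (1 : R) prof1 (prof2 (rad s 0)).
      by apply: is_derive_prof1; rewrite r0 ger0_norm // ltW.
    exact: (@is_derive1_comp _ prof1 (rad s) 0 _ _ D3 D1).
  have [D1' _] := D1; have [D2' _] := D2.
  have s0' : rad s 0 != 0 by rewrite r0 gt_eqF.
  exact: (@derivableM R R (prof1 \o rad s) (fun t => (rad s t)^-1) 0 1 D2' (derivableV s0' D1')).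
have D : is_derive (0:R) 1 (fun t => k t * t) (k 0).
  have kD : is_derive (0:R) 1 k ('D_1 k 0) by exact: derivableP.
  have := @is_deriveM R R k id (0:R) 1 _ _ kD (is_derive_id _ _).
  by move=> H; apply: is_derive_eq; rewrite scale0r addr0 -[LHS]/(_ * _) mulr1.
have E : \forall u \near (0:R), k u * u = (fun x => 'D_(dy R) G (s, x)) u.
  have := nearb 0; rewrite normr0 => /(_ d0); apply: filterS => u us.
  by rewrite g2E.
have [_ ->] := near_eq_is_derive E D.
by rewrite /k r0.
Qed.

Definition mprof (s : R) := s * prof1 s.

(** The polar form of the Laplacian, Delta phi = (r phi')' / r. *)
Lemma is_derive_mprof (s : R) : 0 < s < 1 -> is_derive s (1 : R) mprof (s * laplacian G (s, 0)).
Proof.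
move=> s01; have /andP[s0 s1] := s01.
have D : is_derive s (1 : R) prof1 (prof2 s) by apply: is_derive_prof1; rewrite ger0_norm // ltW.
have := @is_deriveM R R id prof1 s 1 _ _ (is_derive_id _ _) D.
move=> H; apply: is_derive_eq.
rewrite /laplacian lap_dy // -/(prof2 s) -![_ *: _]/(_ * _); field.
by rewrite gt_eqF.
Qed.

End RadialLaplacian.

Section MeanValue.
Variable R : realType.
Implicit Types (g : R -> R) (a b c x : R).

Lemma mvt_le g (g' : R -> R) a b c : a <= b -> (forall x, a <= x <= b -> is_derive x 1 g (g' x)) ->
  (forall x, a <= x <= b -> g' x <= c) -> g b - g a <= c * (b - a).
Proof.
move=> ab gd gc.
have [||x xab ->] := @MVT_segment R g g' a b ab.
- by move=> x; rewrite in_itv /= => /andP[/ltW ax /ltW xb]; apply: gd; rewrite ax.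
- apply: continuous_in_subspaceT => x /set_mem /=; rewrite in_itv /= => xab.
  apply/differentiable_continuous/derivable1_diffP.
  by have [] := gd x xab.
by rewrite ler_wpM2r ?subr_ge0 // gc //; move: xab; rewrite in_itv.
Qed.

Lemma mvt_ge g (g' : R -> R) a b c : a <= b -> (forall x, a <= x <= b -> is_derive x 1 g (g' x)) ->
  (forall x, a <= x <= b -> c <= g' x) -> c * (b - a) <= g b - g a.
Proof.
move=> ab gd gc.
have K := @mvt_le (fun x => - g x) (fun x => - g' x) a b (- c) ab.
have H x : a <= x <= b -> is_derive x 1 (fun x => - g x) (- g' x) by move=> /gd ?; exact: is_deriveN.
have : - g b - - g a <= - c * (b - a) by apply: K => // x /gc; rewrite lerN2.
lra.
Qed.

End MeanValue.

(** * Peaks of weighted monomials *)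

(** What the estimates use of a weight exp(-phi), in terms of the radius: p is the
profile of phi, m = r p' and t = (Delta phi)^(-1/2).  The slope 1/8 for t is any
small number, available near the boundary because tau' tends to 0; since tau
tends to 0 as well, t is then at most 1/8 of the distance to the boundary. *)
Record regular_profile (R : realType) (p m t : R -> R) (r1 : R) : Prop := RegularProfile {
  rp_r1 : 2^-1 <= r1 < 1;
  rp_gt0 : forall s, 0 < s < 1 -> 0 < t s;
  rp_dec : forall x y, r1 <= x -> x <= y -> y < 1 -> t y <= t x;
  rp_lip : forall x y, r1 <= x -> x <= y -> y < 1 -> t x <= t y + (y - x) / 8;
  rp_small : forall x, r1 <= x < 1 -> t x <= (1 - x) / 8;
  rp_p : forall s : R, 0 < s < 1 -> is_derive s (1 : R) p (m s / s);
  rp_m : forall s : R, 0 < s < 1 -> is_derive s (1 : R) m (s / t s ^+ 2) }.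

Section ClassProfile.
Variables (R : realType) (phi : R[i] -> R).
Hypothesis phiW : classW_exponent phi.
Let G := phi \o @cplx R.

Lemma laplacian_axis_gt0 (s : R) : `|s| < 1 -> 0 < laplacian G (s, 0).
Proof.
by case: phiW => _ _ [C C0 H] _ _ s1; apply: lt_le_trans C0 _; apply/H/disk2_axis.
Qed.

Lemma tau_gt0 (s : R) : `|s| < 1 -> 0 < tau phi s.
Proof. by move=> s1; apply/powR_gt0/laplacian_axis_gt0. Qed.

Lemma tau_sqr (s : R) : `|s| < 1 -> laplacian G (s, 0) = (tau phi s ^+ 2)^-1.
Proof.
move=> s1; have l0 := laplacian_axis_gt0 s1.
rewrite /tau -/G -powR_mulrn ?powR_ge0 // -powRrM.
have -> : - 2^-1 * 2%:R = - 1 :> R by lra.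
by rewrite powRN powRr1 ?invrK // ltW.
Qed.

Lemma near_left1 (P : R -> Prop) : (\forall r \near 1^'-, P r) ->
  exists2 r : R, r < 1 & forall x, r < x < 1 -> P x.
Proof.
case=> e /= e0 H; exists (1 - e); first by rewrite ltrBlDr ltrDl.
move=> x /andP[x1 x2]; apply: H => //=.
by rewrite /ball_ /= ger0_norm; lra.
Qed.

Lemma classW_profile : exists r1, regular_profile (prof phi) (mprof phi) (tau phi) r1.
Proof.
case: phiW => prad pC2 _ [[r0 r001 dec] t0] [nd nd0 _].
have [ra ra1 da] := near_left1 nd.
have [rb rb1 db] : exists2 r : R, r < 1 & forall x, r < x < 1 -> `|derive1 (tau phi) x| <= 8^-1.
  by apply: near_left1; have /cvgr0_norm_le /(_ _ _) := nd0; apply; rewrite invr_gt0.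
pose r1 := Num.max (Num.max r0 2^-1) (Num.max ((ra + 1) / 2) ((rb + 1) / 2)).
have r1r0 : r0 <= r1 by rewrite !le_max lexx.
have r1h : 2^-1 <= r1 by rewrite !le_max lexx orbT.
have r1a : ra < r1 by rewrite !lt_max; apply/orP; right; apply/orP; left; lra.
have r1b : rb < r1 by rewrite !lt_max; apply/orP; right; apply/orP; right; lra.
have r11 : r1 < 1.
  by case/andP: r001 => _ r01; rewrite !gt_max r01 /=; apply/and3P; split; lra.
have abs1 (s : R) : 0 < s < 1 -> `|s| < 1 by case/andP=> s0 s1; rewrite gtr0_norm.
have lip x y : r1 <= x -> x <= y -> y < 1 -> tau phi x <= tau phi y + (y - x) / 8.
  move=> xr xy y1.
  have := @mvt_ge R (tau phi) (derive1 (tau phi)) x y (- 8^-1) xy.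
  have H z : x <= z <= y -> is_derive z 1 (tau phi) (derive1 (tau phi) z).
    by move=> /andP[xz zy]; rewrite derive1E; apply: derivableP; apply: da; apply/andP; split; lra.
  move=> /(_ H) K.
  have : - 8^-1 * (y - x) <= tau phi y - tau phi x.
    apply: K => z /andP[xz zy].
    have /db : rb < z < 1 by apply/andP; split; lra.
    by rewrite ler_norml => /andP[].
  by move: (tau phi x) (tau phi y) => a b ab; clear -ab; lra.
refine (ex_intro _ r1 (RegularProfile _ _ _ _ _ _ _)); last 2 first.
- move=> s s01; have := is_derive_prof pC2 (abs1 _ s01).
  move=> H; apply: is_derive_eq; rewrite /mprof mulrC mulKf //.
  by case/andP: s01 => ? _; rewrite gt_eqF.
- move=> s s01; have := is_derive_mprof prad pC2 s01.
  by rewrite tau_sqr ?abs1.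
- by apply/andP.
- by move=> s /abs1; exact: tau_gt0.
- move=> x y xr xy y1; apply: dec => //; rewrite in_itv /=; apply/andP; split; lra.
- exact: lip.
- move=> x /andP[xr x1]; apply/ler_addgt0Pr => e e0.
  have [rc rc1 dc] : exists2 r : R, r < 1 & forall x, r < x < 1 -> `|tau phi x| <= e.
    by apply: near_left1; have /cvgr0_norm_le /(_ _ e0) := t0; apply.
  pose y := Num.max ((x + 1) / 2) ((rc + 1) / 2).
  have yx : x <= y by rewrite le_max; apply/orP; left; lra.
  have yc : rc < y by rewrite lt_max; apply/orP; right; lra.
  have y1 : y < 1 by rewrite gt_max; apply/andP; split; lra.
  have := lip x y xr yx y1.
  have : tau phi y <= e by apply: le_trans (ler_norm _) _; apply: dc; apply/andP; split.
  by move: (tau phi x) (tau phi y) => a b ab; clear -ab yx y1; lra.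
Qed.

End ClassProfile.

Section ProfileEstimates.
Variables (R : realType) (p m t : R -> R) (r1 : R).
Hypothesis P : regular_profile p m t r1.

Let r1h : 2^-1 <= r1. Proof. by case/andP: (rp_r1 P). Qed.
Let r11 : r1 < 1. Proof. by case/andP: (rp_r1 P). Qed.
Let tp (s : R) : r1 <= s < 1 -> 0 < t s.
Proof. by case/andP=> a b; apply: (rp_gt0 P); apply/andP; split=> //; have := r1h; lra. Qed.

Lemma nat_floor (x : R) : 0 <= x -> exists2 k : nat, k%:R <= x & x < k%:R + 1.
Proof.
by move=> x0; exists (Num.truncn x); have /andP[] := truncn_itv x0; rewrite ?natr1.
Qed.

Lemma m_slope_ge a b c : 0 < a -> a <= b -> b < 1 ->
  (forall s, a <= s <= b -> c <= s / t s ^+ 2) -> c * (b - a) <= m b - m a.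
Proof.
move=> a0 ab b1 H; apply: mvt_ge ab _ H => x /andP[ax xb].
by apply: (rp_m P); apply/andP; split; lra.
Qed.

Lemma m_slope_le a b c : 0 < a -> a <= b -> b < 1 ->
  (forall s, a <= s <= b -> s / t s ^+ 2 <= c) -> m b - m a <= c * (b - a).
Proof.
move=> a0 ab b1 H; apply: mvt_le ab _ H => x /andP[ax xb].
by apply: (rp_m P); apply/andP; split; lra.
Qed.

Lemma m_incr a b : 0 < a -> a <= b -> b < 1 -> m a <= m b.
Proof.
move=> a0 ab b1; rewrite -subr_ge0 -[X in X <= _](mul0r (b - a)); apply: m_slope_ge => // s /andP[as_ sb].
by rewrite divr_ge0 ?sqr_ge0 //; lra.
Qed.

(** The logarithm of s^(2n) exp(-p s), the squared modulus of a monomial times the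
weight.  Its derivative is (2n - m) / s, so it peaks where m = 2n. *)
Definition hlog (n : nat) (s : R) := n.*2%:R * ln s - p s.

Lemma is_derive_hlog n (s : R) : 0 < s < 1 -> is_derive s (1 : R) (hlog n) ((n.*2%:R - m s) / s).
Proof.
move=> s01; have s0 : 0 < s by case/andP: s01.
have D1 := rp_p P s01; have D2 := is_derive1_ln s0.
have H := is_deriveB (is_deriveZ (n.*2%:R) D2) D1.
have -> : hlog n = (n.*2%:R \*: (@ln R)) - p by [].
by apply: is_derive_eq; rewrite -[_ *: _]/(_ * _) mulrBl.
Qed.

Lemma hlog_slope_le n a b c : 0 < a -> a <= b -> b < 1 ->
  (forall s, a <= s <= b -> (n.*2%:R - m s) / s <= c) -> hlog n b - hlog n a <= c * (b - a).
Proof.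
move=> a0 ab b1 H; apply: mvt_le ab _ H => x /andP[ax xb].
by apply: is_derive_hlog; apply/andP; split; lra.
Qed.

Lemma hlog_slope_ge n a b c : 0 < a -> a <= b -> b < 1 ->
  (forall s, a <= s <= b -> c <= (n.*2%:R - m s) / s) -> c * (b - a) <= hlog n b - hlog n a.
Proof.
move=> a0 ab b1 H; apply: mvt_ge ab _ H => x /andP[ax xb].
by apply: is_derive_hlog; apply/andP; split; lra.
Qed.

Section AtPoint.
Variable r : R.
Hypotheses (rge : r1 <= r) (rlt1 : r < 1) (rr : r1 <= r - t r).

Let t0 : 0 < t r. Proof. by apply: tp; apply/andP. Qed.

Let tsm : t r <= (1 - r) / 8. Proof. by apply: (rp_small P); apply/andP. Qed.

(** To the right of r the slope of [hlog] is at most 2 / t r; after 4 * t r it is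
below -1 / t r, because m grows at the rate s / t^2.  To the left of r it is
nonnegative, and at least 1 / (3 * t r) beyond a distance t r. *)
Lemma peak n : m r <= n.*2%:R <= m r + (t r)^-1 -> forall s, 0 < s < 1 ->
  hlog n s - hlog n r <= 12 - `|s - r| / (8 * t r).
Proof.
move=> /andP[nlo nhi] s /andP[s0 s1].
have h1 := r1h; have h2 := rge; have h3 := tsm; have h4 := t0; have h5 := rr.
have tu : (t r)^-1 * t r = 1 by rewrite mulVf ?gt_eqF.
set u := (t r)^-1 in tu nhi *.
have u0 : 0 < u by rewrite invr_gt0.
have -> : `|s - r| / (8 * t r) = `|s - r| * u / 8.
  by rewrite /u; field; rewrite gt_eqF.
have [rs|sr] := leP r s.
  rewrite ger0_norm ?subr_ge0 //.
  have near b : r <= b -> b <= r + 4 * t r -> b < 1 -> hlog n b - hlog n r <= 2 * u * (b - r).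
    move=> rb bt b1; apply: hlog_slope_le => //; first lra.
    move=> x /andP[rx xb].
    have mx : m r <= m x by apply: m_incr; lra.
    rewrite ler_pdivrMr; last lra.
    nra.
  have [st|ts] := leP s (r + 4 * t r).
    have := near s rs st s1.
    have : u * (s - r) <= u * (4 * t r) by rewrite ler_pM2l //; lra.
    nra.
  have := near (r + 4 * t r).
  have e1 : r + 4 * t r < 1 by lra.
  have /[swap]/[apply] : r <= r + 4 * t r by lra.
  move=> /(_ (lexx _) e1) N1.
  have mfar : m r + 2 * u <= m (r + 4 * t r).
    have : 2^-1 * (u * u) * (r + 4 * t r - r) <= m (r + 4 * t r) - m r.
      apply: m_slope_ge => //; first lra.
        lra.
      move=> x /andP[rx xb].
      have tx0 : 0 < t x by apply: tp; apply/andP; split; lra.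
      have tx : t x <= t r by apply: (rp_dec P); lra.
      rewrite ler_pdivlMr ?exprn_gt0 //.
      have : u * t x <= 1 by rewrite -tu ler_pM2l.
      have : 0 <= u * t x by rewrite mulr_ge0 // ltW.
      rewrite expr2; nra.
    nra.
  have : hlog n s - hlog n (r + 4 * t r) <= - u * (s - (r + 4 * t r)).
    apply: hlog_slope_le => //; [lra|lra|].
    move=> x /andP[rx xb].
    have mx : m (r + 4 * t r) <= m x by apply: m_incr; lra.
    rewrite ler_pdivrMr; last lra.
    nra.
  have : 0 <= u * (s - r) by rewrite mulr_ge0 // ?subr_ge0 // ltW.
  nra.
rewrite distrC ger0_norm; last by rewrite subr_ge0 ltW.
have near a : 0 < a -> a <= r -> 0 * (r - a) <= hlog n r - hlog n a.
  move=> a0 ar; apply: hlog_slope_ge => // x /andP[ax xr].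
  have mx : m x <= m r by apply: m_incr; lra.
  by apply: divr_ge0; lra.
have [st|ts] := leP (r - t r) s.
  have := near s s0 (ltW sr).
  have : u * (r - s) <= u * t r by rewrite ler_pM2l //; lra.
  lra.
have := near (r - t r).
have /[swap]/[apply] : 0 < r - t r by lra.
have /[swap]/[apply] : r - t r <= r by lra.
move=> N1.
have mfar : m (r - t r) + 3^-1 * u <= m r.
  have : 3^-1 * (u * u) * (r - (r - t r)) <= m r - m (r - t r).
    apply: m_slope_ge => //; [lra|lra|].
    move=> x /andP[rx xb].
    have tx0 : 0 < t x by apply: tp; apply/andP; split; lra.
    have tx : t x <= t r + (r - x) / 8 by apply: (rp_lip P); lra.
    rewrite ler_pdivlMr ?exprn_gt0 //.
    have : u * t x <= 9 / 8.
      have : u * t x <= u * (9 / 8 * t r) by rewrite ler_pM2l //; lra.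
      lra.
    have : 0 <= u * t x by rewrite mulr_ge0 // ltW.
    rewrite expr2; nra.
  nra.
have : 3^-1 * u * (r - t r - s) <= hlog n (r - t r) - hlog n s.
  apply: hlog_slope_ge => //; [lra|lra|].
  move=> x /andP[rx xb].
  have mx : m x <= m (r - t r) by apply: m_incr; lra.
  rewrite ler_pdivlMr; last lra.
  nra.
have : 0 <= u * (r - s) by rewrite mulr_ge0 // ?subr_ge0 ltW.
nra.
Qed.

(** Over a distance t r the function m changes by at most a multiple of 1 / t r, so
[hlog] changes by a bounded amount. *)
Lemma plateau n : `|n.*2%:R - m r| <= 2 -> forall s, `|s - r| <= t r -> `|hlog n s - hlog n r| <= 12.
Proof.
move=> nm s sr.
have h1 := r1h; have h2 := rge; have h3 := tsm; have h4 := t0; have h5 := rr.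
have tu : (t r)^-1 * t r = 1 by rewrite mulVf ?gt_eqF.
set u := (t r)^-1 in tu *.
have u0 : 0 < u by rewrite invr_gt0.
have b1 : r + t r < 1 by lra.
have dm a b : r - t r <= a -> a <= b -> b <= r + t r -> m b - m a <= 4 / 3 * (u * u) * (b - a).
  move=> ra ab br; apply: m_slope_le => //; [lra|lra|].
  move=> x /andP[ax xb].
  have tx0 : 0 < t x by apply: tp; apply/andP; split; lra.
  have tx : 7 / 8 * t r <= t x.
    have [xr|rx] := leP x r.
      have : t r <= t x by apply: (rp_dec P); lra.
      lra.
    have : t r <= t x + (x - r) / 8 by apply: (rp_lip P); lra.
    lra.
  rewrite ler_pdivrMr ?exprn_gt0 //.
  have : 7 / 8 <= u * t x.
    have : u * (7 / 8 * t r) <= u * t x by rewrite ler_pM2l //; lra.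
    lra.
  rewrite expr2; nra.
have mb x : `|x - r| <= t r -> `|n.*2%:R - m x| <= 2 + 4 / 3 * u.
  rewrite ler_norml => /andP[xl xr].
  have : `|m x - m r| <= 4 / 3 * u.
    have [rx|xr'] := leP r x.
      have : m r <= m x by apply: m_incr; lra.
      have := dm r x; have /[swap]/[apply] : r - t r <= r by lra.
      move=> /(_ rx); have /[swap]/[apply] : x <= r + t r by lra.
      have : u * (x - r) <= u * t r by rewrite ler_pM2l //; lra.
      move=> q1 q2 q3; rewrite ger0_norm ?subr_ge0 //; nra.
    have : m x <= m r by apply: m_incr; lra.
    have := dm x r; have /[swap]/[apply] : r - t r <= x by lra.
    move=> /(_ (ltW xr')); have /[swap]/[apply] : r <= r + t r by lra.
    have : u * (r - x) <= u * t r by rewrite ler_pM2l //; lra.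
    move=> q1 q2 q3; rewrite distrC ger0_norm ?subr_ge0 //; nra.
  have := ler_normD (n.*2%:R - m r) (m r - m x).
  rewrite [`|m r - _|]distrC addrA subrK; have := nm; lra.
have dh a b : r - t r <= a -> a <= b -> b <= r + t r -> `|hlog n b - hlog n a| <= (4 + 8 / 3 * u) * (b - a).
  move=> ra ab br.
  have sl x : a <= x <= b -> `|(n.*2%:R - m x) / x| <= 4 + 8 / 3 * u.
    move=> /andP[ax xb]; have x0 : 0 < x by lra.
    rewrite normrM normfV (gtr0_norm x0) ler_pdivrMr //.
    have : `|n.*2%:R - m x| <= 2 + 4 / 3 * u by apply: mb; rewrite ler_norml; apply/andP; split; lra.
    nra.
  rewrite ler_norml; apply/andP; split.
    rewrite -mulNr; apply: hlog_slope_ge => //; [lra|lra|].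
    by move=> x /sl; rewrite ler_norml => /andP[].
  apply: hlog_slope_le => //; [lra|lra|].
  by move=> x /sl; rewrite ler_norml => /andP[].
move: (sr); rewrite ler_norml => /andP[sl1 sl2].
have fin : (4 + 8 / 3 * u) * t r <= 12 by lra.
have c0 : 0 < 4 + 8 / 3 * u by lra.
have [rs|sr'] := leP r s.
  apply: le_trans (dh r s _ rs _) _; [lra|lra|].
  apply: le_trans fin; rewrite ler_pM2l //; lra.
rewrite distrC; apply: le_trans (dh s r _ (ltW sr') _) _; [lra|lra|].
apply: le_trans fin; rewrite ler_pM2l //; lra.
Qed.

(** The indices n whose peak is near r fill an interval of length 1 / (2 * t r).
Their number makes the kernel as large as 1 / (omega tau^2) on the diagonal. *)
Lemma many_peaks : 0 <= m r -> exists a K : nat,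
  (4 * t r)^-1 <= K%:R /\ forall n, (a <= n < a + K)%N -> m r <= n.*2%:R <= m r + (t r)^-1.
Proof.
move=> m0; have h3 := tsm; have h4 := t0; have h1 := r1h; have h2 := rge.
have u0 : 0 <= (2 * t r)^-1 by rewrite invr_ge0; lra.
have tu : (t r)^-1 * t r = 1 by rewrite mulVf ?gt_eqF.
have e2 : (2 * t r)^-1 = (t r)^-1 / 2 by field; rewrite gt_eqF.
have e4 : (4 * t r)^-1 = (t r)^-1 / 4 by field; rewrite gt_eqF.
have [K k1 k2] := nat_floor u0.
have [|a j1 j2] := @nat_floor (m r / 2); first lra.
exists a.+1, K; split.
  rewrite e4; move: k2; rewrite e2.
  have : 4 <= (t r)^-1 by rewrite -[4]invrK lef_pV2 ?posrE; lra.
  lra.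
move=> n /andP[an nb].
have an' : a.+1%:R <= n%:R :> R by rewrite ler_nat.
have nb' : n%:R <= (a + K)%:R :> R by rewrite ler_nat -ltnS -addSn.
rewrite -mul2n natrM; move: nb' an'; rewrite natrD -[a.+1%:R]natr1 => nb' an'.
move: k1; rewrite e2 => k1; apply/andP; split; lra.
Qed.

Lemma near_index : 0 <= m r -> exists n : nat, `|n.*2%:R - m r| <= 2.
Proof.
move=> m0; have [|a j1 j2] := @nat_floor (m r / 2); first lra.
exists a; rewrite -mul2n natrM.
by rewrite ler_norml; apply/andP; split; lra.
Qed.

End AtPoint.

(** As t is at most a multiple of the distance to the boundary, m' = s / t^2 is not
integrable up to 1. *)
Lemma m_unbounded M : exists2 r2, r1 <= r2 < 1 & forall r, r2 <= r < 1 -> r1 <= r - t r /\ M <= m r.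
Proof.
have h1 := r1h; have h2 := r11.
pose q : R := `|M| + `|m r1| + 1.
have q1 : 1 <= q by rewrite /q; have := normr_ge0 M; have := normr_ge0 (m r1); lra.
pose r2 := Num.max ((1 + r1) / 2) (1 - q^-1).
have qi : q^-1 * q = 1 by rewrite mulVf // gt_eqF //; lra.
have qi0 : 0 < q^-1 by rewrite invr_gt0; lra.
have r2a : (1 + r1) / 2 <= r2 by rewrite le_max lexx.
have r2b : 1 - q^-1 <= r2 by rewrite le_max lexx orbT.
have r21 : r2 < 1 by rewrite gt_max; apply/andP; split; lra.
exists r2; first by apply/andP; split; lra.
move=> r /andP[rr rlt]; split.
  have : t r <= (1 - r) / 8 by apply: (rp_small P); apply/andP; split; lra.
  lra.
pose x := 2 * r - 1.
have xr1 : r1 <= x by rewrite /x; lra.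
have : (2 * (1 - r)^-1 * (1 - r)^-1) * (r - x) <= m r - m x.
  apply: m_slope_ge; rewrite /x; try lra.
  move=> s /andP[xs sr].
  have ts0 : 0 < t s by apply: tp; apply/andP; split; lra.
  have ts : t s <= (1 - s) / 8 by apply: (rp_small P); apply/andP; split; lra.
  rewrite ler_pdivlMr ?exprn_gt0 //.
  have : (1 - r)^-1 * t s <= 1 / 4.
    by rewrite mulrC ler_pdivrMr; lra.
  have : 0 <= (1 - r)^-1 * t s by rewrite mulr_ge0 ?invr_ge0; lra.
  rewrite expr2; nra.
have -> : r - x = 1 - r by rewrite /x; lra.
rewrite mulfVK; last by rewrite gt_eqF //; lra.
have : q <= (1 - r)^-1.
  rewrite -[q]invrK lef_pV2 ?posrE //; lra.
have : m r1 <= m x by apply: m_incr => //; rewrite /x; lra.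
have a1 := ler_norm M; have a2 := ler_norm (- m r1); rewrite normrN in a2.
rewrite /q; set v := (1 - r)^-1; move: v (m r) (m x) (m r1) `|M| `|m r1| a1 a2 (normr_ge0 M) (normr_ge0 (m r1)) => v b c d e f.
lra.
Qed.

End ProfileEstimates.

(** * The kernel on the diagonal *)

Section PeakIntegral.
Variable R : realType.
Local Notation M2 := (measurableTypeR R * measurableTypeR R)%type.

Lemma expRN1 : 0 < expR (- 1 : R) < 1.
Proof. by rewrite expR_gt0 expR_lt1 ltrN10. Qed.

Lemma sum_succ_geom (q : R) K : 0 <= q < 1 -> \sum_(k < K) k.+1%:R * q ^+ k <= (1 - q)^-2.
Proof.
move=> /andP[q0 q1]; have d0 : 0 < (1 - q) ^+ 2 by rewrite exprn_gt0 // subr_gt0.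
rewrite -[leRHS]mul1r ler_pdivlMr //.
have -> : (\sum_(k < K) k.+1%:R * q ^+ k) * (1 - q) ^+ 2 = 1 - K.+1%:R * q ^+ K + K%:R * (q * q ^+ K).
  elim: K => [|K ih]; first by rewrite big_ord0 expr0; ring.
  by rewrite big_ord_recr /= mulrDl ih -[K.+2%:R]natr1 -[K.+1%:R]natr1 [q ^+ K.+1]exprS; ring.
have K0 : 0 <= K%:R :> R by [].
have qK : 0 <= q ^+ K by rewrite exprn_ge0.
have : q * q ^+ K <= q ^+ K by rewrite ler_piMl // ltW.
move=> qq; have : K%:R * (q * q ^+ K) <= K%:R * q ^+ K by rewrite ler_wpM2l.
rewrite -[K.+1%:R]natr1 mulrDl mul1r; lra.
Qed.

Definition band (r b : R) : set M2 := disc2 1 `&` (disc2 (r + b) `\` disc2 (r - b)).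

Lemma measurable_band r b : measurable (band r b).
Proof.
apply: measurableI; first exact: measurable_disc2.
by apply: measurableD; exact: measurable_disc2.
Qed.

Lemma band_area (r b : R) : 2^-1 <= r < 1 -> 0 < b -> (dA R (band r b) <= (4 * b * disk_area R)%:E)%E.
Proof.
move=> /andP[r2 r1] b0; have a0 := disk_area_gt0 R.
have [rb|br] := leP r b.
  apply: (@le_trans _ _ (dA R (disc2 1))).
    apply: le_measure; rewrite ?inE; [exact: measurable_band|exact: measurable_disc2|].
    by move=> p [].
  rewrite dA_discE // expr1n lee_fin ler_wpM2r ?(ltW a0) //; lra.
apply: (@le_trans _ _ (dA R (disc2 (r + b) `\` disc2 (r - b)))).
  apply: le_measure; rewrite ?inE; [exact: measurable_band| |by move=> p []].
  by apply: measurableD; exact: measurable_disc2.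
rewrite dA_annulus ?lee_fin ?ler_wpM2r ?(ltW a0) //; [|lra|lra].
have : 0 <= b * (1 - r) by rewrite mulr_ge0; lra.
nra.
Qed.

(** On the k-th layer the exponential is at most e^(-k), and the layer lies in a
band; this reduces [peak_integral] to areas of bands. *)
Lemma expR_layers (r t : R) K (p : M2) : 0 < t -> disc2 1 p -> `|normc (cplx p) - r| / (8 * t) < K%:R ->
  expR (- (`|normc (cplx p) - r| / (8 * t))) <=
    \sum_(k < K) expR (- 1 : R) ^+ k * \1_(band r (8 * t * k.+1%:R)) p.
Proof.
move=> t0 Dp; have t8 : 0 < 8 * t by lra.
set x := _ / _ => xK; have x0 : 0 <= x by rewrite divr_ge0 // ltW.
have /andP[k1 k2] := truncn_itv x0.
have kK : (Num.truncn x < K)%N by rewrite -(ltr_nat R); apply: le_lt_trans xK.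
rewrite (bigD1 (Ordinal kK)) //=.
have -> : \1_(band r (8 * t * (Num.truncn x).+1%:R)) p = 1 :> R.
  rewrite indicE mem_set //; split => //.
  move: k2; rewrite {1}/x ltr_pdivrMr // mulrC ltr_norml => /andP[l1 l2].
  split; first by rewrite /disc2 /=; lra.
  by rewrite /disc2 /= => l3; lra.
rewrite mulr1 -[leLHS]addr0; apply: lerD; last first.
  by apply: sumr_ge0 => i _; rewrite mulr_ge0 ?exprn_ge0 ?expR_ge0.
by rewrite -expRM_natl ler_expR mulrN1 lerN2.
Qed.

Lemma peak_integral (r t : R) : 2^-1 <= r < 1 -> 0 < t ->
  (\int[dA R]_(p in disc2 1) (expR (- (`|normc (cplx p) - r| / (8 * t))))%:E <=
     (32 * disk_area R * (1 - expR (- 1)) ^- 2 * t)%:E)%E.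
Proof.
move=> r01 t0; have /andP[r2 r1] := r01.
have a0 := disk_area_gt0 R; have t8 : 0 < 8 * t by lra.
pose K := (Num.bound (8 * t)^-1).+1.
have K8 : (8 * t)^-1 < K%:R.
  have i0 : 0 <= (8 * t)^-1 by rewrite invr_ge0; lra.
  by apply: lt_trans (archi_boundP i0) _; rewrite ltr_nat.
have mB k := measurable_band r (8 * t * k.+1%:R).
have mi k : measurable_fun (disc2 1) (fun p : M2 => (expR (- 1 : R) ^+ k)%:E * (\1_(band r (8 * t * k.+1%:R)) p)%:E)%E.
  by apply: measurable_funeM; apply/measurable_EFinP; exact: measurable_indic.
apply: (@le_trans _ _ (\int[dA R]_(p in disc2 1)
   (\sum_(k < K) (expR (- 1 : R) ^+ k)%:E * (\1_(band r (8 * t * k.+1%:R)) p)%:E))%E).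
  apply: ge0_le_integral => //.
  - exact: measurable_disc2.
  - apply/measurable_EFinP; apply: measurableT_comp => //.
    apply: measurableT_comp => //; apply: measurable_funM => //.
    apply: measurableT_comp => //; apply: measurable_funB => //.
    apply: measurable_normc; exact: cmeas_cplx.
  - by apply: emeasurable_sum => k; exact: mi.
  - move=> p Dp; rewrite (eq_bigr (fun k : 'I_K => (expR (- 1 : R) ^+ k * \1_(band r (8 * t * k.+1%:R)) p)%:E)) //.
    rewrite sumEFin lee_fin; apply: expR_layers => //.
    apply: le_lt_trans K8; rewrite -[leRHS]mul1r ler_wpM2r ?invr_ge0 ?(ltW t8) //.
    by move: Dp; rewrite /disc2 /= => Dp; rewrite ler_norml; have := normc_ge0 (cplx p); lra.
rewrite ge0_integral_sum; [|exact: measurable_disc2|by move=> k; exact: mi|]; last first.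
  by move=> k p _; rewrite -EFinM lee_fin mulr_ge0 ?exprn_ge0 ?expR_ge0.
apply: (@le_trans _ _ (\sum_(k < K) (expR (- 1 : R) ^+ k * (4 * (8 * t * k.+1%:R) * disk_area R))%:E)%E).
  apply: lee_sum => k _; rewrite ge0_integralZl_EFin ?exprn_ge0 ?expR_ge0 //; [|exact: measurable_disc2|].
    rewrite integral_indic ?EFinM; [|exact: measurable_disc2|exact: mB].
    rewrite lee_pmul2l ?lte_fin ?exprn_gt0 ?expR_gt0 //.
    have -> : band r (8 * t * k.+1%:R) `&` disc2 1 = band r (8 * t * k.+1%:R).
      by apply: setIidl => p [].
    by apply: band_area => //; rewrite mulr_gt0.
  by apply/measurable_EFinP; exact: measurable_indic.
rewrite sumEFin lee_fin.
have -> : \sum_(k < K) expR (- 1 : R) ^+ k * (4 * (8 * t * k.+1%:R) * disk_area R) =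
    32 * disk_area R * t * \sum_(k < K) k.+1%:R * expR (- 1 : R) ^+ k.
  by rewrite mulr_sumr; apply: eq_bigr => k _; ring.
rewrite [leRHS]mulrAC ler_wpM2l ?mulr_ge0 ?(ltW a0) ?(ltW t0) //.
by apply: sum_succ_geom; have /andP[/ltW -> ->] := expRN1.
Qed.

End PeakIntegral.

Section KernelSize.
Variables (R : realType) (omega : R[i] -> R) (p m t : R -> R) (r1 : R).
Local Notation M2 := (measurableTypeR R * measurableTypeR R)%type.
Hypothesis P : regular_profile p m t r1.
Hypothesis rw : radial_weight 1 omega.
Hypothesis omE : forall z, normc z < 1 -> omega z = expR (- p (normc z)).
Local Notation bkernel := (Defs.kernel omega).
Local Notation KK := (KK omega).
Local Notation mom := (mom omega).
Local Notation nrm2 := (nrm2 omega).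

Let om0 z : normc z < 1 -> 0 < omega z.
Proof. by move=> z1; rewrite omE // expR_gt0. Qed.

Let r1h : 2^-1 <= r1 < 1 := rp_r1 P.

(** Radii at which all estimates on a disk of radius tau hold. *)
Definition deep (s : R) := [/\ r1 <= s, s < 1, r1 <= s - t s & 1 <= m s].

Lemma deepP : exists2 r2, r1 <= r2 < 1 & forall s, r2 <= s < 1 -> deep s.
Proof.
have [r2 /andP[r12 r21] H] := m_unbounded P 1; exists r2; first by rewrite r12.
move=> s s01; have [h1 h2] := H s s01; case/andP: s01 => h3 h4.
by split=> //; exact: le_trans h3.
Qed.

Lemma peakE n z : 0 < normc z < 1 -> normc z ^+ (2 * n) * omega z = expR (hlog p n (normc z)).
Proof.
move=> /andP[z0 z1]; rewrite omE // /hlog expRD; congr (_ * _).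
by rewrite expRM_natl lnK ?posrE // mul2n.
Qed.

Definition peak_const : R := expR 12 * (32 * disk_area R * (1 - expR (- 1)) ^- 2).

Lemma peak_const_gt0 : 0 < peak_const.
Proof.
have /andP[_ e1] := expRN1 R.
by rewrite mulr_gt0 ?expR_gt0 // mulr_gt0 ?mulr_gt0 ?disk_area_gt0 // invr_gt0 exprn_gt0 // subr_gt0.
Qed.

Lemma deep_t s : deep s -> 0 < t s /\ t s <= (1 - s) / 8.
Proof.
case=> h1 h2 h3 h4; split; last by apply: (rp_small P); rewrite h1.
by apply: (rp_gt0 P); apply/andP; split => //; case/andP: r1h => ? _; lra.
Qed.

(** By [peak] the integrand is at most its value at radius normc z times an
exponential of width 8 * tau, whose integral is of order tau. *)
Lemma mom_peak n z : deep (normc z) ->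
  m (normc z) <= n.*2%:R <= m (normc z) + (t (normc z))^-1 ->
  mom n <= peak_const * (normc z ^+ (2 * n) * omega z) * t (normc z).
Proof.
set r := normc z => dr mn; have [t0 ts] := deep_t dr; case: dr => h1 h2 h3 h4.
have /andP[q1 q2] := r1h.
have r01 : 0 < r < 1 by apply/andP; split; lra.
have n0 : (0 < n)%N.
  by case: n mn => // /andP[mn _]; move: mn; rewrite double0; lra.
rewrite -lee_fin -(moment_fin n rw) /wint peakE //.
set X := expR (hlog p n r).
apply: (@le_trans _ _ (\int[dA R]_(q in disc2 1) ((expR 12 * X)%:E * (expR (- (`|normc (cplx q) - r| / (8 * t r))))%:E))%E).
  apply: ge0_le_integral => //.
  - exact: measurable_disc2.
  - by move=> q Dq; rewrite lee_fin mulr_ge0 ?exprn_ge0 ?normc_ge0 ?(rw_ge0 rw).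
  - by apply: (@measurable_wint _ _ _ (fun z => normc z ^+ (2 * n))) => //; exact: measurable_normcX.
  - apply: measurable_funeM; apply/measurable_EFinP; apply: measurableT_comp => //.
    apply: measurableT_comp => //; apply: measurable_funM => //.
    apply: measurableT_comp => //; apply: measurable_funB => //.
    apply: measurable_normc; exact: cmeas_cplx.
  - move=> q Dq; rewrite -EFinM lee_fin.
    have [q0|q0] := eqVneq (normc (cplx q)) 0.
      by rewrite q0 expr0n muln_eq0 /= eqn0Ngt n0 mul0r !mulr_ge0 ?expR_ge0.
    have q01 : 0 < normc (cplx q) < 1 by rewrite lt_def q0 normc_ge0 /=.
    rewrite peakE // -!expRD ler_expR.
    have := peak P h1 h2 h3 mn q01; rewrite -/r; lra.
rewrite ge0_integralZl_EFin ?mulr_ge0 ?expR_ge0 //; [|exact: measurable_disc2|].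
  apply: (@le_trans _ _ ((expR 12 * X)%:E * (32 * disk_area R * (1 - expR (- 1)) ^- 2 * t r)%:E)%E).
    rewrite lee_pmul2l ?lte_fin ?mulr_gt0 ?expR_gt0 //; apply: peak_integral => //.
    by apply/andP; split; lra.
  by rewrite -EFinM lee_fin /peak_const le_eqVlt; apply/orP; left; apply/eqP; ring.
apply/measurable_EFinP; apply: measurableT_comp => //.
apply: measurableT_comp => //; apply: measurable_funM => //.
apply: measurableT_comp => //; apply: measurable_funB => //.
apply: measurable_normc; exact: cmeas_cplx.
Qed.

(** Keep in the diagonal series the indices with peak near normc z: there are about
1 / tau of them, and each contributes at least 1 / (omega tau). *)
Lemma KK_ge z : deep (normc z) -> (4 * peak_const * (omega z * t (normc z) ^+ 2))^-1 <= KK z.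
Proof.
move=> dz; have [t0 ts] := deep_t dz; have [h1 h2 h3 h4] := dz.
have C0 := peak_const_gt0; have w0 := om0 h2; have /andP[q1 _] := r1h.
have z0 : 0 < normc z by lra.
have m0 : 0 <= m (normc z) by lra.
have [a [K [K4 HK]]] := many_peaks P h1 h2 m0.
apply: le_trans (KK_lower rw om0 a (a + K)%N h2).
apply: (@le_trans _ _ (\sum_(a <= n < a + K) (peak_const * omega z * t (normc z))^-1)).
  rewrite sumr_const_nat addKn -[_ *+ K]mulr_natl.
  have -> : (4 * peak_const * (omega z * t (normc z) ^+ 2))^-1 = (4 * t (normc z))^-1 * (peak_const * omega z * t (normc z))^-1.
    by rewrite -invfM; congr (_^-1); ring.
  by rewrite ler_wpM2r // invr_ge0; exact: (ltW (mulr_gt0 (mulr_gt0 C0 w0) t0)).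
rewrite big_nat_cond [leRHS]big_nat_cond; apply: ler_sum => n; rewrite andbT => /HK nn.
have := mom_peak dz nn; have M0 : 0 < mom n by exact: mom_gt0.
have Z0 : 0 < normc z ^+ (2 * n) by rewrite exprn_gt0.
have D0 : 0 < peak_const * omega z * t (normc z) := mulr_gt0 (mulr_gt0 C0 w0) t0.
move=> H; rewrite ler_pdivlMr // mulrC ler_pdivrMr //.
by apply: le_trans H _; rewrite le_eqVlt; apply/orP; left; apply/eqP; ring.
Qed.

Lemma near_deep z v : deep (normc z) -> normc (v - z) <= t (normc z) ->
  [/\ 0 < normc v < 1, `|normc v - normc z| <= normc (v - z),
     7 / 8 * t (normc z) <= t (normc v) <= 9 / 8 * t (normc z) &
     forall n, `|n.*2%:R - m (normc z)| <= 2 ->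
      expR (- 12) * (normc z ^+ (2 * n) * omega z) <= normc v ^+ (2 * n) * omega v <=
      expR 12 * (normc z ^+ (2 * n) * omega z)].
Proof.
move=> dz vz; have [t0 ts] := deep_t dz; have [h1 h2 h3 h4] := dz.
have /andP[q1 _] := r1h.
have d : `|normc v - normc z| <= normc (v - z).
  have := ler_normcB z v; have := ler_normcB v z; rewrite [normc (z - v)]normcB => a b.
  by rewrite ler_norml; apply/andP; split; lra.
have dt : `|normc v - normc z| <= t (normc z) by apply: le_trans vz.
move: (dt); rewrite ler_norml => /andP[d1 d2].
have v01 : 0 < normc v < 1 by apply/andP; split; lra.
split => //.
  have [vz'|zv] := leP (normc v) (normc z).
    have := rp_dec P (_ : r1 <= normc v) vz' h2.
    have := rp_lip P (_ : r1 <= normc v) vz' h2.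
    have rv : r1 <= normc v by lra.
    move=> /(_ rv) a /(_ rv) b; apply/andP; split; lra.
  have v1 : normc v < 1 by case/andP: v01.
  have := rp_dec P h1 (ltW zv) v1; have := rp_lip P h1 (ltW zv) v1.
  by move=> a b; apply/andP; split; lra.
move=> n nn; have z01 : 0 < normc z < 1 by apply/andP; split; lra.
have := plateau P h1 h2 h3 nn dt; rewrite ler_norml => /andP[a b].
by rewrite !peakE // -!expRD !ler_expR; apply/andP; split; lra.
Qed.

Lemma discat_sub z (rho : R) : deep (normc z) -> rho <= t (normc z) -> discat z rho `<=` disc2 1.
Proof.
move=> dz rt q Dq; have [|/andP[]] := @near_deep z (cplx q) dz.
  by apply: le_trans rt; exact: ltW.
by [].
Qed.

Lemma holo_twist f n z (rho : R) : analytic f -> deep (normc z) -> rho <= t (normc z) ->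
  forall w, normc (w - z) < rho -> holo_at (fun v => f v * (v ^+ n)^-1) w.
Proof.
move=> fa dz rt w wz; have [|/andP[w0 w1] _ _ _] := @near_deep z w dz.
  by apply: le_trans rt; exact: ltW.
have wn : w != 0 by rewrite -normc_gt0.
apply: holoM.
  by have := fa w w1; rewrite derivable_cder => -[l fl]; exists l.
by apply: holoV; [rewrite expf_neq0|exact: holoX].
Qed.

(** The sub-mean value property of f(v) v^(-n), with n such that |v^n|^2 omega(v) is
constant up to the factor e^12 on the disk ([plateau]). *)
Lemma local_bound f z (rho : R) : A2 omega f -> deep (normc z) -> 0 < rho <= t (normc z) ->
  ((normc (f z) ^+ 2 * omega z * (rho ^+ 2 * disk_area R))%:E <=
    (expR 12)%:E * \int[dA R]_(q in discat z rho) (normc (f (cplx q)) ^+ 2 * omega (cplx q))%:E)%E.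
Proof.
move=> fA dz /andP[rho0 rt]; have [fa _ _] := fA.
have [h1 h2 h3 h4] := dz; have /andP[q1 _] := r1h.
have m0 : 0 <= m (normc z) by lra.
have [n nn] := near_index m0.
have z0 : 0 < normc z by lra.
pose h v := f v * (v ^+ n)^-1.
have hh := holo_twist n fa dz rt.
have := submean rho0 hh; rewrite -/(h _).
set Y := normc z ^+ (2 * n) * omega z.
have Y0 : 0 < Y by rewrite mulr_gt0 ?exprn_gt0 ?om0.
have hE v : normc (h v) ^+ 2 = normc (f v) ^+ 2 / normc v ^+ (2 * n).
  by rewrite /h normcM normcV normcX exprMn exprVn -exprM [(n * 2)%N]mulnC.
have mD := measurable_discat z rho.
have mf : measurable_fun (discat z rho) (fun q => (normc (f (cplx q)) ^+ 2 * omega (cplx q))%:E).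
  apply: measurable_funS (measurable_int _ (A2_integrable rw fA)) => //; first exact: measurable_disc2.
  exact: discat_sub.
move=> SM.
have : (\int[dA R]_(q in discat z rho) (normc (h (cplx q)) ^+ 2)%:E <=
   \int[dA R]_(q in discat z rho) ((expR 12 / Y)%:E * (normc (f (cplx q)) ^+ 2 * omega (cplx q))%:E))%E.
  apply: ge0_le_integral => //.
  - by move=> q _; rewrite lee_fin sqr_ge0.
  - by apply/measurable_EFinP; exact: measurable_holo_discat.
  - exact: measurable_funeM.
  - move=> q Dq; rewrite -EFinM lee_fin hE.
    have [|/andP[v0 v1] _ _ /(_ n nn) /andP[lo _]] := @near_deep z (cplx q) dz.
      by apply: le_trans rt; exact: ltW.
    rewrite -/Y in lo.
    have V0 : 0 < normc (cplx q) ^+ (2 * n) by rewrite exprn_gt0.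
    rewrite ler_pdivrMr //.
    have -> : expR 12 / Y * (normc (f (cplx q)) ^+ 2 * omega (cplx q)) * normc (cplx q) ^+ (2 * n) =
       normc (f (cplx q)) ^+ 2 * (expR 12 / Y * (normc (cplx q) ^+ (2 * n) * omega (cplx q))) by ring.
    rewrite -[leLHS]mulr1 ler_wpM2l ?sqr_ge0 //.
    have : expR 12 * (expR (- 12) * Y) <= expR 12 * (normc (cplx q) ^+ (2 * n) * omega (cplx q)).
      by rewrite ler_pM2l ?expR_gt0.
    rewrite mulrA -expRD subrr expR0 mul1r => H.
    rewrite -(ler_pM2r Y0) mul1r; apply: le_trans H _.
    by rewrite le_eqVlt; apply/orP; left; apply/eqP; field; rewrite gt_eqF.
rewrite ge0_integralZl_EFin ?divr_ge0 ?expR_ge0 ?(ltW Y0) //; last first.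
  move=> q Dq; rewrite lee_fin mulr_ge0 ?sqr_ge0 // (rw_ge0 rw) //.
  exact: (discat_sub dz rt Dq).
move=> H; have {SM}H := le_trans SM H.
have := lee_wpmul2l (_ : (0 <= Y%:E)%E) H; rewrite lee_fin ltW // => /(_ isT).
rewrite muleA -!EFinM hE.
have -> : Y * (expR 12 / Y) = expR 12 by field; rewrite gt_eqF.
apply: le_trans; rewrite lee_fin le_eqVlt; apply/orP; left; apply/eqP.
by rewrite /Y; field; rewrite gt_eqF // exprn_gt0.
Qed.

(** [local_bound] on the disk of radius tau bounds evaluation at z by the norm. *)
Lemma KK_le z : deep (normc z) -> KK z <= expR 12 / (omega z * t (normc z) ^+ 2 * disk_area R).
Proof.
move=> dz; have [t0 ts] := deep_t dz; have [h1 h2 h3 h4] := dz.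
have w0 := om0 h2; have a0 := disk_area_gt0 R.
apply: KK_upper => // f fA.
have := @local_bound f z (t (normc z)) fA dz; rewrite t0 lexx => /(_ isT) H.
have D0 : 0 < omega z * t (normc z) ^+ 2 * disk_area R by rewrite !mulr_gt0 ?exprn_gt0.
rewrite mulrAC ler_pdivlMr // -lee_fin [(_ * nrm2 f)%:E]EFinM -(nrm2E rw fA).
apply: (@le_trans _ _ ((normc (f z) ^+ 2 * omega z * (t (normc z) ^+ 2 * disk_area R))%:E)).
  by rewrite lee_fin le_eqVlt; apply/orP; left; apply/eqP; ring.
apply: le_trans H _; rewrite lee_pmul2l ?lte_fin ?expR_gt0 //.
apply: ge0_subset_integral; [exact: measurable_discat|exact: measurable_disc2| | |].
- exact: measurable_int (A2_integrable rw fA).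
- by move=> q Dq; rewrite lee_fin mulr_ge0 ?sqr_ge0 // (rw_ge0 rw).
- exact: discat_sub.
Qed.

End KernelSize.

(** * The kernel near the diagonal *)

Section Area.
Variable R : realType.
Local Notation M2 := (measurableTypeR R * measurableTypeR R)%type.

(** dA under a head symbol of its own, to which sigma-finiteness, and with it
Tonelli, can be attached. *)
Definition area (A : set M2) : \bar R := dA R A.

Let area0 : area set0 = 0%E. Proof. exact: measure0. Qed.
Let area_ge0 A : (0 <= area A)%E. Proof. exact: measure_ge0. Qed.
Let area_sadd : semi_sigma_additive area. Proof. exact: measure_semi_sigma_additive. Qed.
HB.instance Definition _ := isMeasure.Build _ M2 R area area0 area_ge0 area_sadd.
Let area_sf : sigma_finite [set: M2] area.
Proof.
exists (fun n => disc2 n.+1%:R).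
  apply/seteqP; split => // p _.
  exists (Num.bound (normc (cplx p))) => //=.
  have := archi_boundP (normc_ge0 (cplx p)) => H.
  by apply: lt_trans H _; rewrite ltr_nat.
move=> i; split; first exact: measurable_disc2.
by change (dA R (disc2 i.+1%:R) < +oo)%E; rewrite dA_discE ?ltry.
Qed.
HB.instance Definition _ := Measure_isSigmaFinite.Build _ M2 R area area_sf.

Lemma integral_area (D : set M2) (f : M2 -> \bar R) : measurable D ->
 (\int[area]_(p in D) f p = \int[dA R]_(p in D) f p)%E.
Proof. by move=> mD; apply: eq_measure_integral. Qed.

(** The product theorem is about functions on a whole product space, so f is
extended by 0 off the rectangle D x E. *)
Lemma tonelli_dA (D E : set M2) (f : M2 -> M2 -> \bar R) : measurable D -> measurable E ->
  measurable_fun (D `*` E) (fun q => f q.1 q.2) -> (forall p q, D p -> E q -> (0 <= f p q)%E) ->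
  [/\ measurable_fun D (fun p => \int[dA R]_(q in E) f p q)%E,
      measurable_fun E (fun q => \int[dA R]_(p in D) f p q)%E &
      (\int[dA R]_(p in D) \int[dA R]_(q in E) f p q = \int[dA R]_(q in E) \int[dA R]_(p in D) f p q)%E].
Proof.
move=> mD mE mf f0; set F := (fun q => f q.1 q.2) \_ (D `*` E).
have mDE : measurable (D `*` E) by exact: measurableX.
have mF : measurable_fun [set: M2 * M2] F.
  by apply/(measurable_restrict _ mDE measurableT); rewrite setTI.
have F0 x : (0 <= F x)%E.
  rewrite /F /patch; case: ifPn => // /set_mem [] Dx Ex; exact: f0.
have := @fubini_tonelli _ _ M2 M2 R area area F mF F0.
have L x : (\int[area]_y F (x, y) = (fun x => \int[dA R]_(q in E) f x q)%E \_ D x)%E.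
  rewrite /patch; case: ifPn => xD.
    rewrite -integral_area // [RHS]integral_mkcond; apply: eq_integral => y _.
    by rewrite /F /patch in_setX xD.
  by apply: integral0_eq => y _; rewrite /F /patch in_setX (negbTE xD).
have L' y : (\int[area]_x F (x, y) = (fun y => \int[dA R]_(p in D) f p y)%E \_ E y)%E.
  rewrite /patch; case: ifPn => yE.
    rewrite -integral_area // [RHS]integral_mkcond; apply: eq_integral => x _.
    by rewrite /F /patch in_setX yE andbT.
  by apply: integral0_eq => x _; rewrite /F /patch in_setX (negbTE yE) andbF.
move=> fub; split.
- have := @measurable_fun_fubini_tonelli_F _ _ M2 M2 R area F mF F0.
  rewrite /fubini_F (_ : (fun x => _) = (fun x => \int[dA R]_(q in E) f x q)%E \_ D); last by apply/funext => x; exact: L.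
  by move/(measurable_restrict _ mD measurableT); rewrite setTI.
- have := @measurable_fun_fubini_tonelli_G _ _ M2 M2 R area F mF F0.
  rewrite /fubini_G (_ : (fun x => _) = (fun y => \int[dA R]_(p in D) f p y)%E \_ E); last by apply/funext => x; exact: L'.
  by move/(measurable_restrict _ mE measurableT); rewrite setTI.
rewrite -(integral_area _ mD) -(integral_area _ mE) [LHS]integral_mkcond [RHS]integral_mkcond.
transitivity (\int[area]_x \int[area]_y F (x, y))%E; first by apply: eq_integral => x _; rewrite L.
by rewrite fub; apply: eq_integral => y _; rewrite L'.
Qed.
End Area.

Ltac pos := match goal with
  | |- is_true (0 <= _) => first [assumption | apply/ltW; assumption | exact: expR_ge0 | exact: normc_ge0
      | exact: sqr_ge0 | exact: ler0n | exact: KK_ge0 | pos_step]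
  | |- is_true (0 < _) => first [assumption | exact: expR_gt0 | exact: ltr0Sn | pos_step]
  end
with pos_step := match goal with
  | |- is_true (0 <= _ * _) => apply: mulr_ge0; pos
  | |- is_true (0 <= _ ^+ _) => apply: exprn_ge0; pos
  | |- is_true (0 <= _^-1) => rewrite invr_ge0; pos
  | |- is_true (0 < _ * _) => apply: mulr_gt0; pos
  | |- is_true (0 < _ ^+ _) => apply: exprn_gt0; pos
  | |- is_true (0 < _^-1) => rewrite invr_gt0; pos
  end.

Section KernelQuotient.
Variables (R : realType) (omega : R[i] -> R).
Hypothesis rw : radial_weight 1 omega.
Hypothesis om0 : forall z, normc z < 1 -> 0 < omega z.
Local Notation bkernel := (Defs.kernel omega).
Local Notation KK := (KK omega).
Local Notation mom := (mom omega).

(** The squared modulus of the normalized kernel at w. *)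
Definition nkernel_sqr (w v : R[i]) : R := normc (bkernel w v) ^+ 2 / KK w.

Lemma nkernel_sqr_ge0 w v : 0 <= nkernel_sqr w v.
Proof. by rewrite /nkernel_sqr divr_ge0 ?sqr_ge0 // KK_ge0. Qed.

Lemma cmeas_kernel d (T : measurableType d) (D : set T) (F G : T -> R[i]) :
  cmeas D F -> cmeas D G -> (forall q, D q -> normc (F q) < 1) -> (forall q, D q -> normc (G q) < 1) ->
  cmeas D (fun q => bkernel (F q) (G q)).
Proof.
move=> mF mG F1 G1.
apply: (@cmeas_pserf _ _ _ D G (fun q n => ((F q)^*%C) ^+ n / (mom n)%:C) (fun q => bkernel (F q)) 1) => //.
  move=> n; apply: cmeasM; last exact: cmeas_cst.
  by apply: cmeasX; exact: cmeas_conj.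
by move=> q Dq; apply: kernel_pser => //; exact: F1.
Qed.

Lemma measurable_nkernel_sqr d (T : measurableType d) (D : set T) (F G : T -> R[i]) : measurable D ->
  cmeas D F -> cmeas D G -> (forall q, D q -> normc (F q) < 1) -> (forall q, D q -> normc (G q) < 1) ->
  measurable_fun D (fun q => nkernel_sqr (F q) (G q)).
Proof.
move=> mD mF mG F1 G1; apply: measurable_funM.
  by apply: measurable_normc2; exact: cmeas_kernel.
apply: (@eq_measurable_fun _ _ _ _ D (fun q => complex.Re (bkernel (F q) (F q)) `^ (- 1))).
  move=> q /set_mem Dq; rewrite KK_self //; last exact: F1.
  by rewrite powRN powRr1 // KK_ge0.
apply: (@measurableT_comp _ _ _ _ _ _ (fun x : R => x `^ (- 1))); first exact: measurable_powR.
by have [] := cmeas_kernel mF mF F1 F1.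
Qed.

End KernelQuotient.

Section Domination.
Variables (R : realType) (omega : R[i] -> R) (p m t : R -> R) (r1 : R).
Local Notation M2 := (measurableTypeR R * measurableTypeR R)%type.
Hypothesis P : regular_profile p m t r1.
Hypothesis rw : radial_weight 1 omega.
Hypothesis omE : forall z, normc z < 1 -> omega z = expR (- p (normc z)).
Local Notation bkernel := (Defs.kernel omega).
Local Notation KK := (KK omega).
Local Notation mom := (mom omega).
Local Notation nrm2 := (nrm2 omega).
Local Notation nkernel_sqr := (nkernel_sqr omega).
Local Notation deep := (deep m t r1).

Let om0 z : normc z < 1 -> 0 < omega z.
Proof. by move=> z1; rewrite omE // expR_gt0. Qed.

(** Chosen so that, at this multiple of tau, the Lipschitz estimate in [near_diag]
costs at most half of the value on the diagonal. *)
Definition diag_radius : R := Num.min 8^-1 (disk_area R * (4 * peak_const R)^-1 / (64 * expR 6 ^+ 3)).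
Definition diag_const : R := (4 * peak_const R)^-1 ^+ 2 * disk_area R * expR (- 12) / (4 * expR 12).

Let c0 : R := (4 * peak_const R)^-1.
Let c00 : 0 < c0. Proof. by rewrite invr_gt0 mulr_gt0 // peak_const_gt0. Qed.

Lemma diag_radius_gt0 : 0 < diag_radius.
Proof.
rewrite lt_min invr_gt0 ltr0n /= divr_gt0 // ?mulr_gt0 ?exprn_gt0 ?expR_gt0 ?disk_area_gt0 //.
Qed.

Lemma diag_const_gt0 : 0 < diag_const.
Proof.
rewrite divr_gt0 ?mulr_gt0 ?exprn_gt0 ?expR_gt0 ?disk_area_gt0 //.
Qed.

Section NearDiagonal.
Variable r2 : R.
Hypotheses (r12 : r1 <= r2 < 1) (H2 : forall s, r2 <= s < 1 -> deep s).

(** On the half disk K_z is bounded through [eval_bound] by the diagonal values at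
z and at w, both of which [KK_le] controls. *)
Lemma kernel_twist_bound z n : (1 + r2) / 2 <= normc z < 1 -> `|n.*2%:R - m (normc z)| <= 2 ->
  forall w, normc (w - z) < t (normc z) / 2 ->
  normc (bkernel z w / w ^+ n) <= 2 * expR 6 ^+ 3 / (disk_area R * t (normc z) ^+ 2 * omega z * normc z ^+ n).
Proof.
move=> /andP[z2 z1] nn w wz; have /andP[r12' r21] := r12.
have dz : deep (normc z) by apply: H2; apply/andP; split; lra.
have [t0 ts] := deep_t P dz; have a0 := disk_area_gt0 R; have w0 := om0 z1.
have wt : normc (w - z) <= t (normc z) by lra.
have [/andP[v0 v1] dv /andP[tl _] /(_ n nn) /andP[lo _]] := near_deep P omE dz wt.
have dw : deep (normc w).
  apply: H2; rewrite v1 andbT; move: dv; rewrite ler_norml => /andP[]; lra.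
have z0 : 0 < normc z by case: dz => ? _ _ _; have /andP[? _] := rp_r1 P; lra.
have ow := om0 v1; have [tw0 _] := deep_t P dw.
have E0 : 0 < expR 6 :> R by exact: expR_gt0.
have E12 : expR 12 = expR 6 ^+ 2 :> R by rewrite -expRM_natl; congr expR; ring.
have Kz := KK_le P rw omE dz; have Kw := KK_le P rw omE dw.
have kA := kernel_A2 rw om0 z1.
have EB := eval_bound rw om0 v1 kA; rewrite -/(KK z) in EB.
rewrite -(ler_pXn2r (n := 2)) ?nnegrE ?normc_ge0 //; last first.
  by rewrite divr_ge0 ?mulr_ge0 ?exprn_ge0 ?normc_ge0 ?(ltW E0) ?(ltW a0) ?(ltW w0) ?(ltW t0).
rewrite normcM normcV normcX exprMn exprVn -exprM [(n * 2)%N]mulnC.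
have V0 : 0 < normc w ^+ (2 * n) by rewrite exprn_gt0.
have Z0 : 0 < normc z ^+ n by rewrite exprn_gt0.
have ZZ : normc z ^+ (2 * n) = (normc z ^+ n) ^+ 2 by rewrite mulnC exprM.
rewrite ler_pdivrMr //; apply: le_trans EB _.
apply: (@le_trans _ _ (expR 12 / (omega z * t (normc z) ^+ 2 * disk_area R) * (expR 12 / (omega w * (t (normc z) ^+ 2 / 4) * disk_area R)))).
  apply: ler_pM => //; [exact: KK_ge0|exact: KK_ge0|].
  apply: le_trans Kw _; rewrite ler_wpM2l ?expR_ge0 // lef_pV2 ?posrE ?mulr_gt0 ?exprn_gt0 ?divr_gt0 ?exprn_gt0 //.
  rewrite ler_pM2r // ler_pM2l //.
  have -> : t (normc z) ^+ 2 / 4 = (t (normc z) / 2) ^+ 2 by field.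
  by rewrite lerXn2r ?nnegrE ?divr_ge0 ?(ltW t0) ?(ltW tw0) //; lra.
have {}lo : normc z ^+ (2 * n) * omega z <= expR 12 * (normc w ^+ (2 * n) * omega w).
  rewrite -(ler_pM2l (expR_gt0 (- 12))) [leRHS]mulrA -expRD addrC subrr expR0 mul1r.
  exact: lo.
rewrite E12 in lo *; rewrite ZZ in lo.
move: (expR 6) (disk_area R) (t (normc z)) (omega z) (omega w) (normc w ^+ (2 * n)) (normc z ^+ n)
  E0 a0 t0 w0 ow V0 Z0 lo => e a T o ow_ V Z e0 a0 T0 o0 ow0 V0 Z0 lo.
have -> : e ^+ 2 / (o * T ^+ 2 * a) * (e ^+ 2 / (ow_ * (T ^+ 2 / 4) * a)) =
   4 * e ^+ 4 / (o * a ^+ 2 * T ^+ 4) * ow_^-1 by field; rewrite !gt_eqF.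
have -> : (2 * e ^+ 3 / (a * T ^+ 2 * o * Z)) ^+ 2 * V = 4 * e ^+ 4 / (o * a ^+ 2 * T ^+ 4) * (e ^+ 2 * V / (o * Z ^+ 2)).
  by field; rewrite !gt_eqF.
rewrite ler_pM2l; last by rewrite divr_gt0 // ?mulr_gt0 ?exprn_gt0.
rewrite ler_pdivlMr ?mulr_gt0 ?exprn_gt0 // mulrC ler_pdivrMr //.
by move: lo; rewrite mulrC [leRHS]mulrA.
Qed.

(** At the center K_z(v) v^(-n) has modulus KK z / |z|^n, and by Cauchy's estimate it
loses at most half of it within diag_radius * tau. *)
Lemma near_diag z v : (1 + r2) / 2 <= normc z < 1 -> normc (v - z) <= diag_radius * t (normc z) ->
  diag_const / (omega v * t (normc z) ^+ 2) <= nkernel_sqr z v.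
Proof.
move=> z21 vz; have /andP[z2 z1] := z21; have /andP[r12' r21] := r12.
have dz : deep (normc z) by apply: H2; apply/andP; split; lra.
have [t0 ts] := deep_t P dz; have a0 := disk_area_gt0 R; have w0 := om0 z1.
have d0 := diag_radius_gt0.
have d8 : diag_radius <= 8^-1 by rewrite /diag_radius ge_min lexx.
have d9 : diag_radius <= disk_area R * c0 / (64 * expR 6 ^+ 3) by rewrite /diag_radius ge_min lexx orbT.
have vt : normc (v - z) <= t (normc z) / 8.
  by apply: le_trans vz _; rewrite [leRHS]mulrC ler_pM2r.
have vt1 : normc (v - z) <= t (normc z) by lra.
have [h1 _ _ h4] := dz; have /andP[q1 _] := rp_r1 P.
have z0 : 0 < normc z by lra.
have [|n nn] := @near_index R m (normc z); first lra.
have [/andP[v0 v1] _ _ /(_ n nn) /andP[lo _]] := near_deep P omE dz vt1.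
have ow := om0 v1.
have kA := kernel_A2 rw om0 z1; have [ka _ _] := kA.
have Kz := KK_le P rw omE dz; have Kl := KK_ge P rw omE dz; have K0 := KK_gt0 rw om0 z1.
set T := t (normc z) in Kz Kl t0 ts vz vt vt1 *.
have E0 : 0 < expR 6 :> R by exact: expR_gt0.
have E12 : expR 12 = expR 6 ^+ 2 :> R by rewrite -expRM_natl; congr expR; ring.
pose h w := bkernel z w / w ^+ n.
have T2 : 0 < T / 2 by lra.
have T2T : T / 2 <= T by lra.
have Z0 : 0 < normc z ^+ n by rewrite exprn_gt0.
pose M := 2 * expR 6 ^+ 3 / (disk_area R * T ^+ 2 * omega z * normc z ^+ n).
have M0 : 0 <= M.
  by rewrite divr_ge0 ?mulr_ge0 ?exprn_ge0 ?normc_ge0 ?(ltW E0) ?(ltW a0) ?(ltW w0) ?(ltW t0).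
have hM : forall w, normc (w - z) < T / 2 -> normc (h w) <= M by exact: kernel_twist_bound.
have hh := holo_twist P omE n ka dz T2T.
have CL := @cauchy_lipschitz R h z (T / 2) M T2 M0 hh hM v.
have {}CL : normc (h v - h z) <= 8 * M / (T / 2) * normc (v - z) by apply: CL; lra.
pose U := (omega z * T ^+ 2 * normc z ^+ n)^-1.
have U0 : 0 < U by rewrite invr_gt0 !mulr_gt0 ?exprn_gt0.
have {}CL : normc (h v - h z) <= c0 / 2 * U.
  apply: le_trans CL _.
  apply: (@le_trans _ _ (8 * M / (T / 2) * (diag_radius * T))).
    by apply: ler_wpM2l vz; pos.
  have -> : 8 * M / (T / 2) * (diag_radius * T) = 32 * expR 6 ^+ 3 / disk_area R * U * diag_radius.
    by rewrite /M /U; field; rewrite !gt_eqF.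
  apply: (@le_trans _ _ (32 * expR 6 ^+ 3 / disk_area R * U * (disk_area R * c0 / (64 * expR 6 ^+ 3)))).
    by apply: ler_wpM2l d9; pos.
  by rewrite le_eqVlt; apply/orP; left; apply/eqP; field; rewrite !gt_eqF.
have hz : c0 * U <= normc (h z).
  rewrite /h normcM normcV normcX /U invfM mulrA ler_wpM2r ?invr_ge0 ?(ltW Z0) //.
  apply: (@le_trans _ _ (KK z)).
    by apply: le_trans Kl; rewrite /c0 -invfM.
  by rewrite -(KK_self rw om0 z1) (le_trans (ler_norm _)) // le_normc_Re.
have hv : c0 / 2 * U <= normc (h v).
  have := ler_normcB (h z) (h v); rewrite normcB; lra.
have V0 : 0 < normc v ^+ (2 * n) by rewrite exprn_gt0.
have kv : normc (bkernel z v) ^+ 2 = normc (h v) ^+ 2 * normc v ^+ (2 * n).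
  rewrite /h normcM normcV normcX exprMn exprVn -exprM [(n * 2)%N]mulnC mulfVK //.
  by rewrite gt_eqF.
have hv2 : (c0 / 2 * U) ^+ 2 <= normc (h v) ^+ 2.
  by rewrite lerXn2r ?nnegrE ?normc_ge0 // mulr_ge0 ?(ltW U0) // divr_ge0 // ltW.
have ZZ : normc z ^+ (2 * n) = (normc z ^+ n) ^+ 2 by rewrite mulnC exprM.
rewrite /nkernel_sqr kv.
apply: (@le_trans _ _ ((c0 / 2 * U) ^+ 2 * normc v ^+ (2 * n) * (omega z * T ^+ 2 * disk_area R / expR 12))).
  have -> : diag_const = c0 ^+ 2 * disk_area R * expR (- 12) / (4 * expR 12) by [].
  rewrite ZZ in lo; rewrite /U.
  move: (expR (- 12)) (expR 12) (expR_gt0 (12 : R)) lo Z0 => e' e e0 lo Z0.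
  move: (normc v ^+ (2 * n)) (normc z ^+ n) V0 Z0 lo => V Z V0 Z0 lo.
  have -> : (c0 / 2 * (omega z * T ^+ 2 * Z)^-1) ^+ 2 * V * (omega z * T ^+ 2 * disk_area R / e) =
    c0 ^+ 2 * disk_area R / (4 * e * T ^+ 2 * omega v) * (V * omega v / (Z ^+ 2 * omega z)) by field; rewrite !gt_eqF.
  have -> : c0 ^+ 2 * disk_area R * e' / (4 * e) / (omega v * T ^+ 2) = c0 ^+ 2 * disk_area R / (4 * e * T ^+ 2 * omega v) * e'.
    by field; rewrite !gt_eqF.
  rewrite ler_wpM2l //.
    by pos.
  by rewrite ler_pdivlMr ?mulr_gt0 ?exprn_gt0.
apply: ler_pM.
- by rewrite mulr_ge0 ?sqr_ge0 // ltW.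
- by pos.
- by rewrite ler_wpM2r // ltW.
- by rewrite -[leLHS]invrK lef_pV2 ?posrE ?invr_gt0 ?divr_gt0 ?mulr_gt0 ?exprn_gt0 ?expR_gt0 // invf_div.
Qed.

End NearDiagonal.

Definition dom_const : R := 8 * expR 12 / (diag_radius ^+ 2 * disk_area R * diag_const).

Lemma dom_const_gt0 : 0 < dom_const.
Proof. by rewrite divr_gt0 ?mulr_gt0 ?exprn_gt0 ?expR_gt0 ?diag_radius_gt0 ?diag_const_gt0 ?disk_area_gt0. Qed.

(** [local_bound] for g on a small disk around v.  On that disk [near_diag] bounds
1 / (omega(v) tau(v)^2) by the squared normalized kernels at v. *)
Lemma domination (r' : R) : r' < 1 -> exists2 r'', 0 < r'' < 1 & forall g v, A2 omega g -> r'' <= normc v < 1 ->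
  ((normc (g v) ^+ 2)%:E <= dom_const%:E *
    \int[dA R]_(q in disc2 1 `\` disc2 r') (normc (g (cplx q)) ^+ 2 * omega (cplx q) * nkernel_sqr (cplx q) v)%:E)%E.
Proof.
move=> r'1; have [r2 r12 H2] := deepP P; have /andP[r12' r21] := r12.
have /andP[q1 _] := rp_r1 P.
pose r3 := Num.max ((1 + r2) / 2) r'.
have r3a : (1 + r2) / 2 <= r3 by rewrite le_max lexx.
have r3b : r' <= r3 by rewrite le_max lexx orbT.
have r31 : r3 < 1 by rewrite gt_max r'1 andbT; lra.
exists ((1 + r3) / 2); first by apply/andP; split; lra.
move=> g v gA /andP[v2 v1]; have [ga _ _] := gA.
have dv : deep (normc v) by apply: H2; apply/andP; split; lra.
have [t0 ts] := deep_t P dv; have a0 := disk_area_gt0 R; have ow := om0 v1.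
have d0 := diag_radius_gt0; have n0 := diag_const_gt0.
have d8 : diag_radius <= 8^-1 by rewrite /diag_radius ge_min lexx.
set T := t (normc v) in t0 ts *.
pose rho := diag_radius / 2 * T.
have rho0 : 0 < rho by rewrite mulr_gt0 ?divr_gt0.
have rhoT : rho <= T / 16.
  rewrite /rho; have : diag_radius * T <= 8^-1 * T by rewrite ler_pM2r.
  lra.
have rhoT1 : rho <= T by lra.
have LB : ((normc (g v) ^+ 2 * omega v * (rho ^+ 2 * disk_area R))%:E <=
    (expR 12)%:E * \int[dA R]_(q in discat v rho) (normc (g (cplx q)) ^+ 2 * omega (cplx q))%:E)%E.
  by apply: (local_bound P rw omE gA dv); rewrite rho0.
set A := disc2 1 `\` disc2 r'.
have mA : measurable A by apply: measurableD; exact: measurable_disc2.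
have AD : A `<=` disc2 1 by exact: subDsetl.
have near q : discat v rho q -> A q /\ normc (v - cplx q) <= diag_radius * t (normc (cplx q)) /\
    (1 + r2) / 2 <= normc (cplx q) < 1 /\ t (normc (cplx q)) ^+ 2 <= 2 * T ^+ 2.
  move=> Dq; have qr : normc (cplx q - v) <= rho by exact: ltW.
  have [/andP[c0' c1'] dq /andP[tl tu] _] := near_deep P omE dv (le_trans qr rhoT1).
  rewrite -/T in tl tu.
  move: dq; rewrite ler_norml => /andP[l1 l2].
  have ql : r3 < normc (cplx q) by lra.
  split; first by split => //; rewrite /disc2 /= => H; lra.
  split.
    rewrite normcB; apply: le_trans qr _; rewrite /rho -mulrA ler_pM2l //; lra.
  split; first by apply/andP; split; lra.
  have tq0 : 0 <= t (normc (cplx q)) by lra.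
  apply: (@le_trans _ _ ((9 / 8 * T) ^+ 2)); first by rewrite lerXn2r ?nnegrE //; lra.
  by rewrite exprMn ler_wpM2r ?sqr_ge0 //; lra.
have DA : discat v rho `<=` A by move=> q /near [].
have mG : measurable_fun (disc2 1) (fun q => (normc (g (cplx q)) ^+ 2 * omega (cplx q))%:E) by exact: measurable_int (A2_integrable rw gA).
have mk : measurable_fun A (fun q => (normc (g (cplx q)) ^+ 2 * omega (cplx q) * nkernel_sqr (cplx q) v)%:E).
  apply/measurable_EFinP; apply: measurable_funM.
    by apply/measurable_EFinP; apply: measurable_funS mG => //; exact: measurable_disc2.
  apply: (@measurable_nkernel_sqr R omega rw om0 _ _ A (@cplx R) (fun=> v)) => //.
  - exact: cmeas_cplx.
  - exact: cmeas_cst.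
have g0 q : A q -> 0 <= normc (g (cplx q)) ^+ 2 * omega (cplx q).
  by move=> /AD Dq; rewrite mulr_ge0 ?sqr_ge0 // (rw_ge0 rw).
have L1 : (\int[dA R]_(q in discat v rho) (normc (g (cplx q)) ^+ 2 * omega (cplx q))%:E <=
   (2 * omega v * T ^+ 2 / diag_const)%:E * \int[dA R]_(q in A) (normc (g (cplx q)) ^+ 2 * omega (cplx q) * nkernel_sqr (cplx q) v)%:E)%E.
  rewrite -ge0_integralZl_EFin //; last 2 first.
  - by move=> q Aq; rewrite lee_fin mulr_ge0 ?g0 // (nkernel_sqr_ge0 rw).
  - by rewrite divr_ge0 ?(ltW n0) // !mulr_ge0 ?sqr_ge0 // ltW.
  apply: (@le_trans _ _ (\int[dA R]_(q in discat v rho) ((2 * omega v * T ^+ 2 / diag_const)%:E * (normc (g (cplx q)) ^+ 2 * omega (cplx q) * nkernel_sqr (cplx q) v)%:E))%E).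
    apply: ge0_le_integral => //.
    - exact: measurable_discat.
    - by move=> q /DA Aq; rewrite lee_fin g0.
    - by apply: measurable_funS mG => //; [exact: measurable_disc2|exact: subset_trans DA AD].
    - by apply: measurable_funeM; apply: measurable_funS mk.
    - move=> q Dq; have [Aq [qv [q2 tt]]] := near q Dq.
      rewrite -EFinM lee_fin mulrCA -[leLHS]mulr1 ler_wpM2l ?g0 //.
      have := near_diag r12 H2 q2 qv => ND.
      have tq0 : 0 < t (normc (cplx q)).
        by have [] // := deep_t P (H2 (normc (cplx q)) _); case/andP: q2 => ? ->; rewrite andbT; lra.
      apply: (@le_trans _ _ (2 * omega v * T ^+ 2 / diag_const * (diag_const / (omega v * t (normc (cplx q)) ^+ 2)))).
        have -> : 2 * omega v * T ^+ 2 / diag_const * (diag_const / (omega v * t (normc (cplx q)) ^+ 2)) = 2 * T ^+ 2 / t (normc (cplx q)) ^+ 2.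
          by field; rewrite !gt_eqF.
        by rewrite ler_pdivlMr ?mul1r // exprn_gt0.
      by rewrite ler_wpM2l // divr_ge0 ?(ltW n0) // !mulr_ge0 ?sqr_ge0 // ltW.
  apply: ge0_subset_integral => //; [exact: measurable_discat|exact: measurable_funeM|].
  move=> q Aq; have q0 := g0 q Aq; have k0 := nkernel_sqr_ge0 rw (cplx q) v.
  by rewrite -EFinM lee_fin; pos.
have := le_trans LB (lee_wpmul2l (_ : (0 <= (expR 12)%:E)%E) L1).
rewrite lee_fin expR_ge0 => /(_ isT).
rewrite muleA -EFinM => {}LB.
pose S := omega v * (rho ^+ 2 * disk_area R).
have S0 : 0 < S by rewrite !mulr_gt0 ?exprn_gt0.
rewrite -(@lee_pmul2l _ S%:E) ?lte_fin // muleA -!EFinM.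
have -> : S * normc (g v) ^+ 2 = normc (g v) ^+ 2 * omega v * (rho ^+ 2 * disk_area R) by rewrite /S; ring.
have -> // : S * dom_const = expR 12 * (2 * omega v * T ^+ 2 / diag_const).
rewrite /S /dom_const /rho; field; rewrite !gt_eqF //.
Qed.

End Domination.

(** * Lower bound for the essential norm *)

Section LowerBound.
Variable R : realType.
Local Notation M2 := (measurableTypeR R * measurableTypeR R)%type.
Variable omega : R[i] -> R.
Hypothesis rw : radial_weight 1 omega.
Hypothesis om0 : forall z, normc z < 1 -> 0 < omega z.
Implicit Types (f g h : R[i] -> R[i]) (z w : R[i]) (N n : nat) (T K : (R[i] -> R[i]) -> (R[i] -> R[i])).
Local Notation bkernel := (Defs.kernel omega).
Local Notation KK := (KK omega).
Local Notation nrm2 := (nrm2 omega).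
Local Notation rip := (rip omega).
Local Notation nrm := (A2norm omega).
Local Notation H2 := (A2 omega).

Lemma lin_0 T : linear_on_A2 omega T -> T (fun=> 0) = (fun=> 0).
Proof.
case=> _ TL; have A0 := A2_0 rw.
have := TL (- 1) _ _ A0 A0.
have -> : (fun z : R[i] => - 1 * (fun=> 0 : R[i]) z + (fun=> 0 : R[i]) z) = (fun=> 0).
  by apply/funext => z /=; rewrite mulr0 addr0.
by move=> H; rewrite H; apply/funext => z; rewrite mulN1r addNr.
Qed.

Lemma lin_Z T a f : linear_on_A2 omega T -> H2 f -> T (fun z => a * f z) = (fun z => a * T f z).
Proof.
move=> L fA; have [_ TL] := L; have := TL a _ _ fA (A2_0 rw).
rewrite (lin_0 L).
have -> : (fun z : R[i] => a * f z + (fun=> 0 : R[i]) z) = (fun z => a * f z).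
  by apply/funext => z /=; rewrite addr0.
by move=> ->; apply/funext => z; rewrite addr0.
Qed.

Lemma lin_D T f g : linear_on_A2 omega T -> H2 f -> H2 g ->
  T (fun z => f z + g z) = (fun z => T f z + T g z).
Proof.
move=> [_ TL] fA gA; have := TL 1 _ _ fA gA.
have -> : (fun z : R[i] => 1 * f z + g z) = (fun z => f z + g z).
  by apply/funext => z; rewrite mul1r.
by move=> ->; apply/funext => z; rewrite mul1r.
Qed.

Lemma lin_B T f g : linear_on_A2 omega T -> H2 f -> H2 g ->
  T (fun z => f z - g z) = (fun z => T f z - T g z).
Proof.
move=> L fA gA; have gN := A2Z rw om0 (- 1) gA.
have -> : (fun z => f z - g z) = (fun z => f z + (fun z => - 1 * g z) z).
  by apply/funext => z; rewrite mulN1r.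
rewrite (lin_D L fA gN) (lin_Z (- 1) L gA).
by apply/funext => z; rewrite mulN1r.
Qed.

Lemma nrmB f g : H2 f -> H2 g -> nrm f <= nrm (fun z => f z - g z) + nrm g.
Proof.
move=> fA gA; have := A2norm_triangle rw om0 (A2B rw om0 fA gA) gA.
by have -> : (fun z => f z - g z + g z) = f by apply/funext => z; rewrite subrK.
Qed.

Lemma nrm_eq0 f : H2 f -> nrm f = 0 -> f = (fun=> 0).
Proof.
move=> fA f0; apply/funext => z; apply: (nrm2_0 rw om0 fA).
by rewrite -(A2norm_sqr rw) f0 expr0n.
Qed.

(** A sequence in the unit ball whose images are unbounded has no convergent
subsequence of images. *)
Lemma compact_bounded K : compact_on_A2 omega K ->
  exists2 B : R, 0 <= B & forall f, H2 f -> nrm (K f) <= B * nrm f.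
Proof.
move=> [L C]; have [LA _] := L.
suff [n Hn] : exists n : nat, forall f, H2 f -> nrm f <= 1 -> nrm (K f) <= n%:R.
  exists n%:R => // f fA; have [f0|f0] := eqVneq (nrm f) 0.
    rewrite {1}(nrm_eq0 fA f0) (lin_0 L) f0 mulr0.
    by rewrite A2norm0.
  have fp : 0 < nrm f by rewrite lt_def f0 A2norm_ge0.
  have gA := A2Z rw om0 ((nrm f)^-1)%:C fA.
  have := Hn _ gA; rewrite (lin_Z _ L fA) (A2normZ rw om0 _ fA) (A2normZ rw om0 _ (LA _ fA)).
  rewrite normc_real ger0_norm ?invr_ge0 ?(ltW fp) // mulVf // lexx => /(_ isT).
  by rewrite mulrC ler_pdivrMr.
apply/not_existsP => H.
have {}H n : exists f, [/\ H2 f, nrm f <= 1 & n%:R < nrm (K f)].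
  apply/not_existsP => H'; apply: (H n) => f fA f1; rewrite leNgt; apply/negP => K1.
  by apply: (H' f).
have [f fP] := choice H.
have [|s [g gA [si sg]]] := C 1 f; first by move=> n; have [] := fP n.
have /cvgr0_norm_le /(_ _ (@ltr01 R)) [N _ HN] := sg.
pose n := maxn N (Num.bound (1 + nrm g)).
have ge_id k : (k <= s k)%N.
  by elim: k => // k ih; apply: leq_ltn_trans ih _; exact: si.
have := HN n (leq_maxl _ _); rewrite ger0_norm ?A2norm_ge0 // => D1.
have [fA _ K1] := fP (s n).
have := nrmB (LA _ fA) gA.
have b0 : 0 <= 1 + nrm g by rewrite addr_ge0 // A2norm_ge0.
have b1 := archi_boundP b0.
have b2 : (Num.bound (1 + nrm g))%:R <= (s n)%:R :> R.
  by rewrite ler_nat (leq_trans _ (ge_id n)) // leq_maxr.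
lra.
Qed.

Lemma nkernelE z : nkernel omega z = (fun w => ((nrm (bkernel z))^-1)%:C * bkernel z w).
Proof. by apply/funext => w; rewrite /nkernel mulrC fmorphV. Qed.

Lemma nrm_kernel z : normc z < 1 -> 0 < nrm (bkernel z).
Proof. by move=> z1; rewrite A2normE sqrtr_gt0; exact: (KK_gt0 rw om0 z1). Qed.

Lemma nkernel_A2 z : normc z < 1 -> H2 (nkernel omega z).
Proof. by move=> z1; rewrite nkernelE; apply: (A2Z rw om0); exact: kernel_A2. Qed.

Lemma nrm_nkernel z : normc z < 1 -> nrm (nkernel omega z) = 1.
Proof.
move=> z1; rewrite nkernelE (A2normZ rw om0 _ (kernel_A2 rw om0 z1)) normc_real.
have k0 := nrm_kernel z1.
by rewrite ger0_norm ?invr_ge0 ?(ltW k0) // mulVf // gt_eqF.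
Qed.

Lemma nkernel_sqrE z w : normc z < 1 -> normc (nkernel omega z w) ^+ 2 = nkernel_sqr omega z w.
Proof.
move=> z1; rewrite nkernelE normcM normc_real exprMn real_normK ?num_real // exprVn.
by rewrite (A2norm_sqr rw) mulrC.
Qed.

Lemma rip_nkernel f z : normc z < 1 -> H2 f -> rip f (nkernel omega z) = complex.Re (f z) / nrm (bkernel z).
Proof.
move=> z1 fA; have kA := kernel_A2 rw om0 z1.
by rewrite nkernelE (ripZr rw _ fA kA) (rip_kernel rw om0 z1 fA) mulrC.
Qed.

Lemma nkernel_weak_null f : H2 f -> exists2 r : R, 0 < r < 1 &
  forall z, r < normc z < 1 -> 2 * rip f (nkernel omega z) <= 1.
Proof.
move=> fA; have q0 : 0 < 4^-1 :> R by rewrite invr_gt0.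
have [r r01 H] := kernel_weak_null rw om0 fA q0; exists r => // z rz.
have /andP[_ z1] := rz; have := H z rz; rewrite -/(KK z) rip_nkernel //.
have k0 := nrm_kernel z1; rewrite -[KK z]/(nrm2 (bkernel z)) -(A2norm_sqr rw (bkernel z)) => F.
have F1 : normc (f z) <= 2^-1 * nrm (bkernel z).
  rewrite -(ler_pXn2r (n := 2)) ?nnegrE ?normc_ge0 //; last by rewrite mulr_ge0 // ltW.
  by rewrite exprMn; apply: le_trans F _; rewrite le_eqVlt; apply/orP; left; apply/eqP; field.
rewrite mulrA ler_pdivrMr // mul1r.
have := le_trans (ler_norm _) (le_normc_Re (f z)); lra.
Qed.

(** Otherwise K x_n -> g along a sequence of normalized kernels, with g nonzero.
As the x_n tend weakly to 0 they can be chosen one after the other almost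
orthogonal to the sum S N of the previous ones; then |S N|^2 <= 2N, while
K (S N) is close to N g, against the boundedness of K. *)
Lemma compact_kills_kernels K (e : R) : compact_on_A2 omega K -> 0 < e ->
  exists2 r : R, 0 < r < 1 & forall z, r < normc z < 1 -> nrm (K (nkernel omega z)) <= e.
Proof.
move=> KC e0; apply: contrapT => H0.
have L := KC.1; have [LA _] := L.
have {}H0 (n : nat) : exists z, [/\ normc z < 1, 1 - n.+2%:R^-1 < normc z & e < nrm (K (nkernel omega z))].
  apply: contrapT => H1; apply: H0.
  have n0 : 0 < n.+2%:R^-1 :> R by rewrite invr_gt0.
  have n1 : n.+2%:R^-1 < 1 :> R by rewrite invf_lt1 // ltr1n.
  exists (1 - n.+2%:R^-1); first by move: n0 n1; set j := n.+2%:R^-1 => n0 n1; apply/andP; split; lra.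
  move=> z /andP[z1 z2]; rewrite leNgt; apply/negP => z3.
  by apply: H1; exists z; split.
have [zz zzP] := choice H0.
pose x n := nkernel omega (zz n).
have z1 n : normc (zz n) < 1 by have [] := zzP n.
have xA n : H2 (x n) by exact: nkernel_A2.
have [|s [g gA [si sg]]] := KC.2 1 (x \o id).
  by move=> n; split; [exact: xA|rewrite nrm_nkernel].
have ge_id k : (k <= s k)%N.
  by elim: k => // k ih; apply: leq_ltn_trans ih _; exact: si.
have e20 : 0 < e / 4 by rewrite divr_gt0.
have /cvgr0_norm_le /(_ _ e20) [N0 _ HN0] := sg.
have {}HN0 n : (N0 <= n)%N -> nrm (fun z => K (x (s n)) z - g z) <= e / 4.
  by move=> /HN0; rewrite ger0_norm ?A2norm_ge0.
have gB : 3 * e / 4 <= nrm g.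
  have := nrmB (LA _ (xA (s N0))) gA; have [_ _] := zzP (s N0).
  have := HN0 N0 (leqnn _); rewrite -/(x (s N0)); lra.
have near f : H2 f -> exists n, (N0 <= n)%N /\ 2 * rip f (x (s n)) <= 1.
  move=> fA; have [r /andP[r0 r1] Hr] := nkernel_weak_null fA.
  pose n := maxn N0 (Num.bound (1 - r)^-1).
  exists n; split; first exact: leq_maxl.
  apply: Hr; rewrite z1 andbT; have [_ zl _] := zzP (s n); apply: le_lt_trans zl.
  have i0 : 0 <= (1 - r)^-1 by rewrite invr_ge0; lra.
  have b1 := archi_boundP i0.
  have : (s n).+2%:R^-1 <= 1 - r.
    rewrite -[1 - r]invrK lef_pV2 ?posrE ?invr_gt0 //; last lra.
    apply: ltW; apply: lt_le_trans b1 _; rewrite ler_nat.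
    by rewrite (leq_trans (leq_maxr N0 _)) // (leq_trans (ge_id _)) // -addn2 leq_addr.
  by move: (_^-1) => j ?; lra.
pose pick f := if pselect (H2 f) is left fA then projT1 (cid (near f fA)) else 0%N.
pose S := fix S N : R[i] -> R[i] := if N is N'.+1 then fun z => S N' z + x (s (pick (S N'))) z else (fun=> 0).
have SA N : H2 (S N).
  by elim: N => [|N ih]; [exact: (A2_0 rw)|exact: (A2D rw om0)].
have pickP N : (N0 <= pick (S N))%N /\ 2 * rip (S N) (x (s (pick (S N)))) <= 1.
  rewrite /pick; case: pselect => [fA|] //; exact: (projT2 (cid (near _ fA))).
have Sn N : nrm2 (S N) <= 2 * N%:R.
  elim: N => [|N ih].
    by rewrite mulr0 /= -(A2norm_sqr rw) A2norm0 expr0n.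
  have [_ Rp] := pickP N; rewrite /= (nrm2D rw om0 (SA N) (xA _)).
  have -> : nrm2 (x (s (pick (S N)))) = 1 by rewrite -(A2norm_sqr rw) nrm_nkernel ?expr1n.
  rewrite -[N.+1%:R]natr1; lra.
have KS N : nrm (fun z => K (S N) z - N%:R * g z) <= N%:R * (e / 4).
  elim: N => [|N ih].
    rewrite /= (lin_0 L) mul0r.
    have -> : (fun z => 0 - 0 * g z) = (fun=> 0) by apply/funext => z; rewrite mul0r subr0.
    by rewrite A2norm0.
  have [Np _] := pickP N; have := HN0 _ Np => Hx.
  rewrite /= (lin_D L (SA N) (xA _)).
  have -> : (fun z => K (S N) z + K (x (s (pick (S N)))) z - N.+1%:R * g z) =
    (fun z => (K (S N) z - N%:R * g z) + (K (x (s (pick (S N)))) z - g z)).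
    by apply/funext => z; rewrite -natr1; ring.
  have A1 : H2 (fun z => K (S N) z - N%:R * g z) by apply: (A2B rw om0 (LA _ (SA N))); exact: (A2Z rw om0).
  have A2' : H2 (fun z => K (x (s (pick (S N)))) z - g z) by exact: (A2B rw om0 (LA _ (xA _)) gA).
  apply: le_trans (A2norm_triangle rw om0 A1 A2') _.
  rewrite -[N.+1%:R]natr1 mulrDl mul1r; exact: lerD.
have [B B0 HB] := compact_bounded KC.
have lowS N : N%:R * (e / 2) <= nrm (K (S N)).
  have A1 := A2Z rw om0 (N%:R)%:C gA.
  have := nrmB A1 (LA _ (SA N)); rewrite (A2normZ rw om0 _ gA) normc_real ger0_norm //.
  have -> : nrm (fun z => (N%:R)%:C * g z - K (S N) z) = nrm (fun z => K (S N) z - N%:R * g z).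
    have A3 : H2 (fun z => K (S N) z - N%:R * g z) by apply: (A2B rw om0 (LA _ (SA N))); exact: (A2Z rw om0).
    rewrite -[RHS]mul1r -[1 in RHS](normc1 R) -[in RHS]normcN -(A2normZ rw om0 _ A3); congr nrm.
    by apply/funext => z; rewrite rmorph_nat; ring.
  have := KS N.
  have : N%:R * (3 * e / 4) <= N%:R * nrm g by rewrite ler_wpM2l.
  lra.
pose N := (Num.bound (8 * B ^+ 2 / e ^+ 2)).+1.
have e2 : 0 < e ^+ 2 by rewrite exprn_gt0.
have b0 : 0 <= 8 * B ^+ 2 / e ^+ 2 by pos.
have NB : 8 * B ^+ 2 < N%:R * e ^+ 2.
  rewrite -ltr_pdivrMr //; apply: lt_trans (archi_boundP b0) _; by rewrite ltr_nat.
have N1 : 0 < N%:R :> R by rewrite ltr0n.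
have : (N%:R * (e / 2)) ^+ 2 <= B ^+ 2 * (2 * N%:R).
  apply: (@le_trans _ _ ((B * nrm (S N)) ^+ 2)).
    rewrite lerXn2r ?nnegrE ?mulr_ge0 ?A2norm_ge0 ?divr_ge0 ?(ltW e0) //.
    exact: le_trans (lowS N) (HB _ (SA N)).
  by rewrite exprMn (A2norm_sqr rw) ler_wpM2l ?sqr_ge0.
have -> : (N%:R * (e / 2)) ^+ 2 = N%:R * (N%:R * e ^+ 2 / 4) by field.
have -> : B ^+ 2 * (2 * N%:R) = N%:R * (8 * B ^+ 2 / 4) by field.
rewrite ler_pM2l //; lra.
Qed.

Lemma berezinE u phi z : normc z < 1 -> berezin omega u phi z = A2normsq omega (wcomp u phi (nkernel omega z)).
Proof.
move=> z1; rewrite /berezin /A2normsq /disk_integral; apply: eq_integral => p /set_mem Dp.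
have -> : wcomp u phi (nkernel omega z) (cplx p) = u (cplx p) * nkernel omega z (phi (cplx p)).
  by rewrite /wcomp /patch mem_set.
have E (a b c : R) : b ^+ 2 * a ^+ 2 * c = (a * b) ^+ 2 * c by ring.
by rewrite [normc (u _ * _)]normcM -E.
Qed.

Lemma opnorm_ge0 T : linear_on_A2 omega T -> (0 <= opnorm omega T)%E.
Proof.
move=> L; apply: (@le_trans _ _ (nrm (T (fun=> 0)))%:E); first by rewrite lee_fin A2norm_ge0.
apply: ereal_sup_ubound; exists (fun=> 0) => //; split; first exact: (A2_0 rw).
by rewrite A2norm0.
Qed.

Lemma lin_sub T K : linear_on_A2 omega T -> linear_on_A2 omega K ->
  linear_on_A2 omega (fun f z => T f z - K f z).
Proof.
move=> [T1 T2] [K1 K2]; split=> [f fA|a f g fA gA].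
  by apply: (A2B rw om0); [exact: T1|exact: K1].
by rewrite T2 // K2 //; apply/funext => z; ring.
Qed.

Lemma essnorm_ge0 T : linear_on_A2 omega T -> (0 <= essnorm omega T)%E.
Proof.
move=> L; apply: le_ereal_inf_tmp => _ [K [LK _] <-]; apply: opnorm_ge0; exact: lin_sub.
Qed.

(** |T k_z| <= |(T - K) k_z| + |K k_z|, and the last term tends to 0. *)
Lemma limsup_le_opnorm u phi K (o : R) : bounded_on_A2 omega (wcomp u phi) -> compact_on_A2 omega K ->
  (opnorm omega (fun f z => wcomp u phi f z - K f z)%R <= o%:E)%E ->
  (berezin_limsup omega u phi <= (o ^+ 2)%:E)%E.
Proof.
move=> [L _] KC Ho; have LK := KC.1.
have o0 : 0 <= o by rewrite -lee_fin; apply: le_trans Ho; apply: opnorm_ge0; exact: lin_sub.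
apply/lee_addgt0Pr => e e0.
pose d := Num.min 1 (e / (2 * o + 1)).
have q0 : 0 < 2 * o + 1 by lra.
have d0 : 0 < d by rewrite lt_min ltr01 divr_gt0.
have d1 : d <= 1 by rewrite ge_min lexx.
have d2 : d * (2 * o + 1) <= e by rewrite -ler_pdivlMr // ge_min lexx orbT.
have [r r01 Hr] := compact_kills_kernels KC d0.
apply: (@le_trans _ _ (ereal_sup [set berezin omega u phi z | z in [set z | r < normc z < 1]])).
  apply: ereal_inf_lbound; exists [set z | r < normc z < 1] => //.
  by exists r => //=; rewrite in_itv.
apply: ge_ereal_sup => _ [z /= rz <-]; have /andP[_ z1] := rz.
have xA := nkernel_A2 z1.
rewrite berezinE // (nrm2E rw (L.1 _ xA)) -(A2norm_sqr rw) -EFinD lee_fin.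
have H1 := nrmB (L.1 _ xA) (LK.1 _ xA).
have H3 : nrm (fun w => wcomp u phi (nkernel omega z) w - K (nkernel omega z) w) <= o.
  rewrite -lee_fin; apply: le_trans Ho; apply: ereal_sup_ubound.
  by exists (nkernel omega z) => //; split => //; rewrite nrm_nkernel.
have := Hr z rz => H4.
apply: (@le_trans _ _ ((o + d) ^+ 2)).
  rewrite lerXn2r ?nnegrE ?A2norm_ge0 //; [by rewrite addr_ge0 // ltW|lra].
nra.
Qed.

Lemma limsup_le_essnorm u phi : bounded_on_A2 omega (wcomp u phi) ->
  (berezin_limsup omega u phi <= essnorm omega (wcomp u phi) ^+ 2)%E.
Proof.
move=> TB; have E0 := essnorm_ge0 TB.1.
move: E0; case EE : (essnorm omega (wcomp u phi)) => [b| |] //; last by move=> _; rewrite expe2 mulyy leey.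
rewrite lee_fin -EFin_expe => b0.
apply/lee_addgt0Pr => e e0.
pose d := Num.min 1 (e / (2 * b + 1)).
have q0 : 0 < 2 * b + 1 by lra.
have d0 : 0 < d by rewrite lt_min ltr01 divr_gt0.
have d1 : d <= 1 by rewrite ge_min lexx.
have d2 : d * (2 * b + 1) <= e by rewrite -ler_pdivlMr // ge_min lexx orbT.
have [|_ [K KC <-] HK] := @lb_ereal_inf_adherent R [set opnorm omega (fun f z => wcomp u phi f z - K f z)%R | K in compact_on_A2 omega] d d0.
  by change (essnorm omega (wcomp u phi) \is a fin_num); rewrite EE.
have {}HK : (opnorm omega (fun f z => wcomp u phi f z - K f z)%R < essnorm omega (wcomp u phi) + d%:E)%E by exact: HK.
rewrite EE -EFinD in HK.
apply: le_trans (limsup_le_opnorm TB KC (ltW HK)) _.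
rewrite -EFinD lee_fin; nra.
Qed.

End LowerBound.

(** * Upper bound for the essential norm *)

Section Subsequences.
Variable R : realType.

Definition vanishes (y : nat -> R) := forall e : R, 0 < e -> exists M, forall n, (M <= n)%N -> y n <= e.

Lemma real_subseq (x : nat -> R) (b : R) : (forall n, `|x n| <= b) ->
  exists s : nat -> nat, {homo s : m n / (m < n)%N} /\ exists c, vanishes (fun n => `|x (s n) - c|).
Proof.
move=> xb.
have [|s si /cvg_ex[c /cvgrPdist_le sc]] := @bolzano_weierstrass R x.
  exists b; split; first exact: num_real.
  by move=> y by_ n _ /=; apply: le_trans (xb n) (ltW by_).
exists s; split.
  move=> m n mn; rewrite ltnNge; apply/negP => H.
  by have := si n m; rewrite !leEnat H leqNgt mn.
exists c => e e0; have [M _ HM] := sc e e0; exists M => n Mn.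
by rewrite distrC; exact: HM.
Qed.

Lemma homo_ge_id (s : nat -> nat) : {homo s : m n / (m < n)%N} -> forall n, (n <= s n)%N.
Proof. by move=> si; elim=> // n ih; apply: leq_ltn_trans ih _; exact: si. Qed.

Lemma complex_subseq (x : nat -> R[i]) (b : R) : (forall n, normc (x n) <= b) ->
  exists s : nat -> nat, {homo s : m n / (m < n)%N} /\ exists c, vanishes (fun n => normc (x (s n) - c)).
Proof.
move=> xb.
have [n|s [si [a sa]]] := @real_subseq (fun n => complex.Re (x n)) b.
  exact: le_trans (le_normc_Re _) (xb n).
have [n|s' [si' [a' sa']]] := @real_subseq (fun n => complex.Im (x (s n))) b.
  exact: le_trans (le_normc_Im _) (xb _).
exists (s \o s'); split; first by move=> m n mn; apply: si; exact: si'.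
exists (a +i* a') => e e0; have e2 : 0 < e / 2 by rewrite divr_gt0.
have [M HM] := sa _ e2; have [M' HM'] := sa' _ e2.
exists (maxn M M') => n; rewrite geq_max => /andP[Mn Mn'].
have := HM _ (leq_trans Mn (homo_ge_id si' n)); have := HM' _ Mn' => H1 H2.
apply: le_trans (normc_le_ReIm _) _; move: H1 H2 => /=.
case: (x (s (s' n))) => c d /=; lra.
Qed.

(** Bolzano-Weierstrass for the first N coordinates, one after the other. *)
Lemma coord_subseq (x : nat -> nat -> R[i]) (b : nat -> R) N : (forall n k, normc (x n k) <= b k) ->
  exists s : nat -> nat, {homo s : m n / (m < n)%N} /\
    exists c : nat -> R[i], forall e : R, 0 < e -> exists M, forall n k, (M <= n)%N -> (k < N)%N ->
      normc (x (s n) k - c k) <= e.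
Proof.
move=> xb; elim: N => [|N [s [si [c sc]]]].
  by exists id; split => //; exists (fun=> 0) => e e0; exists 0%N.
have [n|s' [si' [a sa]]] := @complex_subseq (fun n => x (s n) N) (b N); first exact: xb.
exists (s \o s'); split; first by move=> m n mn; apply: si; exact: si'.
exists (fun k => if (k < N)%N then c k else a) => e e0.
have [M HM] := sc e e0; have [M' HM'] := sa e e0.
exists (maxn M M') => n k; rewrite geq_max ltnS [(k <= N)%N]leq_eqVlt => /andP[Mn Mn'] /orP[/eqP ->|kN].
  by rewrite ltnn; exact: HM'.
by rewrite kN; apply: HM => //; exact: leq_trans Mn (homo_ge_id si' n).
Qed.

End Subsequences.

Section UpperBound.
Variables (R : realType) (omega : R[i] -> R).
Local Notation M2 := (measurableTypeR R * measurableTypeR R)%type.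
Hypothesis rw : radial_weight 1 omega.
Hypothesis om0 : forall z, normc z < 1 -> 0 < omega z.
Implicit Types (f g h : R[i] -> R[i]) (z w : R[i]) (N n : nat) (T K : (R[i] -> R[i]) -> (R[i] -> R[i])).
Local Notation bkernel := (Defs.kernel omega).
Local Notation KK := (KK omega).
Local Notation mom := (mom omega).
Local Notation nrm2 := (nrm2 omega).
Local Notation nrm := (A2norm omega).
Local Notation H2 := (A2 omega).

Lemma polyd_lc a c d N : polyd (fun n => a * c n + d n) N = (fun z : R[i] => a * polyd c N z + polyd d N z).
Proof.
apply/funext => z; rewrite /polyd /patch; case: ifPn => _; first exact: psum_lc.
by rewrite mulr0 addr0.
Qed.

(** The operator only sees the first N Taylor coefficients, which along a bounded
sequence of functions have a convergent subsequence. *)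
Lemma truncation_compact T N : bounded_on_A2 omega T -> compact_on_A2 omega (fun f => T (Sn N f)).
Proof.
move=> [L [M0 TM]]; have [LA LL] := L; split; first split.
- by move=> f fA; apply: LA; exact: (Sn_A2 rw om0).
- move=> a f g fA gA; rewrite -LL; [|exact: (Sn_A2 rw om0)|exact: (Sn_A2 rw om0)].
  by congr T; have := tc_lc a fA gA; rewrite /lc /Sn => ->; exact: polyd_lc.
move=> M f fP.
have M1 : 0 <= M by have [_ H] := fP 0%N; apply: le_trans H; exact: A2norm_ge0.
have mom0 n : 0 < mom n := mom_gt0 rw om0 n.
have [|s [si [c sc]]] := @coord_subseq R (fun n => tc (f n)) (fun k => M / Num.sqrt (mom k)) N.
  move=> n k; have [fA fM] := fP n.
  have sm : 0 < Num.sqrt (mom k) by rewrite sqrtr_gt0.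
  rewrite ler_pdivlMr // -(ler_pXn2r (n := 2)) ?nnegrE ?mulr_ge0 ?normc_ge0 ?(ltW sm) //.
  rewrite exprMn sqr_sqrtr ?(ltW (mom0 k)) //.
  apply: le_trans (tc_bound rw om0 k fA) _; rewrite -(A2norm_sqr rw).
  by rewrite lerXn2r ?nnegrE ?A2norm_ge0.
have pA d := (polyd_A2 rw om0 d N).1.
exists s; exists (T (polyd c N)); first by apply: LA; exact: pA.
split=> //.
pose B := Num.max M0 0.
have B0 : 0 <= B by rewrite le_max lexx orbT.
have TB g : H2 g -> nrm (T g) <= B * nrm g.
  by move=> gA; apply: le_trans (TM _ gA) _; rewrite ler_wpM2r ?A2norm_ge0 // le_max lexx.
pose m := \sum_(k < N) mom k.
have m0 : 0 <= m by apply: sumr_ge0 => k _; exact: ltW.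
apply/cvgr0Pnorm_le => e e0.
pose q := e / (B * Num.sqrt m + 1).
have D0 : 0 < B * Num.sqrt m + 1 by rewrite ltr_wpDl // mulr_ge0 // sqrtr_ge0.
have q0 : 0 < q by rewrite divr_gt0.
have [n0 Hn0] := sc q q0.
exists n0 => // n /= nn0; rewrite ger0_norm ?A2norm_ge0 //.
have fA := (fP (s n)).1; have SA := Sn_A2 rw om0 N (f (s n)).
rewrite -(lin_B rw om0 L SA (pA c)).
have -> : (fun z => Sn N (f (s n)) z - polyd c N z) = polyd (fun k => - 1 * c k + tc (f (s n)) k) N.
  by rewrite polyd_lc; apply/funext => z; rewrite mulN1r addrC.
set d := fun k => _.
apply: le_trans (TB _ (pA d)) _.
have pd : nrm (polyd d N) <= q * Num.sqrt m.
  rewrite -(ler_pXn2r (n := 2)) ?nnegrE ?A2norm_ge0 ?(mulr_ge0 (ltW q0) (sqrtr_ge0 m)) //.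
  rewrite (A2norm_sqr rw) exprMn sqr_sqrtr //.
  apply: le_trans (polyd_A2 rw om0 d N).2 _.
  rewrite /dsum /m mulr_sumr; apply: ler_sum => k _.
  rewrite ler_wpM2r ?(ltW (mom0 k)) // lerXn2r ?nnegrE ?normc_ge0 ?(ltW q0) //.
  by rewrite /d mulN1r addrC; exact: Hn0.
apply: (@le_trans _ _ (B * (q * Num.sqrt m))); first by apply: ler_wpM2l.
have -> : B * (q * Num.sqrt m) = e * (B * Num.sqrt m) / (B * Num.sqrt m + 1).
  by rewrite /q; ring.
rewrite ler_pdivrMr // ler_pM2l // lerDl //.
Qed.

Lemma cmeas_analytic f : analytic f -> cmeas (disc2 1) (fun p => f (cplx p)).
Proof. by move=> fa; apply: (cmeas_pser _ (tcP fa)) => //; exact: cmeas_cplx. Qed.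

Lemma berezinE_sqr u phi z : normc z < 1 -> berezin omega u phi z =
  (\int[dA R]_(p in disc2 1) (normc (u (cplx p)) ^+ 2 * omega (cplx p) * nkernel_sqr omega z (phi (cplx p)))%:E)%E.
Proof.
move=> z1; apply: eq_integral => p _; rewrite (nkernel_sqrE rw _ z1).
by apply: (congr1 EFin); move: (normc _ ^+ 2) (nkernel_sqr _ _ _) (omega _) => a b c; ring.
Qed.

Lemma constant_A2 : exists2 e1, H2 e1 & forall z, normc z < 1 -> e1 z = 1.
Proof.
exists (polyd (fun=> 1) 1); first exact: (polyd_A2 rw om0 _ 1).1.
by move=> z z1; rewrite polydE // /psum big_ord1 expr0 mulr1.
Qed.

Section Split.
Variables u phi : R[i] -> R[i].
Hypothesis ua : analytic u.
Hypothesis pa : analytic phi.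
Hypothesis pD : forall z, disk z -> disk (phi z).
Hypothesis TB : bounded_on_A2 omega (wcomp u phi).
Variable r' r'' C : R.
Hypothesis r''01 : 0 < r'' < 1.
Hypothesis C0 : 0 < C.
Hypothesis dom : forall g v, A2 omega g -> r'' <= normc v < 1 ->
  ((normc (g v) ^+ 2)%:E <= C%:E *
    \int[dA R]_(q in disc2 1 `\` disc2 r') (normc (g (cplx q)) ^+ 2 * omega (cplx q) * nkernel_sqr omega (cplx q) v)%:E)%E.
Let A : set M2 := disc2 1 `\` disc2 r'.
Let E : set M2 := disc2 1 `&` [set p | r'' <= normc (phi (cplx p))].
Let E' : set M2 := disc2 1 `\` [set p | r'' <= normc (phi (cplx p))].

Let mA : measurable A. Proof. by apply: measurableD; exact: measurable_disc2. Qed.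

Let mphi : cmeas (disc2 1) (fun p : M2 => phi (cplx p)). Proof. exact: cmeas_analytic. Qed.
Let mu : measurable_fun (disc2 1) (fun p : M2 => normc (u (cplx p)) ^+ 2 * omega (cplx p)).
Proof.
apply: measurable_funM; first by apply: measurable_normc2; exact: cmeas_analytic.
exact: (rw_meas rw).
Qed.

Let mE : measurable E.
Proof.
have := measurable_normc mphi (measurable_disc2 1) (measurable_itv `[r'', +oo[).
by congr measurable; apply/seteqP; split => p [Dp]; rewrite /= in_itv /= andbT => H; split.
Qed.

Let mE' : measurable E'.
Proof.
have -> : E' = disc2 1 `\` E by apply/seteqP; split => p [Dp H]; split => // H'; apply: H; [case: H'|].
by apply: measurableD => //; exact: measurable_disc2.
Qed.

Let wE g p : disc2 1 p -> wcomp u phi g (cplx p) = u (cplx p) * g (phi (cplx p)).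
Proof. by move=> Dp; rewrite /wcomp /patch mem_set. Qed.

Let mT g : H2 g -> measurable_fun (disc2 1) (fun p : M2 => (normc (wcomp u phi g (cplx p)) ^+ 2 * omega (cplx p))%:E).
Proof. by move=> gA; exact: measurable_int (A2_integrable rw (TB.1.1 _ gA)). Qed.

(** Apply the hypothesis [dom] at v = phi(xi) and exchange the integrals: the
integral in xi is the Berezin transform at w. *)
Lemma outer_part g (S : R) : H2 g -> 0 <= S -> (forall z, r' <= normc z < 1 -> (berezin omega u phi z <= S%:E)%E) ->
  (\int[dA R]_(p in E) (normc (wcomp u phi g (cplx p)) ^+ 2 * omega (cplx p))%:E <= (C * S * nrm2 g)%:E)%E.
Proof.
move=> gA S0 HS.
pose F (p q : M2) : \bar R := (normc (u (cplx p)) ^+ 2 * omega (cplx p) *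
   (normc (g (cplx q)) ^+ 2 * omega (cplx q) * nkernel_sqr omega (cplx q) (phi (cplx p))))%:E.
have AD : A `<=` disc2 1 by exact: subDsetl.
have ED : E `<=` disc2 1 by move=> p [].
have pE p : E p -> normc (phi (cplx p)) < 1 by move=> /ED /pD.
have w0 p : disc2 1 p -> 0 <= omega (cplx p) by move=> Dp; exact: (rw_ge0 rw Dp).
have k0 q v := nkernel_sqr_ge0 rw q v.
have F0 p q : E p -> A q -> (0 <= F p q)%E.
  by move=> /ED /w0 wp /AD /w0 wq; have kq0 := k0 (cplx q) (phi (cplx p)); rewrite lee_fin; pos.
have mG : measurable_fun (disc2 1) (fun q : M2 => normc (g (cplx q)) ^+ 2 * omega (cplx q)).
  by apply/measurable_EFinP; exact: measurable_int (A2_integrable rw gA).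
have mk p : E p -> measurable_fun A (fun q => (normc (g (cplx q)) ^+ 2 * omega (cplx q) * nkernel_sqr omega (cplx q) (phi (cplx p)))%:E).
  move=> Ep; apply/measurable_EFinP; apply: measurable_funM.
    by apply: measurable_funS mG => //; exact: measurable_disc2.
  apply: (@measurable_nkernel_sqr _ _ rw om0 _ _ A (@cplx R) (fun=> phi (cplx p))) => //.
  - exact: cmeas_cplx.
  - exact: cmeas_cst.
  - by move=> q _; exact: pE.
have mF : measurable_fun (E `*` A) (fun q => F q.1 q.2).
  apply/measurable_EFinP.
  have m1 : measurable_fun (E `*` A) (fun q : M2 * M2 => q.1) by apply: measurable_funTS; exact: measurable_fst.
  have m2 : measurable_fun (E `*` A) (fun q : M2 * M2 => q.2) by apply: measurable_funTS; exact: measurable_snd.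
  have s1 : (fun q : M2 * M2 => q.1) @` (E `*` A) `<=` disc2 1 by move=> _ [q [/ED Eq _] <-].
  have s2 : (fun q : M2 * M2 => q.2) @` (E `*` A) `<=` disc2 1 by move=> _ [q [_ /AD Eq] <-].
  apply: measurable_funM; first exact: (measurable_comp (measurable_disc2 1) s1 mu m1).
  apply: measurable_funM; first exact: (measurable_comp (measurable_disc2 1) s2 mG m2).
  apply: (@measurable_nkernel_sqr _ _ rw om0 _ _ (E `*` A) (@cplx R \o snd) ((fun p => phi (cplx p)) \o fst)).
  - exact: measurableX.
  - apply: (cmeas_comp (measurable_disc2 1) _ m2 (cmeas_cplx _)) => q [_ /AD] //.
  - apply: (cmeas_comp (measurable_disc2 1) _ m1 mphi) => q [/ED] //.
  - by move=> q [_ /AD].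
  - by move=> q [/pE].
have TON := tonelli_dA mE mA mF F0.
apply: (@le_trans _ _ (\int[dA R]_(p in E) (C%:E * \int[dA R]_(q in A) F p q))%E).
  apply: ge0_le_integral => //.
  - by move=> p /ED /w0 wp; rewrite lee_fin; pos.
  - by apply: measurable_funS (mT gA) => //; exact: measurable_disc2.
  - by case: TON => mE1 _ _; exact: (measurable_funeM _ mE1).
  - move=> p Ep; rewrite (wE _ (ED _ Ep)) normcM exprMn.
    have wp := w0 _ (ED _ Ep).
    have -> : (\int[dA R]_(q in A) F p q = (normc (u (cplx p)) ^+ 2 * omega (cplx p))%:E *
       \int[dA R]_(q in A) (normc (g (cplx q)) ^+ 2 * omega (cplx q) * nkernel_sqr omega (cplx q) (phi (cplx p)))%:E)%E.
      rewrite -ge0_integralZl_EFin //; [|exact: mk|by pos].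
      by move=> q /AD /w0 wq; have kq0 := k0 (cplx q) (phi (cplx p)); rewrite lee_fin; pos.
    rewrite muleCA mulrAC EFinM; apply: lee_wpmul2l; first by rewrite lee_fin; pos.
    by apply: dom => //; rewrite pE // andbT; case: Ep.
rewrite ge0_integralZl_EFin; [|exact: mE| |case: TON => mE1 _ _; exact: mE1|exact: ltW]; last first.
  by move=> p Ep; apply: integral_ge0 => q Aq; exact: F0.
have [_ _ ->] := TON.
rewrite -mulrA EFinM; apply: lee_wpmul2l; first by rewrite lee_fin ltW.
apply: (@le_trans _ _ (\int[dA R]_(q in A) (S%:E * (normc (g (cplx q)) ^+ 2 * omega (cplx q))%:E))%E).
  apply: ge0_le_integral.
  - exact: mA.
  - by move=> q Aq; apply: integral_ge0 => p Ep; exact: F0.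
  - case: TON => _ mA1 _; exact: mA1.
  - by apply: measurable_funeM; apply/measurable_EFinP; apply: measurable_funS mG => //; exact: measurable_disc2.
  - move=> q Aq; have Dq := AD _ Aq; have wq := w0 _ Dq.
    have q1 : r' <= normc (cplx q) < 1.
      by case: Aq => q1 /negP; rewrite -leNgt => q2; apply/andP.
    apply: (@le_trans _ _ ((normc (g (cplx q)) ^+ 2 * omega (cplx q))%:E * berezin omega u phi (cplx q))%E).
      rewrite berezinE_sqr //.
      have mB : measurable_fun (disc2 1) (fun p => (normc (u (cplx p)) ^+ 2 * omega (cplx p) * nkernel_sqr omega (cplx q) (phi (cplx p)))%:E).
        apply/measurable_EFinP; apply: measurable_funM => //.
        apply: (@measurable_nkernel_sqr _ _ rw om0 _ _ (disc2 1) (fun=> cplx q) (fun p => phi (cplx p))) => //.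
        + exact: measurable_disc2.
        + exact: cmeas_cst.
        + by move=> p /pD.
      have B0 p : disc2 1 p -> (0 <= (normc (u (cplx p)) ^+ 2 * omega (cplx p) * nkernel_sqr omega (cplx q) (phi (cplx p)))%:E)%E.
        by move=> /w0 wp; have kq0 := k0 (cplx q) (phi (cplx p)); rewrite lee_fin; pos.
      rewrite -ge0_integralZl_EFin //; last 2 first.
      + exact: measurable_disc2.
      + by pos.
      have -> : (\int[dA R]_(p in E) F p q = \int[dA R]_(p in E) ((normc (g (cplx q)) ^+ 2 * omega (cplx q))%:E *
         (normc (u (cplx p)) ^+ 2 * omega (cplx p) * nkernel_sqr omega (cplx q) (phi (cplx p)))%:E))%E.
        by apply: eq_integral => p _; rewrite /F -EFinM; apply: (congr1 EFin); ring.
      apply: ge0_subset_integral => //; [exact: measurable_disc2|exact: measurable_funeM|].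
      by move=> p Dp; apply: mule_ge0; [rewrite lee_fin; pos|exact: B0].
    by rewrite muleC; apply: lee_wpmul2r; [rewrite lee_fin; pos|exact: HS].
rewrite ge0_integralZl_EFin //; last 2 first.
- by move=> q /AD /w0 wq; rewrite lee_fin; pos.
- by apply/measurable_EFinP; apply: measurable_funS mG => //; exact: measurable_disc2.
rewrite EFinM; apply: lee_wpmul2l; first by rewrite lee_fin.
rewrite -(nrm2E rw gA); apply: ge0_subset_integral => //.
- exact: measurable_disc2.
- exact/measurable_EFinP.
- by move=> q /w0 wq; rewrite lee_fin; pos.
Qed.

(** Where |phi| < r'' the function g is at most b, so T g is at most b times T 1. *)
Lemma inner_part g e1 (b : R) : H2 g -> H2 e1 -> (forall z, normc z < 1 -> e1 z = 1) ->
  (forall w, normc w <= r'' -> normc (g w) <= b) ->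
  (\int[dA R]_(p in E') (normc (wcomp u phi g (cplx p)) ^+ 2 * omega (cplx p))%:E <=
     (b ^+ 2 * nrm2 (wcomp u phi e1))%:E)%E.
Proof.
move=> gA eA e11 gb; have ED : E' `<=` disc2 1 by move=> p [].
have w0 p : disc2 1 p -> 0 <= omega (cplx p) by move=> Dp; exact: (rw_ge0 rw Dp).
have TA := TB.1.1 _ eA.
rewrite EFinM -(nrm2E rw TA).
apply: (@le_trans _ _ (\int[dA R]_(p in E') ((b ^+ 2)%:E * (normc (wcomp u phi e1 (cplx p)) ^+ 2 * omega (cplx p))%:E))%E).
  apply: ge0_le_integral => //.
  - by move=> p /ED /w0 wp; rewrite lee_fin; pos.
  - by apply: measurable_funS (mT gA) => //; exact: measurable_disc2.
  - by apply: measurable_funeM; apply: measurable_funS (mT eA) => //; exact: measurable_disc2.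
  - move=> p [Dp /negP pr]; have wp := w0 _ Dp; rewrite !wE // -EFinM lee_fin.
    have p1 : normc (phi (cplx p)) < 1 by exact: pD.
    rewrite e11 // mulr1 [normc (u _ * _)]normcM exprMn.
    have E1 (a c d e : R) : 0 <= a -> 0 <= d -> c <= e -> a * c * d <= e * (a * d).
      by move=> a0 d0 ce; rewrite [a * c]mulrC -mulrA ler_wpM2r // mulr_ge0.
    apply: E1 => //; first exact: sqr_ge0.
    have gp : normc (g (phi (cplx p))) <= b by apply: gb; move: pr; rewrite -ltNge => /ltW.
    by rewrite lerXn2r ?nnegrE ?normc_ge0 // (le_trans _ gp) // normc_ge0.
rewrite ge0_integralZl_EFin ?sqr_ge0 //; last 2 first.
- by move=> p /ED /w0 wp; rewrite lee_fin; pos.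
- by apply: measurable_funS (mT eA) => //; exact: measurable_disc2.
apply: lee_wpmul2l; first by rewrite lee_fin sqr_ge0.
apply: ge0_subset_integral => //; [exact: measurable_disc2|exact: mT|].
by move=> p /w0 wp; rewrite lee_fin; pos.
Qed.

(** T - T S_N maps f to T (R_N f), whose norm is split over the two parts of the
disk; the inner part tends to 0 with N. *)
Lemma essnorm_sqr_le (S : R) : 0 <= S -> (forall z, r' <= normc z < 1 -> (berezin omega u phi z <= S%:E)%E) ->
  (essnorm omega (wcomp u phi) ^+ 2 <= (C * S)%:E)%E.
Proof.
move=> S0 HS; have [e1 eA e11] := constant_A2.
have [|B [q [B0 q01 HB]]] := @Rn_small _ _ rw om0 r''; first by case/andP: r''01 => /ltW -> ->.
have L := TB.1; have U0 := nrm2_ge0 rw (wcomp u phi e1).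
apply/lee_addgt0Pr => e e0.
have [N HN] : exists N, forall n, (N <= n)%N -> B ^+ 2 * nrm2 (wcomp u phi e1) * q ^+ n <= e.
  have [N HN] := geom_small (B ^+ 2 * nrm2 (wcomp u phi e1)) q01 e0.
  by exists N => n /HN /ltW.
have {}HN := HN N (leqnn _).
have /andP[q0 q1] := q01.
have main f : H2 f -> nrm f <= 1 -> nrm2 (wcomp u phi (Rn N f)) <= C * S + e.
  move=> fA f1; have gA := Rn_A2 rw om0 N fA; set g := Rn N f in gA *.
  have f20 : nrm2 f <= 1 by rewrite -(A2norm_sqr rw) expr_le1 // A2norm_ge0.
  have g1 : nrm2 g <= 1 by exact: le_trans (nrm2_Rn_le rw om0 N fA) f20.
  have gb w : normc w <= r'' -> normc (g w) <= B * q ^+ N.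
    move=> wr; apply: le_trans (HB f N w fA wr) _.
    by rewrite ler_piMl // mulr_ge0 // exprn_ge0.
  have I1 := outer_part gA S0 HS; have I2 := inner_part gA eA e11 gb.
  rewrite -lee_fin -(nrm2E rw (L.1 _ gA)).
  have -> : A2normsq omega (wcomp u phi g) = (\int[dA R]_(p in E `|` E') (normc (wcomp u phi g (cplx p)) ^+ 2 * omega (cplx p))%:E)%E.
    rewrite /A2normsq /disk_integral; congr (integral _ _ _); apply/seteqP; split => p.
      by move=> Dp; have [H|H] := pselect (r'' <= normc (phi (cplx p))); [left|right].
    by case=> -[].
  have U : E `|` E' = disc2 1.
    apply/seteqP; split => p; first by case=> -[].
    by move=> Dp; have [H|H] := pselect (r'' <= normc (phi (cplx p))); [left|right].
  rewrite ge0_integral_setU //; last 3 first.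
  - by rewrite U; exact: mT.
  - by rewrite U => p Dp; rewrite lee_fin; apply: mulr_ge0; [exact: sqr_ge0|exact: (rw_ge0 rw Dp)].
  - by apply/disj_setPS => p [[_ H] [_ H']].
  apply: le_trans (leeD I1 I2) _; rewrite -EFinD lee_fin; apply: lerD.
    by rewrite ler_piMr // mulr_ge0 // ltW.
  apply: le_trans HN; rewrite exprMn mulrAC -[leRHS]mulrC -[leLHS]mulrC.
  rewrite mulrC [leRHS]mulrC; apply: ler_wpM2l; first by rewrite mulr_ge0 // sqr_ge0.
  by rewrite expr2 ler_piMr ?exprn_ge0 // exprn_ile1 // ltW.
have CS0 : 0 <= C * S + e by rewrite addr_ge0 ?mulr_ge0 // ltW.
pose TN := (fun f (z : R[i]) => wcomp u phi f z - wcomp u phi (Sn N f) z).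
have ON : (opnorm omega TN <= (Num.sqrt (C * S + e))%:E)%E.
  apply: ge_ereal_sup => _ [f [fA f1] <-]; rewrite lee_fin /TN.
  rewrite -(lin_B rw om0 L fA (Sn_A2 rw om0 N f)) -/(Rn N f).
  by rewrite A2normE ler_sqrt //; exact: main.
have EN : (essnorm omega (wcomp u phi) <= (Num.sqrt (C * S + e))%:E)%E.
  apply: le_trans ON; apply: ereal_inf_lbound.
  by exists (fun f => wcomp u phi (Sn N f)); first exact: (truncation_compact N TB).
have E0 := essnorm_ge0 rw om0 L.
apply: (@le_trans _ _ ((Num.sqrt (C * S + e))%:E * (Num.sqrt (C * S + e))%:E)%E).
  by rewrite expe2; apply: lee_pmul.
by rewrite -EFinM -expr2 sqr_sqrtr.
Qed.

End Split.
End UpperBound.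

Section ClassWWeight.
Variables (R : realType) (omega : R[i] -> R).
Hypothesis W : classW omega.

Lemma classW_weight : radial_weight 1 omega.
Proof.
case: W => wi wr [phi _ wE]; split => //.
- by move=> z z1; rewrite wE // expR_ge0.
- by move=> z w z1 zw; apply: wr => //; rewrite /disk /= -zw.
Qed.

(** The Berezin transform is bounded by its supremum S over an annulus r < |z| < 1;
[domination] is used with a larger inner radius, so that only this annulus
enters. *)
Lemma essnorm_le_limsup : exists2 C : R, 0 < C & forall u phi : R[i] -> R[i],
  analytic u -> analytic phi -> (forall z, disk z -> disk (phi z)) -> bounded_on_A2 omega (wcomp u phi) ->
  (essnorm omega (wcomp u phi) ^+ 2 <= C%:E * berezin_limsup omega u phi)%E.
Proof.
have rw := classW_weight; case: W => _ _ [ph phW wE].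
have [r1 P] := classW_profile phW; case: phW => phr _ _ _ _.
have omE z : normc z < 1 -> omega z = expR (- prof ph (normc z)).
  by move=> z1; rewrite wE // (profE phr z1).
have om0 z : normc z < 1 -> 0 < omega z by move=> z1; rewrite omE // expR_gt0.
exists (dom_const R); first exact: dom_const_gt0.
move=> u phi ua pa pD TB; have C0 := dom_const_gt0 R.
rewrite -lee_pdivrMl //; apply: le_ereal_inf_tmp => _ [V [r /= r01 rV] <-].
move: r01; rewrite in_itv /= => /andP[r0 r1'].
rewrite lee_pdivrMl //.
set S := ereal_sup _.
have r'1 : (1 + r) / 2 < 1 by lra.
have HS z : (1 + r) / 2 <= normc z < 1 -> (berezin omega u phi z <= S)%E.
  move=> /andP[z1 z2]; apply: ereal_sup_ubound; exists z => //; apply: rV => /=.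
  by apply/andP; split => //; lra.
have S0 : (0 <= S)%E.
  have zz : normc (((1 + r) / 2)%:C : R[i]) = (1 + r) / 2 by rewrite normc_real ger0_norm //; lra.
  apply: le_trans (HS (((1 + r) / 2)%:C) _); last by rewrite zz lexx.
  apply: integral_ge0 => p Dp; rewrite lee_fin; have := rw_ge0 rw Dp => wp.
  by pos.
have [r'' r''01 dom] := domination P rw omE r'1.
move: S0 HS; case: S => [b| |] //.
  by rewrite lee_fin => b0 HS; rewrite -EFinM; exact: (essnorm_sqr_le rw om0 ua pa pD TB r''01 C0 dom b0 HS).
by move=> _ _; rewrite gt0_muley ?lte_fin // leey.
Qed.

End ClassWWeight.

Theorem theorem4p5 (R : realType) (omega : R[i] -> R) :
  classW omega ->
  exists2 C : R, 1 <= C &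
    forall u phi : R[i] -> R[i],
      analytic u -> analytic phi -> (forall z, disk z -> disk (phi z)) ->
      bounded_on_A2 omega (wcomp u phi) ->
      (berezin_limsup omega u phi <= essnorm omega (wcomp u phi) ^+ 2)%E /\
      (essnorm omega (wcomp u phi) ^+ 2
         <= C%:E * berezin_limsup omega u phi)%E.
Proof.
move=> W; have [C C0 HC] := essnorm_le_limsup W.
have rw := classW_weight W.
have om0 z : normc z < 1 -> 0 < omega z.
  by case: W => _ _ [ph _ wE] z1; rewrite wE // expR_gt0.
exists (Num.max C 1); first by rewrite le_max lexx orbT.
move=> u phi ua pa pD TB.
have low := limsup_le_essnorm rw om0 TB; split => //.
have := HC u phi ua pa pD TB; have [L0|L0] := leP 0%E (berezin_limsup omega u phi).
  by move=> /le_trans; apply; apply: lee_wpmul2r => //; rewrite lee_fin le_max lexx.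
have := essnorm_ge0 rw om0 TB.1 => E0 E1; exfalso.
have : (0 <= essnorm omega (wcomp u phi) ^+ 2)%E by rewrite expe2; exact: mule_ge0.
move=> /le_trans /(_ E1); rewrite leNgt => /negP; apply.
by rewrite pmule_rlt0.
Qed.
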